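(* Let $M$ be a smooth compact Riemannian manifold with $\dim M\ge 2$ and let $f:M\to M$ be a $C^\infty$ diffeomorphism which is minimal and has positive topological entropy. Let $\Omega$ be the suspension manifold of $f$, and let $X$ be the $C^\infty$ vector field on $\Omega$ generating the standard suspension flow of $f$. Then there exist two functions $\alpha,\widehat{\alpha}\in C^\infty(\Omega,[0,1])$ satisfying the following: (1) the vector fields $\alpha X$ and $\widehat{\alpha}X$ induce equivalent flows $\varphi(t)$ and $\widehat{\varphi}(t)$ on $\Omega$; (2) $\varphi(t)$ has zero topological entropy and $\widehat{\varphi}(t)$ has positive topological entropy.
   Context: A diffeomorphism $f:M\to M$ is minimal if all forward orbits are dense in $M$ (equivalently, every closed invariant set is either empty or all of $M$). The suspension manifold of $f$ (with constant roof function $1$) is $\Omega=M\times[0,1]/\sim$, where $(y,1)\sim(f(y),0)$; it is a smooth compact Riemannian manifold. The standard suspension flow $\psi_t$ on $\Omega$ is the $C^\infty$ flow defined by $\psi_t(y,s)=(y,t+s)$ for $0\le t+s<1$ (and extended to all $t\in\mathbb{R}$ using the identification). $X$ is the $C^\infty$ vector field associated with $\psi_t$. For $\alpha\in C^\infty(\Omega,[0,1])$, $\alpha X$ is a $C^\infty$ vector field on $\Omega$ and induces a unique flow. Two flows on a smooth manifold are equivalent if there exists a homeomorphism of the manifold that sends each orbit of one flow onto an orbit of the other flow while preserving the time orientation. The topological entropy of a flow is the topological entropy of its time-1 map. *)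

(* Defs.v *)
From HB Require Import structures.
From mathcomp Require Import all_boot all_order all_algebra generic_quotient.
From mathcomp Require Import all_classical all_reals all_analysis.
From mathcomp Require Import zify lra.
Set Implicit Arguments.
Unset Strict Implicit.
Unset Printing Implicit Defensive.
Import Order.TTheory GRing.Theory Num.Theory numFieldNormedType.Exports.
Local Open Scope classical_set_scope.
Local Open Scope ring_scope.

(** * Smooth maps between open subsets of normed spaces *)

(* The model spaces used below are finite dimensional, where continuity of all
   iterated directional derivatives is the usual C^k condition.  The set [U] is
   always open, so only the values of [f] on [U] matter. *)
Fixpoint Ck {R : realType} {E F : normedModType R} (k : nat) (U : set E)
    (f : E -> F) : Prop :=
  match k with
  | 0 => forall x, U x -> {for x, continuous f}
  | k'.+1 => (forall x, U x -> differentiable f x) /\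
             (forall v, Ck k' U (fun x => 'D_v f x))
  end.

Definition smooth_on {R : realType} {E F : normedModType R} (U : set E)
  (f : E -> F) : Prop := forall k, Ck k U f.

(** * Smooth manifolds *)

Record chart {R : realType} (E : normedModType R) (T : topologicalType) := Chart {
  chart_dom : set T;
  chart_cod : set E;
  chart_map : T -> E;
  chart_inv : E -> T }.

Definition is_chart {R : realType} {E : normedModType R} {T : topologicalType}
    (c : chart E T) : Prop :=
  [/\ open (chart_dom c), open (chart_cod c),
      set_fun (chart_dom c) (chart_cod c) (chart_map c) /\
      set_fun (chart_cod c) (chart_dom c) (chart_inv c),
      (forall p, chart_dom c p -> chart_inv c (chart_map c p) = p) /\
      (forall x, chart_cod c x -> chart_map c (chart_inv c x) = x) &
      (forall p, chart_dom c p -> {for p, continuous (chart_map c)}) /\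
      (forall x, chart_cod c x -> {for x, continuous (chart_inv c)})].

Definition overlap {R : realType} {E : normedModType R} {T : topologicalType}
    (c d : chart E T) : set E :=
  chart_cod c `&` chart_inv c @^-1` chart_dom d.

Definition transition {R : realType} {E : normedModType R}
    {T : topologicalType} (c d : chart E T) : E -> E :=
  chart_map d \o chart_inv c.

(* Smooth manifolds without boundary, modelled on [E]. *)
Record smoothManifold {R : realType} (E : normedModType R) := SmoothManifold {
  mfd_space :> topologicalType;
  atlas : set (chart E mfd_space);
  mfd_hausdorff : hausdorff_space mfd_space;
  mfd_second_countable : @second_countable mfd_space;
  atlas_chart : forall c, atlas c -> is_chart c;
  atlas_cover : \bigcup_(c in atlas) chart_dom c = [set: mfd_space];
  atlas_compatible : forall c d, atlas c -> atlas d ->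
    smooth_on (overlap c d) (transition c d) }.

Definition smooth_map {R : realType} {E F : normedModType R}
    {M : smoothManifold E} {N : smoothManifold F} (f : M -> N) : Prop :=
  continuous f /\
  forall c d, atlas c -> atlas d ->
    smooth_on (chart_cod c `&` (f \o chart_inv c) @^-1` chart_dom d)
              (chart_map d \o f \o chart_inv c).

Record diffeo {R : realType} {E : normedModType R} (M : smoothManifold E) :=
  Diffeo {
  diffeo_fun :> M -> M;
  diffeo_inv : M -> M;
  diffeo_funK : cancel diffeo_fun diffeo_inv;
  diffeo_invK : cancel diffeo_inv diffeo_fun;
  diffeo_smooth : smooth_map diffeo_fun;
  diffeo_inv_smooth : smooth_map diffeo_inv }.

(* [metric c x u v] is the inner product, at the point of coordinates [x] in
   the chart [c], of the tangent vectors with coordinates [u] and [v]. *)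
Record riemannianMetric {R : realType} {E : normedModType R}
    (M : smoothManifold E) := RiemannianMetric {
  metric : chart E M -> E -> E -> E -> R;
  metric_linear : forall c x u, atlas c -> chart_cod c x ->
    linear (metric c x u : E -> R^o);
  metric_sym : forall c x u v, atlas c -> chart_cod c x ->
    metric c x u v = metric c x v u;
  metric_pos : forall c x u, atlas c -> chart_cod c x ->
    u != 0 -> 0 < metric c x u u;
  metric_smooth : forall c u v, atlas c ->
    smooth_on (chart_cod c) (fun x => metric c x u v : R^o);
  metric_compatible : forall c d x u v, atlas c -> atlas d -> overlap c d x ->
    metric c x u v = metric d (transition c d x)
      ('d (transition c d) x u) ('d (transition c d) x v) }.

(** * Topological dynamics *)

Definition minimal {T : topologicalType} (f : T -> T) : Prop :=
  forall x, dense (range (fun n => iter n f x)).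

Section Entropy.
Context (R : realType) {T : topologicalType}.
Local Open Scope ereal_scope.

Definition open_cover (U : set (set T)) : Prop :=
  (forall A, U A -> open A) /\ \bigcup_(A in U) A = [set: T].

Definition min_subcover (U : set (set T)) : \bar R :=
  ereal_inf [set ((size s)%:R : R)%:E | s in
    [set s : seq (set T) | [set` s] `<=` U /\
                           \bigcup_(A in [set` s]) A = [set: T]]].

(* The join of the covers f^{-i}(U) for i < n. *)
Definition iterated_join (f : T -> T) (U : set (set T)) (n : nat) :
    set (set T) :=
  [set B | exists2 A : nat -> set T, (forall i, (i < n)%N -> U (A i)) &
           B = \bigcap_(i in `I_n) (iter i f @^-1` A i)].

(* Adler-Konheim-McAndrew entropy; for compact [T] the sequence converges by
   subadditivity, so its limsup is its limit. *)
Definition cover_entropy (f : T -> T) (U : set (set T)) : \bar R :=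
  limn_esup (fun n =>
    ((n.+1%:R)^-1)%:E * lne (min_subcover (iterated_join f U n.+1))).

Definition topological_entropy (f : T -> T) : \bar R :=
  ereal_sup [set cover_entropy f U | U in open_cover].

End Entropy.
Arguments topological_entropy R {T} f.

Definition is_flow {R : realType} {T : topologicalType}
    (phi : R -> T -> T) : Prop :=
  [/\ continuous (fun tp : R * T => phi tp.1 tp.2),
      (forall p, phi 0 p = p) &
      (forall s t p, phi (s + t) p = phi s (phi t p))].

Definition flow_entropy {R : realType} {T : topologicalType}
  (phi : R -> T -> T) : \bar R := topological_entropy R (phi 1).

Definition orbit {R : realType} {T : topologicalType} (phi : R -> T -> T)
  (p : T) : set T := range (fun t => phi t p).

(* Preservation of the time orientation: along each orbit, [h] intertwines the
   flows up to an increasing continuous change of time. *)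
Definition equivalent_flows {R : realType} {T : topologicalType}
    (phi phi' : R -> T -> T) : Prop :=
  exists h h' : T -> T,
    [/\ continuous h, continuous h', cancel h h', cancel h' h &
     forall p, h @` orbit phi p = orbit phi' (h p) /\
       exists tau : R -> R,
         [/\ continuous tau, {homo tau : s t / s < t} &
             forall t, h (phi t p) = phi' (tau t) (h p)]].

(** * The suspension of a diffeomorphism *)

Definition unit_itv (R : realType) : Type := set_type `[0 : R, 1 : R]%classic.
HB.instance Definition _ (R : realType) := Topological.on (unit_itv R).

Section Suspension.
Context {R : realType} {E : normedModType R} {M : smoothManifold E}
        (f : diffeo M).

Definition suspension_glue (p q : M * unit_itv R) : Prop :=
  [/\ \val p.2 = 1, \val q.2 = 0 & q.1 = f p.1].

(* The equivalence relation generated by [suspension_glue]. *)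
Definition suspension_rel (p q : M * unit_itv R) : bool :=
  `[< [\/ p = q, suspension_glue p q | suspension_glue q p] >].

Lemma suspension_rel_refl : reflexive suspension_rel.
Proof. by move=> p; apply/asboolP; constructor 1. Qed.

Lemma suspension_rel_sym : symmetric suspension_rel.
Proof.
move=> p q; apply/asboolP/asboolP => -[->|g|g];
  by [constructor 1|constructor 2|constructor 3].
Qed.

Lemma suspension_rel_trans : transitive suspension_rel.
Proof.
have inj01 (x y : M * unit_itv R) : x.1 = y.1 -> \val x.2 = \val y.2 -> x = y.
  by case: x y => [a b] [c d] /= -> /val_inj ->.
have n01 : (1 : R) <> 0 by apply/eqP; rewrite oner_eq0.
move=> q p r /asboolP pq /asboolP qr; apply/asboolP.
case: pq qr => [->//|[p1 q0 e1]|[q1 p0 e1]] [<-|[a b e2]|[a b e2]].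
- by constructor 2.
- by case: n01; rewrite -a q0.
- constructor 1; apply: inj01; last by rewrite p1 a.
  by apply: (can_inj (diffeo_funK f)); rewrite -e1 -e2.
- by constructor 3.
- by constructor 1; apply: inj01; [rewrite e1 e2|rewrite p0 b].
- by case: n01; rewrite -q1 b.
Qed.

Canonical suspension_equiv := EquivRel suspension_rel suspension_rel_refl
  suspension_rel_sym suspension_rel_trans.

Definition suspension : Type :=
  quotient_topology {eq_quot suspension_equiv}%qT.
HB.instance Definition _ := Topological.on suspension.
HB.instance Definition _ := Quotient.on suspension.

Definition spi (y : M) (s : unit_itv R) : suspension := \pi_suspension%qT (y, s).

Lemma spi_eq y s z t : spi y s = spi z t <->
  [\/ (y, s) = (z, t), suspension_glue (y, s) (z, t) | suspension_glue (z, t) (y, s)].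
Proof.
rewrite /spi; split => [H|H].
  have /eqmodP : (\pi_{eq_quot suspension_equiv} (y, s) = \pi_{eq_quot suspension_equiv} (z, t))%qT := H.
  by move/asboolP.
have : (\pi_{eq_quot suspension_equiv} (y, s) = \pi_{eq_quot suspension_equiv} (z, t))%qT.
  by apply/eqmodP/asboolP.
exact.
Qed.

Lemma frac_subproof (s : R) : s - (Num.floor s)%:~R \in `[0 : R, 1 : R]%classic.
Proof.
rewrite inE /= in_itv /= subr_ge0 ge_floor /= lerBlDl.
by apply/ltW; have := lt_succ_floor s; rewrite intrD addrC.
Qed.

Definition frac (s : R) : unit_itv R := SigSub (frac_subproof s).

Definition ziter (k : int) : M -> M :=
  match k with
  | Posz n => iter n f
  | Negz n => iter n.+1 (diffeo_inv f)
  end.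

Lemma ziterS k y : ziter (k + 1) y = ziter k (f y).
Proof.
case: k => [n|[|n]].
- have -> : n%:Z + 1 = n.+1 by lia.
  exact: iterSr.
- have -> : Negz 0 + 1 = 0%N by lia.
  by rewrite /= diffeo_funK.
have -> : Negz n.+1 + 1 = Negz n by lia.
by rewrite /ziter !iterSr diffeo_funK.
Qed.

Lemma ziterD k l y : ziter (k + l) y = ziter k (ziter l y).
Proof.
elim/int_ind: l k y => [|n IH|n IH] k y; first by rewrite addr0.
  have -> : k + n.+1%:Z = (k + n) + 1 by lia.
  have -> : n.+1%:Z = n%:Z + 1 by lia.
  by rewrite !ziterS IH.
have := ziterS (k - n.+1%:Z) (diffeo_inv f y).
have -> : k - n.+1%:Z + 1 = k - n%:Z by lia.
rewrite diffeo_invK => <-.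
rewrite IH; congr ziter.
have := ziterS (- n.+1%:Z) (diffeo_inv f y).
by rewrite diffeo_invK => <-; congr ziter; lia.
Qed.

(* The class of (y, s) in M x R under the identification (y, s + 1) ~ (f y, s);
   it agrees with [spi] for s in [0, 1], see [spiR_spi]. *)
Definition spiR (y : M) (s : R) : suspension :=
  spi (ziter (Num.floor s) y) (frac s).

Lemma spiRD y s (k : int) : spiR y (s + k%:~R) = spiR (ziter k y) s.
Proof.
rewrite /spiR (@floorDrz _ s k%:~R) ?floorK; last first.
  exact: intr_int.
rewrite intrKfloor ziterD; congr spi. apply/val_inj => /=.
by rewrite (@floorDrz _ s k%:~R) ?intr_int // intrKfloor intrD; lra.
Qed.

Lemma spiR_spi y (s : unit_itv R) : spiR y (\val s) = spi y s.
Proof.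
have : \val s \in `[0:R,1]%classic := valP s.
rewrite inE /= in_itv /= => /andP[s0 s1].
apply/spi_eq; have [s1'|] := ltP (\val s) 1.
  have fl : Num.floor (\val s) = 0 by apply/eqP; rewrite floor_eq s0 add0r.
  constructor 1; congr pair; first by rewrite fl.
  by apply/val_inj; rewrite /= fl subr0.
move=> s1'; have e : \val s = 1 by apply/eqP; rewrite eq_le s1.
constructor 3; split => //=; rewrite e floor1 //. by rewrite subrr.
Qed.

Definition suspension_flow (t : R) (p : suspension) : suspension :=
  let: (y, s) := repr p in spiR y (t + \val s).

Lemma suspension_flow_spi t y s : suspension_flow t (spi y s) = spiR y (t + \val s).
Proof.
rewrite /suspension_flow; case e : (repr _) => [z u].
have /spi_eq : spi z u = spi y s by rewrite /spi -e reprK.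
case=> [[-> ->]//|[/= u1 s0 ->]|[/= u1 s0 ->]].
  by rewrite u1 s0 addr0 (spiRD _ _ 1).
by rewrite u1 s0 addr0 (spiRD _ _ 1).
Qed.

Lemma suspension_flow_spiR t y s : suspension_flow t (spiR y s) = spiR y (t + s).
Proof.
rewrite {1}/spiR suspension_flow_spi -spiRD /=; congr spiR; lra.
Qed.

(* The chart (y, s) |-> (x, s), x the coordinates of y in the chart [c], on the
   image of chart_dom c x ]a, a + 1[ in the suspension.  On a point [spi y s],
   the representative with last coordinate in [a, a + 1[ is
   (f^k y, s - k) with k the floor of s - a. *)
Definition suspension_chart (c : chart E M) (a : R) :
    chart (E * R^o)%type suspension :=
  let cod := chart_cod c `*` `]a, (a + 1)%R[%classic in
  let inv := fun xs : E * R^o => spiR (chart_inv c xs.1) xs.2 in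
  let map := fun p : suspension =>
    let: (y, s) := repr p in
    let k := Num.floor (\val s - a) in
    (chart_map c (ziter k y), \val s - k%:~R) in
  Chart (inv @` cod) cod map inv.

Definition suspension_atlas : set (chart (E * R^o)%type suspension) :=
  [set suspension_chart ca.1 ca.2 | ca in atlas (s := M) `*` [set: R]].

Definition suspension_smooth (g : suspension -> R) : Prop :=
  forall c, suspension_atlas c ->
    smooth_on (chart_cod c) (g \o chart_inv c : E * R^o -> R^o).

(* Vector fields on the suspension, as derivations acting on functions. *)
Definition vector_field : Type := (suspension -> R) -> suspension -> R.

Definition suspension_field : vector_field :=
  fun g p => derive1 (fun t : R => g (suspension_flow t p) : R^o) 0.

Definition scale_field (alpha : suspension -> R) (V : vector_field) :
  vector_field := fun g p => alpha p * V g p.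

(* [phi] is the flow of [V]: its orbit maps are the integral curves of [V]. *)
Definition induced_flow (V : vector_field) (phi : R -> suspension -> suspension)
    : Prop :=
  is_flow phi /\
  forall g, suspension_smooth g -> forall (p : suspension) (t : R),
    is_derive (t : R^o) (1 : R^o) (fun u : R^o => g (phi u p) : R^o)
              (V g (phi t p)).

End Suspension.

Arguments suspension_flow {R E M} f t p.
Arguments suspension_field {R E M} f g p.

(* Main.v *)
(** Both fields vanish at a single point p = [(x0, 1/2)] of the suspension, so
    they have the same orbits and the identity is an equivalence of their flows.
    What differs is the order of vanishing.  [alpha'] vanishes quadratically: an
    orbit segment passing at distance d from p loses a time of order 1/d.  As
    n >= 2, 1/d is integrable over a two-dimensional slice of possible centres
    x0, and Fatou's lemma yields a centre for which, infinitely often, half of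
    an exponentially large separated set of orbits of length n of [f] is
    traversed in time O(n); hence positive entropy.  [alpha] is the composition
    of a field of the first kind with a function so flat at 0 that the average
    speed along every orbit is 0, uniformly: by minimality every orbit of [f]
    comes close to p within a bounded time.  All orbits then spend almost all of
    their time in any given neighbourhood of p, which forces zero entropy. *)
Require Import Defs.
From mathcomp Require Import finmap.
From mathcomp Require Import all_boot all_order all_algebra.
From mathcomp Require Import all_classical all_reals all_analysis.
From HB Require Import structures.
From mathcomp Require Import generic_quotient measurable_realfun.
From mathcomp Require Import zify ring lra.
Set Implicit Arguments.
Unset Strict Implicit.
Unset Printing Implicit Defensive.
Import Order.TTheory GRing.Theory Num.Theory numFieldNormedType.Exports.
Local Open Scope classical_set_scope.
Local Open Scope ring_scope.

(** * Differential equations on the line and their flows *)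

(** The lift to M x R makes the dynamics one-dimensional: a flow along [alpha X] keeps [y] fixed and
    moves the height [s] by a scalar equation in which [y] is only a parameter.

    The order of the choices matters. Separated sets depend on [f] alone, so they are fixed first
    and the centre is selected from them; the slow field can be built around any centre, which
    avoids circularity. Around that centre one function [q] is built. It is the faster field itself,
    and the slower one is [D 0] composed with [q], so the zeros agree by construction. The flatness
    required of [D] is read off return times to small sublevel sets of [q], hence is known before
    [D] exists.

    The factor 1/8 in [q] bounds the speed: two orbits that share thin slabs at integer times cannot
    drift into different cells, so separation under [f] passes to the flow. Entropy is handled by
    open covers throughout, with rare itineraries counted for the upper bound and separated sets
    relative to a cover for the lower one. *)

Section OneVariable.
Context {R : realType}.
Implicit Types (f g : R -> R).

(** Euler schemes, flat functions and series all come with quadratic error bounds; this turns them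
    into derivatives. *)
Lemma is_derive_quadratic f (x l C d : R) : 0 < d ->
  (forall h, `|h| <= d -> `|f (x + h) - f x - h * l| <= C * h ^+ 2) ->
  is_derive x (1 : R) f l.
Proof.
move=> d0 H.
have H' : h^-1 *: (f (h *: (1 : R) + x) - f x) @[h --> 0^'] --> l.
  apply/cvgrPdist_le => e e0.
  have C0 : 0 < `|C| + 1 by rewrite ltr_wpDl.
  near=> h.
  have hn0 : h != 0 by near: h; exact: nbhs_dnbhs_neq.
  have hd : `|h| <= Num.min d (e / (`|C| + 1)).
    near: h; apply: dnbhs0_le; rewrite lt_min d0 divr_gt0//.
  move: hd; rewrite le_min => /andP[hd he].
  have := H h hd; rewrite [h *: _]mulr1 (addrC h).
  have -> : l - h^-1 *: (f (x + h) - f x) = - (h^-1 * (f (x + h) - f x - h * l)).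
    rewrite /GRing.scale/=. field. exact: hn0.
  move=> B; rewrite normrN normrM normfV mulrC ler_pdivrMr ?normr_gt0//.
  apply: (le_trans B); rewrite -(real_normK (num_real h)) expr2 mulrA ler_wpM2r//.
  rewrite ler_pdivlMr// in he; apply: le_trans he.
  rewrite mulrC ler_wpM2l// (le_trans (ler_norm C))// lerDl//.
by apply: DeriveDef; [apply/cvg_ex; exists l|apply/cvg_lim].
Unshelve. all: by end_near. Qed.

Lemma is_derive_continuous f x l : is_derive x (1 : R) f l -> {for x, continuous f}.
Proof. by move=> [/derivable1_diffP/differentiable_continuous]. Qed.

Lemma mvt f df (a b : R) : a <= b ->
  (forall x, a <= x <= b -> is_derive x (1 : R) f (df x)) ->
  exists2 c, a <= c <= b & f b - f a = df c * (b - a).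
Proof.
move=> ab H; have [||c cab E] := @MVT_segment R f df a b ab.
- by move=> x; rewrite in_itv /= => /andP[? ?]; apply: H; rewrite !ltW.
- apply: derivable_within_continuous => x; rewrite in_itv /= => /H.
  by case.
by exists c => //; move: cab; rewrite in_itv.
Qed.

Lemma mvt_ge f df (a b c : R) : a <= b ->
  (forall x, a <= x <= b -> is_derive x (1 : R) f (df x)) ->
  (forall x, a <= x <= b -> c <= df x) -> c * (b - a) <= f b - f a.
Proof.
move=> ab H Hc; have [d dab ->] := mvt ab H.
by rewrite ler_wpM2r ?subr_ge0//; exact: Hc.
Qed.

Lemma mvt_le f df (a b c : R) : a <= b ->
  (forall x, a <= x <= b -> is_derive x (1 : R) f (df x)) ->
  (forall x, a <= x <= b -> df x <= c) -> f b - f a <= c * (b - a).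
Proof.
move=> ab H Hc; have [d dab ->] := mvt ab H.
by rewrite ler_wpM2r ?subr_ge0//; exact: Hc.
Qed.

Lemma mvt_norm f df (M : R) : (forall x, is_derive x (1 : R) f (df x)) ->
  (forall x, `|df x| <= M) -> forall a b, `|f b - f a| <= M * `|b - a|.
Proof.
move=> H B a b; wlog ab : a b / a <= b.
  move=> W; have [/W//|/ltW/W] := leP a b.
  by rewrite distrC (distrC a).
have [c _ ->] := mvt ab (fun x _ => H x).
by rewrite normrM ler_wpM2r.
Qed.

Lemma le_addgt_pow2 (x b C : R) : (forall m, x <= b + C * 2 ^- m) -> x <= b.
Proof.
move=> H; apply/ler_addgt0Pr => e e0.
have C0 : 0 < `|C| + 1 by rewrite ltr_wpDl.
have [m Hm] : exists m, (`|C| + 1) / e < 2 ^+ m.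
  exists (Num.truncn ((`|C| + 1) / e)).+1.
  apply: (lt_trans (truncnS_gt _)).
  by rewrite -natrX ltr_nat ltn_expl.
apply: (le_trans (H m)); rewrite lerD2l.
apply: (@le_trans _ _ ((`|C| + 1) * 2 ^- m)).
  by rewrite ler_wpM2r ?invr_ge0 ?exprn_ge0// (le_trans (ler_norm _))// lerDl.
rewrite ler_pdivrMr ?exprn_gt0// mulrC -ler_pdivrMr//. exact: ltW.
Qed.

(** [x m + 2 C 2^-m] decreases and [x m - 2 C 2^-m] increases; the limit exists and lies between
    them, which is the error bound. *)
Lemma geometric_cauchy (x : nat -> R) (C : R) :
  (forall m, `|x m.+1 - x m| <= C * 2 ^- m) ->
  forall m, `|limn x - x m| <= 2 * C * 2 ^- m.
Proof.
move=> H.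
have C0 : 0 <= C.
  by have := H 0%N; rewrite expr0 invr1 mulr1; apply: le_trans.
have p2 m : 2 ^- m.+1 = 2 ^- m / 2 :> R by rewrite exprSr invfM.
pose w m := x m + 2 * C * 2 ^- m.
pose v m := x m - 2 * C * 2 ^- m.
have wd : nonincreasing_seq w.
  apply/nonincreasing_seqP => m; rewrite /w p2.
  have := H m; rewrite ler_distl => /andP[_]; lra.
have vd : nondecreasing_seq v.
  apply/nondecreasing_seqP => m; rewrite /v p2.
  have := H m; rewrite ler_distl => /andP[+ _]; lra.
have p0 m : 0 <= 2 * C * 2 ^- m.
  by rewrite mulr_ge0 ?invr_ge0 ?exprn_ge0 ?mulr_ge0.
have vw m : v m <= w m by have := p0 m; rewrite /v /w; lra.
have cw : cvgn w.
  apply: nonincreasing_is_cvgn => //; exists (v 0%N) => _ [m _ <-].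
  exact: le_trans (vd _ _ (leq0n m)) (vw m).
have c0 : 2 * C * 2 ^- m @[m --> \oo] --> 0.
  rewrite -(mulr0 (2 * C)); apply: cvgMr.
  have := @cvg_geometric R 1 (2^-1).
  rewrite ger0_norm// invf_lt1 ?ltr1n// => /(_ isT).
  apply: cvg_trans; apply: near_eq_cvg; near=> m.
  by rewrite /geometric/= mul1r exprVn.
have cx : x @ \oo --> limn w.
  have -> : x = w \- (fun m => 2 * C * 2 ^- m).
    by apply/funext => m; rewrite /w /=; lra.
  by rewrite -[limn w]subr0; exact: cvgB.
have lx : limn x = limn w by exact/cvg_lim.
move=> m; rewrite lx ler_distl; apply/andP; split; last first.
  have := nonincreasing_cvgn_ge wd cw m. by rewrite /w addrC.
rewrite -/(v m).
apply: (limr_ge cw).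
near=> k; apply: le_trans (vw k); apply: vd; near: k; exact: nbhs_infty_ge.
Unshelve. all: by end_near. Qed.

Lemma ode_unique (b : R -> R) (L : R) (v w : R -> R) :
  (forall s s', `|b s - b s'| <= L * `|s - s'|) ->
  (forall t, is_derive t (1 : R) v (b (v t))) ->
  (forall t, is_derive t (1 : R) w (b (w t))) ->
  v 0 = w 0 -> v =1 w.
Proof.
move=> Lb dv dw v0.
(* Gronwall in both time directions: (v - w)^2 exp(-+2Lt) is monotone. *)
have key (e : R) : e = 1 \/ e = -1 -> forall t, 0 <= e * t -> v t = w t.
  move=> He.
  pose g t := (v t - w t) ^+ 2 * expR (e * (- (2 * L)) * t).
  pose dg t := (2 * (v t - w t) * (b (v t) - b (w t)) +
    (v t - w t) ^+ 2 * (e * (- (2 * L)))) * expR (e * (- (2 * L)) * t).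
  have dgP t : is_derive t (1 : R) g (dg t).
    have := dv t; have := dw t => dwt dvt.
    have d1 : is_derive t (1:R) (fun t => (v t - w t) ^+ 2) 
       (2 * (v t - w t) * (b (v t) - b (w t))).
      apply: is_derive_eq (is_deriveM (is_deriveB dvt dwt) (is_deriveB dvt dwt)) _.
      set d : R := v t - w t; set k : R := b (v t) - b (w t).
      by change (d * k + d * k = 2 * d * k); ring.
    have d2 : is_derive t (1:R) (fun t => expR (e * (- (2 * L)) * t))
       ((e * (- (2 * L))) * expR (e * (- (2 * L)) * t)).
      have d3 : is_derive t (1 : R) (fun t => e * (- (2 * L)) * t) (e * (- (2 * L))).
        have := is_deriveZ (e * (- (2 * L))) (is_derive_id t (1:R)).
        by rewrite /GRing.scale /= mulr1.
      apply: (is_derive_eq (is_derive1_comp (is_derive_expR _) d3)).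
      by rewrite mulrC.
    apply: (is_derive_eq (is_deriveM d1 d2)).
    rewrite /GRing.scale /= /dg.
    set x : R := v t - w t; set k : R := b (v t) - b (w t).
    set y : R := expR _; set z : R := e * _.
    by change (x ^+ 2 * (z * y) + y * (2 * x * k) = (2 * x * k + x ^+ 2 * z) * y); ring.
  have e2 : e * e = 1 by case: He => ->; ring.
  have eg t : e * dg t <= 0.
    rewrite /dg mulrA mulr_le0_ge0 ?expR_ge0//.
    have /ler_normlP[h1 h2] : `|(v t - w t) * (b (v t) - b (w t))| <= L * (v t - w t) ^+ 2.
      rewrite normrM -[X in _ <= L * X]ger0_norm ?sqr_ge0// normrX expr2 mulrC.
      by rewrite mulrA ler_wpM2r.
    have -> : e * (2 * (v t - w t) * (b (v t) - b (w t)) +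
      (v t - w t) ^+ 2 * (e * - (2 * L))) =
      2 * (e * ((v t - w t) * (b (v t) - b (w t)))) - 2 * ((e * e) * (L * (v t - w t) ^+ 2)) by ring.
    by rewrite e2; case: He => ->; lra.
  have g0 : g 0 = 0 by rewrite /g v0 subrr expr0n /= mul0r.
  have gle t : 0 <= e * t -> g t <= 0.
    move=> et; case: He et eg => ->; rewrite ?mul1r ?mulN1r ?oppr_ge0 => t0 eg.
      have := mvt_le (c := 0) t0 (fun x _ => dgP x).
      rewrite g0 subr0 mul0r; apply => x _; have := eg x; lra.
    have := mvt_ge (c := 0) t0 (fun x _ => dgP x).
    rewrite g0 mul0r sub0r oppr_ge0; apply => x _; have := eg x; lra.
  move=> t /gle gt; apply/eqP; rewrite -subr_eq0 -sqrf_eq0 eq_le sqr_ge0 andbT.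
  by move: gt; rewrite /g pmulr_lle0// expR_gt0.
move=> t; have [t0|t0] := leP 0 t.
  by apply: (key 1); [left|rewrite mul1r].
by apply: (key (-1)); [right|rewrite mulN1r oppr_ge0 ltW].
Qed.

End OneVariable.

(** * Euler's scheme for a scalar field depending on a parameter *)

Section Euler.
Context {R : realType} {Y : topologicalType}.
Variables (a : Y -> R -> R) (L : R).
Hypothesis L0 : 0 <= L.
Hypothesis a1 : forall y s, `|a y s| <= 1.
Hypothesis aL : forall y s s', `|a y s - a y s'| <= L * `|s - s'|.
Hypothesis ac : continuous (fun p : Y * R => a p.1 p.2).

Definition euler (h : R) (y : Y) (s : R) : R := s + h * a y s.

Lemma lip_iter (G : R -> R) (K : R) k s s' : 0 <= K ->
  (forall s s', `|G s - G s'| <= K * `|s - s'|) ->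
  `|iter k G s - iter k G s'| <= K ^+ k * `|s - s'|.
Proof.
move=> K0 H; elim: k => [|k IH] /=; first by rewrite expr0 mul1r.
by apply: (le_trans (H _ _)); rewrite exprS -mulrA ler_wpM2l.
Qed.

(** Replacing one step costs [d], and each later step expands the error by at most [K]; as [1 <= K],
    every product of such factors is below [K ^+ k]. *)
Lemma telescope_iter (F G : R -> R) (K d : R) k s : 1 <= K ->
  (forall s s', `|G s - G s'| <= K * `|s - s'|) ->
  (forall s, `|F s - G s| <= d) ->
  `|iter k F s - iter k G s| <= k%:R * d * K ^+ k.
Proof.
move=> K1 HG HF; elim: k => [|k IH] /=; first by rewrite subrr normr0 !mul0r.
have K0 : 0 <= K by apply: le_trans K1.
have d0 : 0 <= d by apply: le_trans (HF s).
apply: (le_trans (ler_distD (G (iter k F s)) _ _)).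
have -> : k.+1%:R * d * K ^+ k.+1 = d * K ^+ k.+1 + K * (k%:R * d * K ^+ k).
  by rewrite exprS -addn1 natrD; ring.
apply: lerD; last by apply: (le_trans (HG _ _)); rewrite ler_wpM2l.
by apply: (le_trans (HF _)); rewrite ler_peMr// exprn_ege1.
Qed.

Lemma euler_lip h y s s' : 0 <= h ->
  `|euler h y s - euler h y s'| <= expR (L * h) * `|s - s'|.
Proof.
move=> h0; have -> : euler h y s - euler h y s' = (s - s') + h * (a y s - a y s').
  by rewrite /euler; ring.
apply: (le_trans (ler_normD _ _)); rewrite normrM (ger0_norm h0).
apply: (@le_trans _ _ ((1 + L * h) * `|s - s'|)); last first.
  by rewrite ler_wpM2r// expR_ge1Dx.
by rewrite mulrDl mul1r lerD2l (mulrC L) -mulrA ler_wpM2l.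
Qed.

Lemma euler_iter_lip h y k s s' : 0 <= h ->
  `|iter k (euler h y) s - iter k (euler h y) s'| <= expR (L * (k%:R * h)) * `|s - s'|.
Proof.
move=> h0; have -> : expR (L * (k%:R * h)) = expR (L * h) ^+ k.
  by rewrite -expRM_natl; congr expR; ring.
by apply: lip_iter; [exact: expR_ge0|move=> *; exact: euler_lip].
Qed.

Lemma euler_iter_dist h y k s : 0 <= h ->
  `|iter k (euler h y) s - s| <= k%:R * h.
Proof.
move=> h0; elim: k => [|k IH] /=; first by rewrite subrr normr0 mul0r.
have -> : euler h y (iter k (euler h y) s) - s =
  h * a y (iter k (euler h y) s) + (iter k (euler h y) s - s) by rewrite /euler; ring.
apply: (le_trans (ler_normD _ _)).
rewrite -addn1 natrD mulrDl mul1r addrC lerD// normrM (ger0_norm h0).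
by rewrite ler_piMr.
Qed.

Lemma euler_iter_lin h y k s : 0 <= h ->
  `|iter k (euler h y) s - s - k%:R * h * a y s| <= L * (k%:R * h) ^+ 2.
Proof.
move=> h0; elim: k => [|k IH] /=.
  by rewrite subrr !mul0r subrr normr0 expr0n /= mulr0.
set u := iter k _ s.
have -> : euler h y u - s - k.+1%:R * h * a y s =
  (u - s - k%:R * h * a y s) + h * (a y u - a y s).
  by rewrite /euler -addn1 natrD; ring.
apply: (le_trans (ler_normD _ _)); apply: (le_trans (lerD IH (lexx _))).
rewrite normrM (ger0_norm h0).
have B : h * `|a y u - a y s| <= h * (L * (k%:R * h)).
  rewrite ler_wpM2l//; apply: (le_trans (aL _ _ _)); rewrite ler_wpM2l//.
  exact: euler_iter_dist.
apply: (le_trans (lerD (lexx _) B)); rewrite -(addn1 k) natrD -subr_ge0.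
have -> : L * ((k%:R + 1) * h) ^+ 2 - (L * (k%:R * h) ^+ 2 + h * (L * (k%:R * h))) =
  L * (k%:R * h ^+ 2 + h ^+ 2) by ring.
by rewrite mulr_ge0// addr_ge0 ?sqr_ge0// mulr_ge0 ?sqr_ge0.
Qed.

Let e m : R := 2 ^- m.
Let e0 m : 0 <= e m. Proof. by rewrite invr_ge0 exprn_ge0. Qed.
Let e0' m : 0 < e m. Proof. by rewrite invr_gt0 exprn_gt0. Qed.
Let eS m : e m = 2 * e m.+1.
Proof. by rewrite /e exprS invfM mulVKf. Qed.

Definition dyadic_steps m (t : R) : nat := Num.truncn (t * 2 ^+ m).

Lemma dyadic_steps_bounds m t : 0 <= t ->
  (dyadic_steps m t)%:R * e m <= t < ((dyadic_steps m t)%:R + 1) * e m.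
Proof.
move=> t0; have := @truncn_itv R (t * 2 ^+ m).
rewrite mulr_ge0 ?exprn_ge0// => /(_ isT)/andP[h1 h2].
rewrite /e ler_pdivrMr ?exprn_gt0// ltr_pdivlMr ?exprn_gt0//.
by rewrite h1 /= -(natrD _ _ 1) addn1.
Qed.

Definition euler_flow m t y s := iter (dyadic_steps m t) (euler (e m) y) s.

Lemma euler_iter_near h y (i j : nat) s : 0 <= h ->
  `|iter i (euler h y) s - iter j (euler h y) s| <= `|i%:R - j%:R| * h.
Proof.
move=> h0; wlog ij : i j / (i <= j)%N.
  move=> W; have [/W//|/ltnW/W] := leqP i j.
  by rewrite distrC (distrC i%:R).
rewrite -(subnK ij) iterD distrC; apply: (le_trans (euler_iter_dist _ _ _ h0)).
rewrite natrD ler_wpM2r// -[X in X <= _]normr_nat distrC.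
by rewrite addrK.
Qed.

(** Two half steps differ from a full one by at most [L e_m^2], and about [t / e_m] such errors are
    expanded by at most [exp (L t)]. The summand 1 pays for rounding the number of steps. *)
Lemma euler_flow_cauchy m t y s : 0 <= t ->
  `|euler_flow m.+1 t y s - euler_flow m t y s| <= (L * t * expR (L * t) + 1) * e m.
Proof.
move=> t0; set k := dyadic_steps m t; set k' := dyadic_steps m.+1 t.
have /andP[k1 k2] := dyadic_steps_bounds m t0.
have /andP[k1' k2'] := dyadic_steps_bounds m.+1 t0.
rewrite -/k in k1 k2; rewrite -/k' in k1' k2'.
(* On the finer grid [t] is rounded to [2k] or [2k + 1] steps. *)
have dk : `|k'%:R - (2 * k)%:R| <= (1 : R).
  have E : (k'%:R : R) < 2 * k%:R + 2.
    rewrite -(ltr_pM2r (e0' m.+1)); apply: le_lt_trans k1' _.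
    by apply: (lt_le_trans k2); rewrite (eS m) le_eqVlt; apply/orP; left; apply/eqP; ring.
  have E' : 2 * k%:R < (k'%:R + 1 : R).
    rewrite -(ltr_pM2r (e0' m.+1)); apply: le_lt_trans k2'.
    by apply: le_trans k1; rewrite (eS m) le_eqVlt; apply/orP; left; apply/eqP; ring.
  have {}E : (k' < 2 * k + 2)%N by rewrite -(ltr_nat R) natrD natrM.
  have {}E' : (2 * k < k' + 1)%N by rewrite -(ltr_nat R) natrD natrM.
  have : (k' <= 2 * k + 1)%N by lia.
  have : (2 * k <= k')%N by lia.
  by rewrite -!(ler_nat R) natrD natrM ler_norml => A B; apply/andP; split; lra.
rewrite /euler_flow -/k -/k'.
apply: (le_trans (ler_distD (iter (2 * k) (euler (e m.+1) y) s) _ _)).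
have A1 : `|iter k' (euler (e m.+1) y) s - iter (2 * k) (euler (e m.+1) y) s| <= e m.
  apply: (le_trans (euler_iter_near _ _ _ _ (e0 _))).
  apply: (@le_trans _ _ (1 * e m.+1)); first by rewrite ler_wpM2r.
  by rewrite (eS m) mul1r ler_peMl// ler1n.
have A2 : `|iter (2 * k) (euler (e m.+1) y) s - iter k (euler (e m) y) s| <=
   L * t * expR (L * t) * e m.
  have -> : iter (2 * k) (euler (e m.+1) y) s =
            iter k (fun s => euler (e m.+1) y (euler (e m.+1) y s)) s.
    elim: k {k1 k2 dk A1} => [//|k IH].
    by rewrite mulnS iterD IH.
  apply: le_trans (telescope_iter (K := expR (L * e m)) (d := L * e m ^+ 2) k s _ _ _) _.
  - by rewrite -expR0 ler_expR mulr_ge0.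
  - by move=> *; exact: euler_lip.
  - move=> u; have -> : euler (e m.+1) y (euler (e m.+1) y u) - euler (e m) y u =
      e m.+1 * (a y (euler (e m.+1) y u) - a y u).
      by rewrite /euler (eS m); ring.
    rewrite normrM ger0_norm//.
    have := aL y (euler (e m.+1) y u) u.
    have := euler_iter_dist y 1 u (e0 m.+1).
    rewrite /= mul1r => B1 B2.
    have em : e m.+1 <= e m by rewrite (eS m) ler_peMl// ler1n.
    rewrite expr2 mulrCA ler_pM// (le_trans B2)// ler_wpM2l//.
    exact: le_trans B1 em.
  rewrite -expRM_natl.
  have -> : k%:R * (L * e m ^+ 2) * expR (k%:R * (L * e m)) =
    (L * (k%:R * e m)) * expR (L * (k%:R * e m)) * e m.
    have -> : k%:R * (L * e m) = L * (k%:R * e m) by ring.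
    ring.
  rewrite ler_wpM2r// ler_pM ?mulr_ge0 ?expR_ge0//; first by rewrite ler_wpM2l.
  by rewrite ler_expR ler_wpM2l.
by apply: (le_trans (lerD A1 A2)); rewrite mulrDl mul1r addrC.
Qed.

Definition semiflow t y s := limn (fun m => euler_flow m t y s).

Let K t := 2 * (L * t * expR (L * t) + 1).

Lemma semiflow_approx m t y s : 0 <= t ->
  `|semiflow t y s - euler_flow m t y s| <= K t * e m.
Proof.
move=> t0; apply: (geometric_cauchy (x := fun m => euler_flow m t y s)) => k.
exact: euler_flow_cauchy.
Qed.

Lemma semiflow0 y s : semiflow 0 y s = s.
Proof.
rewrite /semiflow (_ : (fun m => _) = fun=> s) ?lim_cst//.
apply/funext => m; rewrite /euler_flow /dyadic_steps mul0r.
by rewrite truncn0.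
Qed.

Lemma semiflow_lip_time t t' y s : 0 <= t -> 0 <= t' ->
  `|semiflow t y s - semiflow t' y s| <= `|t - t'|.
Proof.
move=> t0 t'0; apply: (le_addgt_pow2 (C := K t + K t' + 1)) => m.
have A := semiflow_approx m y s t0.
have A' := semiflow_approx m y s t'0.
have /andP[k1 k2] := dyadic_steps_bounds m t0.
have /andP[k1' k2'] := dyadic_steps_bounds m t'0.
have B : `|euler_flow m t y s - euler_flow m t' y s| <= `|t - t'| + e m.
  apply: (le_trans (euler_iter_near _ _ _ _ (e0 m))).
  rewrite -{1}(ger0_norm (e0 m)) -normrM mulrBl ler_norml.
  have := ler_norm (t - t'); have := ler_norm (t' - t); rewrite (distrC t').
  by move=> *; apply/andP; split; lra.
apply: (le_trans (ler_distD (euler_flow m t y s) _ _)).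
have := ler_distD (euler_flow m t' y s) (euler_flow m t y s) (semiflow t' y s).
rewrite (distrC (euler_flow m t' y s)) -/(e m).
rewrite !mulrDl mul1r; lra.
Qed.

(** Rounding [t], [t'] and [t + t'] separately shifts the number of steps by a bounded amount, and
    the error of [semiflow t'] grows by at most [exp (L t)]; all discrepancies are of order
    [2^-m]. *)
Lemma semiflowD t t' y s : 0 <= t -> 0 <= t' ->
  semiflow (t + t') y s = semiflow t y (semiflow t' y s).
Proof.
move=> t0 t'0; have tt0 : 0 <= t + t' by rewrite addr_ge0.
apply/eqP; rewrite -subr_eq0 -normr_le0.
apply: (le_addgt_pow2 (C := K (t + t') + K t + expR (L * t) * K t' + 2)) => m.
have A := semiflow_approx m y s tt0.
have A1 := semiflow_approx m y s t'0.
have A2 := semiflow_approx m y (semiflow t' y s) t0.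
set x := semiflow t' y s in A1 A2 *.
set x' := euler_flow m t' y s in A1 *.
have /andP[k1 k2] := dyadic_steps_bounds m t0.
have /andP[k1' k2'] := dyadic_steps_bounds m t'0.
have /andP[k1'' k2''] := dyadic_steps_bounds m tt0.
have A3 : `|euler_flow m t y x - euler_flow m t y x'| <= expR (L * t) * (K t' * e m).
  apply: (@le_trans _ _ (expR (L * t) * `|x - x'|)); last first.
    by rewrite ler_wpM2l// expR_ge0.
  apply: (le_trans (euler_iter_lip _ _ _ _ (e0 m))); rewrite ler_wpM2r//.
  by rewrite ler_expR ler_wpM2l.
have A4 : `|euler_flow m (t + t') y s - euler_flow m t y x'| <= 2 * e m.
  rewrite /x' /euler_flow -iterD.
  apply: (le_trans (euler_iter_near _ _ _ _ (e0 m))).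
  rewrite -{1}(ger0_norm (e0 m)) -normrM mulrBl natrD mulrDl ler_norml.
  move: k1 k2 k1' k2' k1'' k2''; rewrite !(mulrDl _ 1) !mul1r => *.
  by apply/andP; split; lra.
have T1 := ler_distD (euler_flow m (t + t') y s) (semiflow (t + t') y s) (semiflow t y x).
have T2 := ler_distD (euler_flow m t y x') (euler_flow m (t + t') y s) (semiflow t y x).
have T3 := ler_distD (euler_flow m t y x) (euler_flow m t y x') (semiflow t y x).
rewrite (distrC _ (euler_flow m t y x)) (distrC (euler_flow m t y x) (semiflow t y x)) in T3.
rewrite -/(e m) !mulrDl add0r -mulrA; lra.
Qed.

(** The derivative at time 0, in quadratic form; the group law carries it to every time. *)
Lemma semiflow_lin t y s : 0 <= t ->
  `|semiflow t y s - s - t * a y s| <= L * t ^+ 2.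
Proof.
move=> t0; apply: (le_addgt_pow2 (C := K t + 1)) => m.
have A := semiflow_approx m y s t0.
have /andP[k1 k2] := dyadic_steps_bounds m t0.
have := euler_iter_lin y (dyadic_steps m t) s (e0 m).
rewrite -/(euler_flow m t y s); set u := euler_flow _ _ _ _.
set d := _%:R * _ in k1 *.
have d0 : 0 <= d by rewrite mulr_ge0.
move=> B.
have -> : semiflow t y s - s - t * a y s = (semiflow t y s - u) +
  ((u - s - d * a y s) + ((d - t) * a y s)) by ring.
apply: (le_trans (ler_normD _ _)).
have B1 : L * d ^+ 2 <= L * t ^+ 2.
  by rewrite ler_wpM2l// ler_pXn2r// nnegrE.
have B2 : `|(d - t) * a y s| <= e m.
  rewrite normrM -[X in _ <= X]mulr1 ler_pM//.
  move: k2; rewrite mulrDl mul1r -/d ler_norml => k2.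
  by apply/andP; split; have := e0 m; lra.
have := ler_normD (u - s - d * a y s) ((d - t) * a y s).
rewrite -/(e m); lra.
Qed.

(** A uniform limit of continuous maps: the error [K t * e m] does not depend on the point. *)
Lemma semiflow_continuous t : 0 <= t ->
  continuous (fun p : Y * R => semiflow t p.1 p.2).
Proof.
move=> t0 p; apply/cvgrPdist_le => d d0.
have [m Hm] : exists m, 2 * K t * e m <= d / 2.
  have K0 : 0 <= K t by rewrite /K mulr_ge0// addr_ge0// mulr_ge0 ?mulr_ge0 ?expR_ge0.
  exists (Num.truncn (2 * K t / (d / 2))).+1.
  rewrite ler_pdivrMr ?exprn_gt0// [X in _ <= X]mulrC -ler_pdivrMr ?divr_gt0//.
  apply: ltW; apply: (lt_trans (truncnS_gt _)).
  move: (Num.truncn _).+1 => N. by rewrite -natrX ltr_nat ltn_expl.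
have ce : continuous (fun p : Y * R => euler_flow m t p.1 p.2).
  rewrite /euler_flow; move: (dyadic_steps m t) => k; elim: k => [|k IH] /= q.
    exact: cvg_snd.
  apply: cvgD; first exact: IH.
  apply: cvgM; first exact: cvg_cst.
  apply: (@continuous_comp _ _ _ (fun p : Y * R => (p.1, iter k (euler (e m) p.1) p.2))
    (fun p => a p.1 p.2)); last exact: ac.
  exact: (cvg_pair (F := nbhs q) (f := fst) (cvg_fst (F := nbhs q.1)) (IH q)).
have /cvgrPdist_le/(_ (d / 2)) := ce p.
rewrite divr_gt0// => /(_ isT); apply: filterS => q Hq.
have A := semiflow_approx m p.1 p.2 t0.
have A' := semiflow_approx m q.1 q.2 t0.
have T1 := ler_distD (euler_flow m t p.1 p.2) (semiflow t p.1 p.2) (semiflow t q.1 q.2).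
have T2 := ler_distD (euler_flow m t q.1 q.2) (euler_flow m t p.1 p.2) (semiflow t q.1 q.2).
rewrite (distrC (euler_flow m t q.1 q.2) (semiflow t q.1 q.2)) in T2; lra.
Qed.

End Euler.

(** An Euler step of [- a] undoes one of [a] up to [L h^2]; over [t / h] steps these errors add up
    to order [h]. This provides the negative times of the flow. *)
Lemma semiflow_inverse (R : realType) (Y : topologicalType)
  (a : Y -> R -> R) (L : R) (L0 : 0 <= L) (a1 : forall y s, `|a y s| <= 1)
  (aL : forall y s s', `|a y s - a y s'| <= L * `|s - s'|) t y s : 0 <= t ->
  semiflow (fun y s => - a y s) t y (semiflow a t y s) = s.
Proof.
move=> t0; set b := fun y s => - a y s.
have b1 y' s' : `|b y' s'| <= 1 by rewrite normrN.
have bL y' s1 s2 : `|b y' s1 - b y' s2| <= L * `|s1 - s2|.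
  by rewrite /b -opprD normrN.
pose K := 2 * (L * t * expR (L * t) + 1).
apply/eqP; rewrite -subr_eq0 -normr_le0.
apply: (le_addgt_pow2 (C := K + expR (L * t) * K + L * t * expR (L * t))) => m.
have A := semiflow_approx L0 a1 aL m y s t0.
have A' := semiflow_approx L0 b1 bL m y (semiflow a t y s) t0.
rewrite -/K in A A'.
set x := semiflow a t y s in A A' *.
set x' := euler_flow a m t y s in A *.
have em0 : 0 <= 2 ^- m :> R by rewrite invr_ge0 exprn_ge0.
have /andP[k1 k2] := dyadic_steps_bounds m t0.
set k := dyadic_steps m t in k1 k2.
have A3 : `|euler_flow b m t y x - euler_flow b m t y x'| <= expR (L * t) * (K * 2 ^- m).
  apply: (@le_trans _ _ (expR (L * t) * `|x - x'|)); last first.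
    by rewrite ler_wpM2l// expR_ge0.
  apply: (le_trans (euler_iter_lip bL _ _ _ _ em0)); rewrite ler_wpM2r//.
  by rewrite ler_expR ler_wpM2l.
have A4 : `|euler_flow b m t y x' - s| <= L * t * expR (L * t) * 2 ^- m.
  rewrite /x' /euler_flow -/k.
  have H j : (j <= k)%N -> `|iter j (euler b (2 ^- m) y) (iter j (euler a (2 ^- m) y) s) - s|
      <= j%:R * (expR (L * t) * (L * (2 ^- m) ^+ 2)).
    elim: j => [|j IH] jk; first by rewrite /= subrr normr0 mul0r.
    rewrite iterSr /=.
    set w := iter j (euler a _ y) s.
    apply: (le_trans (ler_distD (iter j (euler b (2 ^- m) y) w) _ _)).
    rewrite -[j.+1]addn1 natrD [X in _ <= X]mulrDl mul1r addrC lerD//; first exact/IH/ltnW.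
    apply: (le_trans (euler_iter_lip bL _ _ _ _ em0)).
    apply: ler_pM; rewrite ?expR_ge0//.
      rewrite ler_expR ler_wpM2l//; apply: le_trans k1; rewrite ler_wpM2r//.
      by rewrite ler_nat ltnW.
    have -> : euler b (2 ^- m) y (euler a (2 ^- m) y w) - w =
       - (2 ^- m * (a y (euler a (2 ^- m) y w) - a y w)).
      by rewrite /b /euler; ring.
    rewrite normrN normrM ger0_norm// expr2 mulrCA ler_wpM2l//.
    apply: (le_trans (aL _ _ _)); rewrite ler_wpM2l//.
    by have := euler_iter_dist a1 y 1 w em0; rewrite /= mul1r.
  apply: (le_trans (H k (leqnn k))).
  have -> : k%:R * (expR (L * t) * (L * 2 ^- m ^+ 2)) =
    (k%:R * 2 ^- m) * (expR (L * t) * (L * 2 ^- m)) by ring.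
  have -> : L * t * expR (L * t) * 2 ^- m = t * (expR (L * t) * (L * 2 ^- m)) by ring.
  by rewrite ler_wpM2r// !mulr_ge0 ?expR_ge0.
have T1 := ler_distD (euler_flow b m t y x) (semiflow b t y x) s.
have T2 := ler_distD (euler_flow b m t y x') (euler_flow b m t y x) s.
rewrite add0r !mulrDl -mulrA; lra.
Qed.

(** The semiflows of [a] and [- a] are glued at time 0. Once the group law holds for all signs,
    Lipschitz dependence on time and the derivative need only be checked at time 0. *)
Lemma lipschitz_flow (R : realType) (Y : topologicalType)
  (a : Y -> R -> R) (L : R) (L0 : 0 <= L) (a1 : forall y s, `|a y s| <= 1)
  (aL : forall y s s', `|a y s - a y s'| <= L * `|s - s'|)
  (ac : continuous (fun p : Y * R => a p.1 p.2)) :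
  exists sigma : R -> Y -> R -> R,
  [/\ forall y s, sigma 0 y s = s,
      forall t t' y s, sigma (t + t') y s = sigma t y (sigma t' y s),
      continuous (fun p : R * (Y * R) => sigma p.1 p.2.1 p.2.2) &
      forall y s t, is_derive t (1 : R) (fun t => sigma t y s) (a y (sigma t y s))].
Proof.
pose b y s := - a y s.
have b1 y' s' : `|b y' s'| <= 1 by rewrite normrN.
have bL y' s1 s2 : `|b y' s1 - b y' s2| <= L * `|s1 - s2|.
  by rewrite /b -opprD normrN.
have bc : continuous (fun p : Y * R => b p.1 p.2).
  by move=> p; apply: cvgN; exact: ac.
have ba t y s : 0 <= t -> semiflow b t y (semiflow a t y s) = s.
  by move=> t0; exact: (semiflow_inverse L0).
have ab t y s : 0 <= t -> semiflow a t y (semiflow b t y s) = s.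
  move=> t0; have := semiflow_inverse L0 b1 bL y s t0.
  congr (semiflow _ _ _ _ = _).
  by apply/funext => y'; apply/funext => s'; rewrite /b opprK.
pose sg t y s := if 0 <= t then semiflow a t y s else semiflow b (- t) y s.
have sgD t t' y s : sg (t + t') y s = sg t y (sg t' y s).
  rewrite /sg; have [t0|t0] := leP 0 t; have [t'0|t'0] := leP 0 t'.
  - by rewrite addr_ge0// (semiflowD L0).
  - have [tt0|tt0] := leP 0 (t + t').
      have -> : semiflow a t y (semiflow b (- t') y s) =
        semiflow a (t + t') y (semiflow a (- t') y (semiflow b (- t') y s)).
        rewrite -(semiflowD L0 a1 aL)// ?oppr_ge0 ?ltW//.
        by congr semiflow; ring.
      by rewrite ab ?oppr_ge0 ?ltW.
    have -> : semiflow b (- t') y s = semiflow b t y (semiflow b (- (t + t')) y s).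
      rewrite -(semiflowD L0 b1 bL)// ?oppr_ge0 ?ltW//.
      by congr semiflow; ring.
    by rewrite ab.
  - have [tt0|tt0] := leP 0 (t + t').
      have -> : semiflow a t' y s = semiflow a (- t) y (semiflow a (t + t') y s).
        rewrite -(semiflowD L0 a1 aL)// ?oppr_ge0 ?ltW//.
        by congr semiflow; ring.
      by rewrite ba ?oppr_ge0 ?ltW.
    have -> : semiflow b (- t) y (semiflow a t' y s) =
      semiflow b (- (t + t')) y (semiflow b t' y (semiflow a t' y s)).
      rewrite -(semiflowD L0 b1 bL)// ?oppr_ge0 ?ltW//.
      by congr semiflow; ring.
    by rewrite ba.
  - have -> : (0 <= t + t') = false by apply/negbTE; rewrite -ltNge; lra.
    by rewrite opprD (semiflowD L0 b1 bL)// ?oppr_ge0 ?ltW.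
have sg0 y s : sg 0 y s = s by rewrite /sg lexx semiflow0.
have sglin t y s : `|sg t y s - s - t * a y s| <= L * t ^+ 2.
  rewrite /sg; have [t0|t0] := leP 0 t; first exact: semiflow_lin.
  have := @semiflow_lin R Y b L L0 b1 bL (- t) y s.
  by rewrite /b mulrNN sqrrN; apply; lra.
have sgt1 t y s : `|sg t y s - s| <= `|t|.
  rewrite /sg; have [t0|t0] := leP 0 t.
    by have := semiflow_lip_time L0 a1 aL y s t0 (lexx 0); rewrite semiflow0 subr0.
  have t0' : 0 <= - t by lra.
  have := semiflow_lip_time L0 b1 bL y s t0' (lexx 0); rewrite semiflow0 subr0.
  by rewrite normrN.
have sgt t t' y s : `|sg t y s - sg t' y s| <= `|t - t'|.
  by rewrite -{1}(subrK t' t) sgD.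
exists sg; split => //.
- move=> [t [y s]]; apply/cvgrPdist_le => d d0 /=.
  have cs : continuous (fun p : Y * R => sg t p.1 p.2).
    rewrite /sg; have [t0|t0] := leP 0 t.
      exact: (semiflow_continuous L0 a1 aL ac).
    by apply: (semiflow_continuous L0 b1 bL bc); lra.
  have d2 : 0 < d / 2 by rewrite divr_gt0.
  have /cvgrPdist_le/(_ _ d2) := cs (y, s) => /= H2.
  have H1 : \forall t' \near t, `|t - t'| <= d / 2.
    by have /cvgrPdist_le/(_ _ d2) : (id x @[x --> t] --> t) by exact: cvg_id.
  near=> p => /=.
  have E1 : `|t - p.1| <= d / 2.
    near: p; exact: (@cvg_fst _ _ (nbhs t) (nbhs (y, s)) _ _ H1).
  have E2 : `|sg t y s - sg t p.2.1 p.2.2| <= d / 2.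
    near: p; exact: (@cvg_snd _ _ (nbhs t) (nbhs (y, s)) _ _ H2).
  have := ler_distD (sg t p.2.1 p.2.2) (sg t y s) (sg p.1 p.2.1 p.2.2).
  have := sgt t p.1 p.2.1 p.2.2; lra.
- move=> y s t; apply: (is_derive_quadratic (C := L) (d := 1)) => // h _.
  by rewrite (addrC t) sgD; exact: sglin.
Unshelve. all: by end_near. Qed.

(** * Flat functions *)

Section Flat.
Context {R : realType}.

(** [D] lists the successive derivatives of [D 0]. Keeping them as data allows series to be
    differentiated term by term, and the uniform bounds control the remainders. *)
Definition smooth_seq (D : nat -> R -> R) :=
  (forall i (x : R), is_derive x (1 : R) (D i) (D i.+1 x)) /\
  (forall i, exists M : R, forall x, `|D i x| <= M).

(** The derivative of [P(1/x) exp(-1/x)] is [x^-2 (P - P')(1/x) exp(-1/x)]; [flat i] is thus the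
    i-th derivative of [exp(-1/x)] extended by 0. *)
Fixpoint flat_poly (i : nat) : {poly R} :=
  if i is j.+1 then 'X^2 * (flat_poly j - (flat_poly j)^`()) else 1.

Definition flat (i : nat) (x : R) : R :=
  if 0 < x then (flat_poly i).[x^-1] * expR (- x^-1) else 0.

Lemma exprn_le_expR k (u : R) : 0 < u -> u ^+ k * expR (- u) <= k%:R ^+ k.
Proof.
move=> u0; rewrite expRN ler_pdivrMr ?expR_gt0//.
case: k => [|k]; first by rewrite !expr0 mul1r -expR0 ler_expR ltW.
have k0 : 0 < k.+1%:R :> R by rewrite ltr0n.
have -> : expR u = expR (u / k.+1%:R) ^+ k.+1.
  by rewrite -expRM_natl mulrC divfK// gt_eqF.
rewrite -exprMn ler_pXn2r// ?nnegrE ?(ltW u0) ?mulr_ge0 ?expR_ge0//.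
rewrite -ler_pdivrMl// mulrC.
by apply: le_trans (expR_ge1Dx _); rewrite lerDr.
Qed.

Lemma poly_expR_bounded (P : {poly R}) k : exists C : R, forall u : R, 0 < u ->
  u ^+ k * `|P.[u]| * expR (- u) <= C.
Proof.
elim/poly_ind: P k => [|p c IH] k.
  by exists 0 => u u0; rewrite horner0 normr0 mulr0 mul0r.
have [C HC] := IH k.+1.
exists (C + `|c| * k%:R ^+ k) => u u0; rewrite hornerMXaddC.
apply: (@le_trans _ _ (u ^+ k.+1 * `|p.[u]| * expR (- u) + `|c| * (u ^+ k * expR (- u)))).
  apply: (@le_trans _ _ (u ^+ k * (`|p.[u]| * u + `|c|) * expR (- u))).
    rewrite ler_wpM2r ?expR_ge0// ler_wpM2l ?exprn_ge0 ?(ltW u0)//.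
    by rewrite (le_trans (ler_normD _ _))// normrM (gtr0_norm u0).
  by rewrite exprSr le_eqVlt; apply/orP; left; apply/eqP; ring.
by rewrite lerD ?HC// ler_wpM2l// exprn_le_expR.
Qed.

Lemma flat_le0 i x : x <= 0 -> flat i x = 0.
Proof. by rewrite /flat leNgt => /negbTE ->. Qed.

Lemma flat_bounded i : exists M : R, forall x, `|flat i x| <= M.
Proof.
have [C HC] := poly_expR_bounded (flat_poly i) 0.
exists (`|C|) => x; rewrite /flat; case: ifPn => [x0|_]; last by rewrite normr0.
rewrite normrM [X in _ * X]gtr0_norm ?expR_gt0//.
have := HC x^-1; rewrite expr0 mul1r invr_gt0 => /(_ x0) H.
exact: le_trans H (ler_norm _).
Qed.

(** With this, [is_derive_quadratic] gives derivative 0 at the junction point 0. *)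
Lemma flat_quadratic i : exists C : R, forall x, `|flat i x| <= C * x ^+ 2.
Proof.
have [C HC] := poly_expR_bounded (flat_poly i) 2.
exists (`|C|) => x; rewrite /flat; case: ifPn => [x0|_]; last first.
  by rewrite normr0 mulr_ge0// sqr_ge0.
rewrite normrM [X in _ * X]gtr0_norm ?expR_gt0//.
have := HC x^-1; rewrite invr_gt0 => /(_ x0).
rewrite -mulrA exprVn mulrC ler_pdivrMr ?exprn_gt0// => H.
by apply: le_trans H _; rewrite ler_wpM2r ?sqr_ge0// ler_norm.
Qed.

Lemma flat_derive i x : is_derive x (1 : R) (flat i) (flat i.+1 x).
Proof.
have [x0|x0|x0] := ltgtP 0 x; last first.
- rewrite -x0 (flat_le0 _ (lexx 0)); have [C HC] := flat_quadratic i.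
  apply: (is_derive_quadratic (C := C) (d := 1)) => // h _.
  by rewrite add0r (flat_le0 _ (lexx 0)) mulr0 !subr0.
- rewrite flat_le0 ?ltW//.
  apply: (is_derive_quadratic (C := 0) (d := - x)); first by lra.
  move=> h; rewrite ler_norml => /andP[_ h1].
  by rewrite !flat_le0 ?mulr0 ?subr0 ?normr0 ?mul0r//; lra.
have xn0 : x != 0 by rewrite gt_eqF.
have dV : is_derive x (1 : R) (fun x : R => x^-1) (- x ^- 2).
  apply: is_derive_eq (is_deriveV xn0 (is_derive_id x 1)) _.
  by rewrite /GRing.scale /= mulr1.
have dE : is_derive x (1 : R) (fun x : R => expR (- x^-1)) (x ^- 2 * expR (- x^-1)).
  apply: is_derive_eq (is_derive1_comp (is_derive_expR _) (is_deriveN dV)) _.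
  by rewrite opprK mulrC.
have dP : is_derive x (1 : R) (fun x : R => (flat_poly i).[x^-1])
    ((flat_poly i)^`().[x^-1] * - x ^- 2).
  apply: (@is_derive1_comp R (horner (flat_poly i)) (fun x => x^-1)) => //.
have : is_derive x (1 : R) (fun x : R => (flat_poly i).[x^-1] * expR (- x^-1)) (flat i.+1 x).
  apply: is_derive_eq (is_deriveM dP dE) _.
  rewrite /flat x0 /= /GRing.scale /= !hornerE /=; rewrite exprVn.
  set p : R := (flat_poly i).[_]; set p' : R := (_^`()).[_]; set e : R := expR _.
  set y : R := x ^- 2.
  by change (p * y * e + e * p' * - y = y * (p - p') * e); ring.
apply: near_eq_is_derive.
near=> z; rewrite /flat (_ : 0 < z)//.
by near: z; exact: lt_nbhsr.
Unshelve. all: by end_near. Qed.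

Lemma flat_smooth : smooth_seq flat.
Proof. by split; [exact: flat_derive|exact: flat_bounded]. Qed.

Lemma flat_gt0 x : 0 < x -> 0 < flat 0 x.
Proof. by move=> x0; rewrite /flat x0 /= hornerE mul1r expR_gt0. Qed.

Lemma flat_ge0 x : 0 <= flat 0 x.
Proof. by have [/flat_le0 ->//|/flat_gt0/ltW] := leP x 0. Qed.

Lemma flat_le1 x : flat 0 x <= 1.
Proof.
rewrite /flat; case: ifPn => [x0|_]//=.
by rewrite hornerE mul1r -expR0 ler_expR oppr_le0 invr_ge0 ltW.
Qed.

Lemma flat1E (x : R) : 0 < x -> flat 1 x = x ^- 2 * expR (- x^-1).
Proof. by move=> x0; rewrite /flat x0 /= derivC subr0 !hornerE exprVn. Qed.

Lemma flat1_ge0 x : 0 <= flat 1 x.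
Proof.
have [/flat_le0 ->//|x0] := leP x 0.
by rewrite flat1E// mulr_ge0 ?expR_ge0// invr_ge0 exprn_ge0// ltW.
Qed.

Lemma flat_nondecreasing : {homo flat 0 : x y / x <= y}.
Proof.
move=> x y xy; rewrite -subr_ge0 -(mul0r (y - x)).
by apply: mvt_ge xy (fun z _ => flat_derive 0 z) (fun z _ => flat1_ge0 z).
Qed.

Lemma flat1_lower (x : R) : 2^-1 <= x <= 1 -> expR (- 2) <= flat 1 x.
Proof.
move=> /andP[h1 h2]; have x0 : 0 < x by apply: lt_le_trans h1; rewrite invr_gt0.
rewrite flat1E// -[X in X <= _]mul1r ler_pM ?expR_ge0//.
  by rewrite invf_ge1 ?exprn_gt0// exprn_ile1// ltW.
by rewrite ler_expR lerN2 -[leRHS]invrK lef_pV2 ?posrE ?invr_gt0.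
Qed.

(** On [1/2, 1] the slope is at least [exp(-2)], and monotonicity handles larger [v]. With [v] a
    squared distance, this and the upper bound below make the gap vanish to order exactly two. *)
Lemma flat_gap_lower : exists2 c : R, 0 < c &
  forall v, 0 <= v -> c * Num.min 1 v <= flat 0 1 - flat 0 (1 - v).
Proof.
exists (expR (- 2) / 2) => [|v v0]; first by rewrite divr_gt0 ?expR_gt0.
have E0 : 0 < expR (- 2 : R) by exact: expR_gt0.
have key w : 0 <= w <= 2^-1 -> expR (- 2) * w <= flat 0 1 - flat 0 (1 - w).
  move=> /andP[w0 w1].
  have := @mvt_ge R (flat 0) (flat 1) (1 - w) 1 (expR (- 2)) _
     (fun z _ => flat_derive 0 z).
  rewrite opprB addrCA subrr addr0; apply; first by lra.
  by move=> z /andP[h1 h2]; apply: flat1_lower; apply/andP; split; lra.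
have [v1|v1] := leP v (2^-1).
  apply: (le_trans _ (key v _)); last by rewrite v0.
  by rewrite ler_pM// ?ge_min ?lexx ?orbT ?le_min ?v0 ?ler01 ?divr_ge0 ?(ltW E0)//; lra.
have h2 : 0 <= (2^-1 : R) by rewrite invr_ge0.
apply: (@le_trans _ _ (flat 0 1 - flat 0 (1 - 2^-1))); last first.
  by rewrite lerD2l lerN2 flat_nondecreasing//; lra.
have := key 2^-1; rewrite h2 lexx => /(_ isT).
apply: le_trans; rewrite -[leRHS]mulr1 ler_wpM2l ?ge_min ?lexx//.
Qed.

Lemma flat_gap_upper : exists2 M : R, 0 < M &
  forall v, 0 <= v -> flat 0 1 - flat 0 (1 - v) <= M * v.
Proof.
have [M HM] := flat_bounded 1; exists (`|M| + 1) => [|v v0].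
  by rewrite ltr_wpDl.
have := mvt_norm (flat_derive 0) HM (1 - v) 1.
rewrite opprB addrCA subrr addr0 (ger0_norm v0) => H.
apply: (le_trans (ler_norm _)); apply: (le_trans H).
by rewrite ler_wpM2r// (le_trans (ler_norm _))// lerDl.
Qed.

(** * Series of shifted flat functions *)

Definition weighted_sum (c : nat -> R) (F : nat -> R -> R) (x : R) : R :=
  limn (fun m => \sum_(k < m) c k * F k x).

Lemma weighted_sum_approx (c : nat -> R) (F : nat -> R -> R) (M : R) x m :
  (forall k, 0 <= c k <= 2 ^- k) -> (forall k, `|F k x| <= M) ->
  `|weighted_sum c F x - \sum_(k < m) c k * F k x| <= 2 * M * 2 ^- m.
Proof.
move=> hc hF; apply: geometric_cauchy => k.
rewrite big_ord_recr /= addrAC subrr add0r normrM mulrC.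
have /andP[c0 c1] := hc k; rewrite (ger0_norm c0) ler_pM//.
Qed.

Lemma sum_weights_le1 (c : nat -> R) m :
  (forall k, 0 <= c k <= 2 ^- k.+1) -> \sum_(k < m) c k <= 1.
Proof.
move=> hc; suff : \sum_(k < m) c k <= 1 - 2 ^- m.
  move/le_trans; apply; rewrite gerBl invr_ge0 exprn_ge0//.
elim: m => [|m IH]; first by rewrite big_ord0 expr0 invr1 subrr.
rewrite big_ord_recr /=; have /andP[_ c1] := hc m.
apply: (le_trans (lerD IH c1)).
rewrite exprS invfM; lra.
Qed.

(** The bound on [D i.+2] gives every term the same remainder [M2 h^2], whatever its shift; weights
    of total at most 1 preserve it. *)
Lemma weighted_sum_derive (c : nat -> R) (D : nat -> R -> R) (r : nat -> R) i :
  (forall k, 0 <= c k <= 2 ^- k.+1) -> smooth_seq D ->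
  forall x, is_derive x (1 : R) (weighted_sum c (fun k x => D i (x - r k)))
    (weighted_sum c (fun k x => D i.+1 (x - r k)) x).
Proof.
move=> hc [dD bD] x.
have hc' k : 0 <= c k <= 2 ^- k.
  have /andP[-> /le_trans] := hc k; apply.
  by rewrite lef_pV2 ?posrE ?exprn_gt0// exprS ler_peMl ?exprn_ge0// ler1n.
have [M0 HM0] := bD i; have [M1 HM1] := bD i.+1; have [M2 HM2] := bD i.+2.
have M20 : 0 <= M2 by apply: le_trans (HM2 0).
have rem y h : `|D i (y + h) - D i y - h * D i.+1 y| <= M2 * h ^+ 2.
  pose g z := D i z - z * D i.+1 y.
  have dg z : is_derive z (1 : R) g (D i.+1 z - D i.+1 y).
    have d1 : is_derive z (1 : R) (fun z => z * D i.+1 y) (D i.+1 y).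
      apply: (is_derive_eq (is_deriveM (is_derive_id z (1 : R))
        (is_derive_cst (D i.+1 y) z (1 : R)))).
      by rewrite /GRing.scale /= mulr0 add0r mulr1.
    exact: (is_deriveB (dD i z) d1).
  have lip z : `|D i.+1 z - D i.+1 y| <= M2 * `|z - y| by exact: (mvt_norm (dD i.+1) HM2).
  have H (a b : R) : a <= b -> (forall z, a <= z <= b -> `|z - y| <= `|h|) ->
      b - a = `|h| -> `|g b - g a| <= M2 * h ^+ 2.
    move=> ab hz bah; have [z zab ->] := mvt ab (fun z _ => dg z).
    rewrite bah normrM normr_id -(real_normK (num_real h)) expr2 mulrA ler_wpM2r//.
    by apply: (le_trans (lip z)); rewrite ler_wpM2l// hz.
  have -> : D i (y + h) - D i y - h * D i.+1 y = g (y + h) - g y by rewrite /g; ring.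
  have [h0|h0] := leP 0 h.
    apply: H; first by lra.
      by move=> z /andP[? ?]; rewrite !ger0_norm; lra.
    by rewrite ger0_norm//; ring.
  rewrite distrC; apply: H; first by lra.
    by move=> z /andP[? ?]; rewrite (ltr0_norm h0) ler0_norm; lra.
  by rewrite ltr0_norm//; ring.
apply: (is_derive_quadratic (C := M2) (d := 1)) => // h h1.
apply: (le_addgt_pow2 (C := 4 * M0 + 2 * M1)) => m.
set F := fun k x => D i (x - r k); set G := fun k x => D i.+1 (x - r k).
have A1 := @weighted_sum_approx c F M0 (x + h) m hc' (fun k => HM0 _).
have A2 := @weighted_sum_approx c F M0 x m hc' (fun k => HM0 _).
have A3 := @weighted_sum_approx c G M1 x m hc' (fun k => HM1 _).
have A3' : `|h * (weighted_sum c G x - \sum_(k < m) c k * G k x)| <= 2 * M1 * 2 ^- m.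
  by rewrite normrM; apply: le_trans A3; rewrite ler_piMl.
have A4 : `|\sum_(k < m) c k * F k (x + h) - \sum_(k < m) c k * F k x
   - h * \sum_(k < m) c k * G k x| <= M2 * h ^+ 2.
  rewrite mulr_sumr -!sumrB; apply: (le_trans (ler_norm_sum _ _ _)).
  apply: (@le_trans _ _ (\sum_(k < m) c k * (M2 * h ^+ 2))); last first.
    rewrite -mulr_suml -[leRHS]mul1r; apply: ler_wpM2r; last exact: sum_weights_le1.
    by rewrite mulr_ge0// sqr_ge0.
  apply: ler_sum => k _; have /andP[c0 _] := hc k.
  have -> : c k * F k (x + h) - c k * F k x - h * (c k * G k x) =
    c k * (D i ((x - r k) + h) - D i (x - r k) - h * D i.+1 (x - r k)).
    by rewrite /F /G (addrAC x h); ring.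
  by rewrite normrM (ger0_norm c0) ler_wpM2l.
move: A1 A2 A3' A4; set S1 := \sum_(k < m) _; set S2 := \sum_(k < m) _; set S3 := \sum_(k < m) _.
rewrite mulrBr !ler_norml => /andP[? ?] /andP[? ?] /andP[? ?] /andP[? ?].
by apply/andP; split; lra.
Qed.

Lemma weighted_sum_smooth (c : nat -> R) (D : nat -> R -> R) (r : nat -> R) :
  (forall k, 0 <= c k <= 2 ^- k.+1) -> smooth_seq D ->
  smooth_seq (fun i => weighted_sum c (fun k x => D i (x - r k))).
Proof.
move=> hc sD; split; first by move=> i x; exact: weighted_sum_derive.
move=> i; have [M HM] := sD.2 i; exists (2 * M) => x.
have hc' k : 0 <= c k <= 2 ^- k.
  have /andP[-> /le_trans] := hc k; apply.
  by rewrite lef_pV2 ?posrE ?exprn_gt0// exprS ler_peMl ?exprn_ge0// ler1n.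
have := @weighted_sum_approx c (fun k x => D i (x - r k)) M x 0 hc' (fun k => HM _).
by rewrite big_ord0 subr0 expr0 invr1 mulr1.
Qed.

(** The j-th term is supported to the right of [2^-j], so at [2^-k] only terms with [j > k] survive,
    and their coefficients are already below [2^-(j+1) eps k]. *)
Lemma superflat (eps : nat -> R) : (forall k, 0 < eps k) ->
  exists D : nat -> R -> R, [/\ smooth_seq D, D 0 0 = 0,
    forall x, 0 < x -> 0 < D 0 x, {homo D 0 : x y / x <= y} &
    (forall x, 0 <= D 0 x <= 1) /\ forall k, D 0 (2 ^- k) <= eps k].
Proof.
move=> eps0.
(* The running product lies below every [eps k] with [k <= j] at once. *)
pose pr k := \prod_(i < k.+1) Num.min 1 (eps i).
have pr0 k : 0 < pr k.
  by apply: prodr_gt0 => i _; rewrite lt_min ltr01 eps0.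
have prle1 k : pr k <= 1.
  by apply: Num.Theory.prodr_ile1 => i _; rewrite ge_min lexx /= le_min ler01 ltW.
have preps k j : (k <= j)%N -> pr j <= eps k.
  move=> kj; rewrite /pr (bigD1 (Ordinal (kj : (k < j.+1)%N)))//= -[leRHS]mulr1.
  apply: ler_pM.
  - by rewrite le_min ler01 ltW.
  - by apply: prodr_ge0 => i _; rewrite le_min ler01 ltW.
  - by rewrite ge_min lexx orbT.
  - by apply: Num.Theory.prodr_ile1 => i _; rewrite ge_min lexx /= le_min ler01 ltW.
pose c k := 2 ^- k.+1 * pr k.
have p20 k : 0 < 2 ^- k :> R by rewrite invr_gt0 exprn_gt0.
have hc k : 0 <= c k <= 2 ^- k.+1.
  by rewrite /c mulr_ge0 ?(ltW (p20 _)) ?(ltW (pr0 _))//= -[leRHS]mulr1 ler_wpM2l ?(ltW (p20 _)).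
have hc' k : 0 <= c k <= 2 ^- k.
  have /andP[-> /le_trans] := hc k; apply.
  by rewrite lef_pV2 ?posrE ?exprn_gt0// exprS ler_peMl ?exprn_ge0// ler1n.
pose r k : R := 2 ^- k.
pose D i := weighted_sum c (fun k x => flat i (x - r k)).
have ap x m : `|D 0%N x - \sum_(k < m) c k * flat 0 (x - r k)| <= 2 * 2 ^- m.
  have := @weighted_sum_approx c (fun k x => flat 0 (x - r k)) 1 x m hc'.
  rewrite mulr1; apply => k.
  by rewrite ger0_norm ?flat_le1 ?flat_ge0.
have Dle x b : (forall m, \sum_(k < m) c k * flat 0 (x - r k) <= b) -> D 0%N x <= b.
  move=> H; apply: (le_addgt_pow2 (C := 2)) => m.
  by have := ap x m; have := H m; rewrite ler_norml => ? /andP[_ ?]; lra.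
have Dge x m : \sum_(k < m) c k * flat 0 (x - r k) <= D 0%N x.
  apply: (le_addgt_pow2 (C := 2)) => k.
  have := ap x (m + k)%N; rewrite ler_norml => /andP[+ _].
  have : \sum_(k < m) c k * flat 0 (x - r k) <= \sum_(k < m + k) c k * flat 0 (x - r k).
    rewrite big_split_ord /= lerDl sumr_ge0// => j _.
    by rewrite mulr_ge0 ?flat_ge0//; have /andP[] := hc (m + j)%N.
  have : 2 * 2 ^- (m + k) <= 2 * 2 ^- k :> R.
    by rewrite ler_wpM2l// lef_pV2 ?posrE ?exprn_gt0// ler_weXn2l ?ler1n// leq_addl.
  by lra.
have D0 x : 0 <= D 0%N x by have := Dge x 0%N; rewrite big_ord0.
exists D; split.
- exact: weighted_sum_smooth hc flat_smooth.
- apply/eqP; rewrite eq_le D0 andbT; apply: Dle => m.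
  rewrite big1// => k _; rewrite flat_le0 ?mulr0// sub0r oppr_le0; exact: ltW (p20 k).
- move=> x x0; have [m Hm] : exists m, r m < x.
    exists (Num.truncn (x^-1)).+1.
    rewrite /r -[ltRHS]invrK ltf_pV2 ?posrE ?exprn_gt0 ?invr_gt0//.
    apply: (lt_trans (truncnS_gt _)).
    by move: (Num.truncn _).+1 => N; rewrite -natrX ltr_nat ltn_expl.
  apply: lt_le_trans (Dge x m.+1).
  rewrite big_ord_recr /= ltr_wpDl//.
    apply: sumr_ge0 => j _.
    by rewrite mulr_ge0 ?flat_ge0//; have /andP[] := hc j.
  by rewrite mulr_gt0 ?flat_gt0 ?subr_gt0// /c mulr_gt0.
- move=> x y xy; apply: Dle => m; apply: le_trans (Dge y m).
  apply: ler_sum => k _; rewrite ler_wpM2l//; first by have /andP[] := hc k.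
  by apply: flat_nondecreasing; rewrite lerD2r.
- split=> [x|k].
    rewrite D0; apply: Dle => m; apply: le_trans (sum_weights_le1 m hc).
    apply: ler_sum => k _; rewrite ler_piMr ?flat_le1//.
    by have /andP[] := hc k.
  apply: Dle => m.
  apply: (@le_trans _ _ (\sum_(j < m) 2 ^- j.+1 * eps k)); last first.
    rewrite -mulr_suml -[leRHS]mul1r ler_wpM2r ?(ltW (eps0 k))//.
    apply: (@sum_weights_le1 (fun j => 2 ^- j.+1)) => j.
    by rewrite lexx ltW.
  apply: ler_sum => j _; have [jk|kj] := leqP j k.
    rewrite flat_le0 ?mulr0 ?mulr_ge0 ?(ltW (p20 _)) ?(ltW (eps0 k))// subr_le0.
    by rewrite /r lef_pV2 ?posrE ?exprn_gt0// ler_weXn2l ?ler1n.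
  rewrite -[leRHS]mulr1 ler_pM ?flat_ge0 ?flat_le1//; first by have /andP[] := hc j.
  by rewrite ler_wpM2l ?(ltW (p20 _)) ?preps// ltnW.
Qed.

End Flat.

(** * Calculus of [Ck] maps *)

Section Ck.
Context {R : realType}.
Implicit Types (E F : normedModType R).

Lemma near_eq_differentiable E F (f g : E -> F) x :
  (\near x, f x = g x) -> differentiable f x -> differentiable g x.
Proof.
move=> fg /diff_locallyP[cd fE].
have gfx : f x = g x by exact: nbhs_singleton fg.
have gE : g \o shift x = cst (g x) + 'd f x +o_ (0 : E) id.
  apply/eqaddoP => e e0; move/eqaddoP : fE => /(_ e e0).
  have fg' : \forall h \near (0 : E), f (h + x) = g (h + x).
    have sx : (h + x) @[h --> (0 : E)] --> x.
      rewrite -[X in _ --> X](add0r x).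
      by apply: cvgD; [exact: cvg_id|exact: cvg_cst].
    exact: sx fg.
  by apply: filterS2 fg' => h /= E1 /=; rewrite !fctE /= -E1 gfx.
have dE : 'd g x = 'd f x :> (E -> F) by exact: (diff_unique cd gE).
by apply/diff_locallyP; split; [rewrite dE|rewrite dE].
Qed.

Lemma Ck_ext E F k (U : set E) (f g : E -> F) : open U ->
  (forall x, U x -> f x = g x) -> Ck k U f -> Ck k U g.
Proof.
move=> oU; elim: k f g => [|k IH] f g fg.
  move=> cf x Ux; change (g z @[z --> x] --> g x); rewrite -(fg _ Ux).
  apply: cvg_trans (cf x Ux).
  apply: near_eq_cvg; move: (open_nbhs_nbhs (conj oU Ux)).
  by apply: filterS => z /fg.
move=> [df Df]; split=> [x Ux|v].
  apply: near_eq_differentiable (df x Ux).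
  by move: (open_nbhs_nbhs (conj oU Ux)); apply: filterS => z /fg.
apply: IH (Df v) => x Ux; apply: near_eq_derive.
by move: (open_nbhs_nbhs (conj oU Ux)); apply: filterS => z /fg.
Qed.

Lemma CkW E F k (U : set E) (f : E -> F) : Ck k.+1 U f -> Ck k U f.
Proof.
elim: k f => [|k IH] f [df Df]; first by move=> x /df/differentiable_continuous.
by split => // v; exact: IH.
Qed.

Lemma Ck_sub E F k (U V : set E) (f : E -> F) : U `<=` V -> Ck k V f -> Ck k U f.
Proof.
move=> UV; elim: k f => [|k IH] f /=; first by move=> H x /UV/H.
by move=> [df Df]; split => [x /UV/df|v]//; exact: IH.
Qed.

(** [Ck] is a condition at each point of its set, differentiability there being that of the ambient
    space. *)
Lemma Ck_local E F k (U : set E) (f : E -> F) :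
  (forall x, U x -> exists2 V : set E, V x & Ck k V f) -> Ck k U f.
Proof.
elim: k f => [|k IH] f H; first by move=> x /H[V Vx]; exact.
split=> [x /H[V Vx [+ _]]|v]; first exact.
apply: IH => x Ux; have [V Vx [_ Df]] := H x Ux.
by exists V => //; exact: Df.
Qed.

Lemma Ck_cst E F k (U : set E) (a : F) : Ck k U (fun=> a).
Proof.
elim: k a => [|k IH] a /=; first by move=> x _; exact: cvg_cst.
split=> [x _|v]; first exact: differentiable_cst.
have E0 : 'D_v (fun=> a) = (fun=> 0) :> (E -> F).
  by apply/funext => x; exact: derive_cst.
by rewrite E0; exact: IH.
Qed.

Lemma CkD E F k (U : set E) (f g : E -> F) :
  open U -> Ck k U f -> Ck k U g -> Ck k U (fun x => f x + g x).
Proof.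
move=> oU; elim: k f g => [|k IH] f g /=.
  by move=> cf cg x Ux; apply: cvgD; [exact: cf|exact: cg].
move=> [df Df] [dg Dg]; split=> [x Ux|v].
  by apply: differentiableD; [exact: df|exact: dg].
apply: (@Ck_ext _ _ k U (fun x => 'D_v f x + 'D_v g x)) => //; last exact: IH.
move=> x Ux; apply/esym/(@deriveD _ _ _ f g x v).
  exact/diff_derivable/df.
exact/diff_derivable/dg.
Qed.

Lemma CkM E k (U : set E) (f g : E -> R) :
  open U -> Ck k U f -> Ck k U g -> Ck k U (fun x => f x * g x).
Proof.
move=> oU; elim: k f g => [|k IH] f g cf cg.
  by move=> x Ux; apply: cvgM; [exact: cf|exact: cg].
have [[df Df] [dg Dg]] := (cf, cg).
split=> [x Ux|v].
  by apply: differentiableM; [exact: df|exact: dg].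
apply: (@Ck_ext _ _ k U (fun x => f x * 'D_v g x + g x * 'D_v f x)) => //.
  move=> x Ux; apply/esym/(@deriveM _ _ f g x v).
    exact/diff_derivable/df.
  exact/diff_derivable/dg.
by apply: CkD => //; apply: IH; [exact: CkW|exact: Dg|exact: CkW|exact: Df].
Qed.

Lemma CkB E k (U : set E) (f g : E -> R) :
  open U -> Ck k U f -> Ck k U g -> Ck k U (fun x => f x - g x).
Proof.
move=> oU cf cg; apply: CkD => //.
have := CkM oU (Ck_cst k U (-1 : R)) cg.
by apply: Ck_ext => // x _; rewrite mulN1r.
Qed.

Lemma Ck_sum E I (r : seq I) k (U : set E) (f : I -> E -> R) : open U ->
  (forall i, Ck k U (f i)) -> Ck k U (fun x => \sum_(i <- r) f i x).
Proof.
move=> oU cf; elim: r => [|i r IH].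
  by apply: (Ck_ext oU _ (Ck_cst k U (0 : R))) => x _; rewrite big_nil.
by apply: (Ck_ext oU _ (CkD oU (cf i) IH)) => x _; rewrite big_cons.
Qed.

Lemma Ck_linear E F (k : nat) (U : set E) (f : {linear E -> F}) :
  continuous f -> Ck k U f.
Proof.
move=> cf; case: k => [|k]; first by move=> x _; exact: cf.
split=> [x _|v]; first exact: linear_differentiable.
have E0 : 'D_v f = (fun=> f v) :> (E -> F).
  apply/funext => x; rewrite deriveE; last exact: linear_differentiable.
  by rewrite diff_lin.
by rewrite E0; exact: Ck_cst.
Qed.

(** The chain rule replaces [D i] by [D i.+1], so the induction on [k] runs over all [i]
    together. *)
Lemma Ck_post E k i (U : set E) (D : nat -> R -> R) (g : E -> R) :
  open U -> smooth_seq D -> Ck k U g -> Ck k U (fun x => D i (g x)).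
Proof.
move=> oU [dD _].
have DD j (x : R) : differentiable (D j : R -> R) x.
  by apply/derivable1_diffP; case: (dD j x).
elim: k i => [|k IH] i cg.
  move=> x Ux; apply: (@continuous_comp _ _ _ g (D i)); first exact: cg.
  exact/differentiable_continuous.
have [dg Dg] := cg; split=> [x Ux|v].
  by apply: (@differentiable_comp _ _ _ _ g (D i)) => //; exact: dg.
apply: (@Ck_ext _ _ k U (fun x => D i.+1 (g x) * 'D_v g x)) => //; last first.
  by apply: CkM => //; [apply: IH; exact: CkW|exact: Dg].
move=> x Ux.
have dgx := dg x Ux.
rewrite [RHS](deriveE (f := D i \o g)); last exact: differentiable_comp.
rewrite diff_comp//= -(deriveE v dgx).
have [dDi vDi] := dD i (g x).
have -> : 'd (D i) (g x) ('D_v g x) = 'D_v g x *: ((D i)^`()%classic (g x)).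
  by rewrite (deriv1E dDi).
by rewrite derive1E vDi mulrC.
Qed.

Lemma Ck_pre_linear E E' F (k : nat) (U : set E') (V : set E) (f : E -> F)
    (A : {linear E' -> E}) : open U -> continuous A ->
  (forall x, U x -> V (A x)) -> Ck k V f -> Ck k U (fun x => f (A x)).
Proof.
move=> oU cA UV; elim: k f => [|k IH] f /=.
  by move=> cf x Ux; apply: (@continuous_comp _ _ _ A f); [exact: cA|exact/cf/UV].
have dA x : differentiable A x by exact: linear_differentiable.
move=> [df Df]; split=> [x Ux|v].
  by apply: (@differentiable_comp _ _ _ _ A f) => //; exact/df/UV.
apply: (@Ck_ext _ _ k U (fun x => 'D_(A v) f (A x))) => //; last exact: (IH _ (Df _)).
move=> x Ux; have dfx := df _ (UV _ Ux).
rewrite [RHS](deriveE (f := f \o A)); last exact: differentiable_comp.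
by rewrite diff_comp//= diff_lin// -deriveE.
Qed.

Lemma rowE n (x : 'rV[R]_n) : x = \sum_(j < n) x 0 j *: delta_mx 0 j.
Proof. by first [exact: row_sum_delta | exact: esym (row_sum_delta _)]. Qed.

Lemma continuous_sum (T : topologicalType) F I (r : seq I) (f : I -> T -> F) x :
  (forall i, {for x, continuous (f i)}) ->
  {for x, continuous (fun z => \sum_(i <- r) f i z)}.
Proof.
move=> cf; elim: r => [|i r IH].
  rewrite (_ : (fun z => _) = fun=> 0); first exact: cvg_cst.
  by apply/funext => z; rewrite big_nil.
rewrite (_ : (fun z => _) = fun z => f i z + \sum_(i <- r) f i z).
  by apply: cvgD; [exact: cf|exact: IH].
by apply/funext => z; rewrite big_cons.
Qed.

(** Through a space of rows, the derivative of the composite is a finite sum of products of real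
    functions, to which [CkM] and the induction hypothesis apply. *)
Lemma Ck_comp_row E n k (U : set E) (V : set 'rV[R]_n) (g : 'rV[R]_n -> R)
    (G : E -> 'rV[R]_n) : open U -> (forall x, U x -> V (G x)) ->
  (forall j, Ck k U (fun x => G x 0 j : R)) -> Ck k V g ->
  Ck k U (fun x => g (G x)).
Proof.
move=> oU UV; elim: k g => [|k IH] g cG cg.
  move=> x Ux; apply: (@continuous_comp _ _ _ G g); last exact/cg/UV.
  rewrite (_ : G = fun x => \sum_(j < n) G x 0 j *: delta_mx 0 j); last first.
    by apply/funext => z; exact: rowE.
  apply: continuous_sum => j; apply: cvgZ; last exact: cvg_cst.
  exact: cG.
have dG x : U x -> differentiable G x.
  move=> Ux; rewrite (_ : G = \sum_(j < n) (fun x => G x 0 j *: delta_mx 0 j)); last first.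
    by apply/funext => z; rewrite fct_sumE; exact: rowE.
  apply: differentiable_sum => j; apply: differentiableZl.
  by have [+ _] := cG j; exact.
have [dg Dg] := cg; split=> [x Ux|v].
  by apply: (@differentiable_comp _ _ _ _ G g); [exact: dG|exact/dg/UV].
apply: (@Ck_ext _ _ k U
  (fun x => \sum_(j < n) 'D_v (fun x => G x 0 j : R) x * 'D_(delta_mx 0 j) g (G x))) => //.
  move=> x Ux; have dgx := dg _ (UV _ Ux).
  rewrite [RHS](deriveE (f := g \o G)); last by apply: differentiable_comp => //; exact: dG.
  rewrite diff_comp//=; last exact: dG.
  rewrite -(deriveE v (dG _ Ux)).
  rewrite [in RHS](rowE ('D_v G x)) linear_sum; apply: eq_bigr => j _.
  rewrite linearZ /= -deriveE// derive_mx ?mxE//.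
  by apply: diff_derivable; exact: dG.
have := @Ck_sum E 'I_n (index_enum _) k U
  (fun j x => 'D_v (fun x => G x 0 j : R) x * 'D_(delta_mx 0 j) g (G x)) oU.
move=> H; apply: (Ck_ext oU _ (H _)); first by move=> x _; apply: eq_bigr.
move=> j; apply: CkM => //; first by have [_] := cG j; exact.
by apply: (IH ('D_(delta_mx 0 j) g)); [move=> i; exact/CkW|exact: Dg].
Qed.

End Ck.

(** * The suspension and its time changes *)

Section SuspensionTopology.
Context {R : realType} {E : normedModType R} {M : smoothManifold E} (f : diffeo M).

Lemma ziter_continuous k : continuous (ziter f k).
Proof.
have it (g : M -> M) n : continuous g -> continuous (iter n g).
  move=> cg; elim: n => [|n IH] x; first exact: cvg_id.
  by apply: (@continuous_comp _ _ _ (iter n g) g); [exact: IH|exact: cg].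
case: k => n; apply: it; [exact: (diffeo_smooth f).1|exact: (diffeo_inv_smooth f).1].
Qed.

Lemma ziterNK k y : ziter f (- k) (ziter f k y) = y.
Proof. by rewrite -ziterD addNr. Qed.

Lemma spiR_shift y s (k : int) : spiR f (ziter f k y) (s - k%:~R) = spiR f y s.
Proof. by rewrite -(spiRD f y (s - k%:~R) k) subrK. Qed.

(** [spiR] is the quotient of M x R by the action of the integers generated by
    [(y, s + 1) ~ (f y, s)]. *)
Lemma spiR_eq y s z u : spiR f y s = spiR f z u <->
  exists k : int, z = ziter f k y /\ u = s - k%:~R.
Proof.
split=> [|[k [-> ->]]]; last by rewrite spiR_shift.
have fr1 x : \val (Defs.frac x : unit_itv R) <> 1.
  by apply/eqP; rewrite /= lt_eqF// ltrBlDr addrC -intrD1 floorD1_gt.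
rewrite /spiR => /spi_eq [[e1 e2]|[/= /fr1//]|[/= /fr1//]].
exists (Num.floor s - Num.floor u); split.
  by rewrite addrC ziterD e1 ziterNK.
by rewrite intrB; move: e2 => /=; lra.
Qed.

Lemma spiR_surj p : exists y s, (0 <= s <= 1) /\ p = spiR f y s.
Proof.
case e : (repr p) => [y s]; exists y, (\val s); split.
  by have := valP s; rewrite inE /= in_itv.
by rewrite spiR_spi /spi -e reprK.
Qed.

Lemma clamp_subproof (x : R) : Num.max 0 (Num.min 1 x) \in `[0 : R, 1 : R]%classic.
Proof. by rewrite inE /= in_itv /= le_max lexx /= ge_max ler01 ge_min lexx. Qed.

(** A total retraction onto [0, 1], so that the formula for [spiR] in one cell is continuous on all
    of M x R. *)
Definition clamp (x : R) : unit_itv R := SigSub (clamp_subproof x).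

Lemma clamp_continuous : continuous clamp.
Proof.
apply: continuous_comp_initial => x.
have : {for x, continuous ((fun=> 0 : R^o) \max ((fun=> 1 : R^o) \min (id : R -> R^o)))}.
  apply: continuous_max; first exact: cvg_cst.
  by apply: continuous_min; [exact: cvg_cst|exact: cvg_id].
exact.
Qed.

Lemma clampK (s : unit_itv R) : clamp (\val s) = s.
Proof.
apply/val_inj => /=; have := valP s; rewrite inE /= in_itv /= => /andP[s0 s1].
by rewrite (min_idPr s1) (max_idPr s0).
Qed.

Lemma spiR_clamp y s (k : int) : k%:~R <= s <= k%:~R + 1 ->
  spiR f y s = spi f (ziter f k y) (clamp (s - k%:~R)).
Proof.
move=> /andP[s0 s1]; rewrite -(spiR_shift y s k).
have h : s - k%:~R \in `[0 : R, 1 : R]%classic.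
  by rewrite inE /= in_itv /=; apply/andP; split; lra.
have e : s - k%:~R = \val (SigSub h : unit_itv R) by [].
by rewrite e spiR_spi clampK.
Qed.

Lemma spi_continuous : continuous (fun p : M * unit_itv R => spi f p.1 p.2).
Proof.
have -> : (fun p : M * unit_itv R => spi f p.1 p.2) =
  (\pi_(quotient_topology {eq_quot suspension_equiv f}))%qT.
  by apply/funext => -[y s].
exact: pi_continuous.
Qed.

(** Near a point, [spiR] agrees with the formula of the cell [k] or of the cell [k - 1]; both are
    continuous, and at integer height they take the same value. *)
Lemma spiR_continuous : continuous (fun p : M * R => spiR f p.1 p.2).
Proof.
pose g k (p : M * R) := spi f (ziter f k p.1) (clamp (p.2 - k%:~R)).
have cg k : continuous (g k).
  move=> p; apply: (@continuous_comp _ _ _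
    (fun p : M * R => (ziter f k p.1, clamp (p.2 - k%:~R)))
    (fun p : M * unit_itv R => spi f p.1 p.2)); last exact: spi_continuous.
  apply: (cvg_pair (F := nbhs p) (f := fun p => ziter f k p.1)
    (g := fun p => clamp (p.2 - k%:~R)) (G := nbhs (ziter f k p.1)) (H := nbhs (clamp (p.2 - k%:~R)))).
    apply: (@continuous_comp _ _ _ fst (ziter f k)); first exact: cvg_fst.
    exact: ziter_continuous.
  apply: (@continuous_comp _ _ _ (fun p : M * R => p.2 - k%:~R) clamp); last exact: clamp_continuous.
  by apply: cvgB; [exact: cvg_snd|exact: cvg_cst].
move=> [y s]; set k := Num.floor s.
have sk : k%:~R <= s by exact: floor_le.
have sk1 : s < k%:~R + 1 by rewrite -intrD1 floorD1_gt.
have c1 : \forall p \near (y, s), p.2 < k%:~R + 1.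
  exact: (@cvg_snd _ _ (nbhs y) (nbhs s) _ _ (lt_nbhsl sk1)).
have c2 : \forall p \near (y, s), k%:~R - 1 < p.2.
  apply: (@cvg_snd _ _ (nbhs y) (nbhs s) _ _ (lt_nbhsr _)); lra.
move=> A /= nA.
have n1 : \forall p \near (y, s), A (g k p).
  apply: cg; rewrite /g /= -spiR_clamp//; by rewrite sk ltW.
(* The lower cell matters only when [s = k]; otherwise the implication holds vacuously near [s]. *)
have n2 : \forall p \near (y, s), p.2 < k%:~R -> A (g (k - 1) p).
  move: sk; rewrite le_eqVlt => /orP[/eqP sk|sk].
    have : \forall p \near (y, s), A (g (k - 1) p).
      apply: cg; rewrite /g /= -spiR_clamp//; by rewrite intrB -sk; apply/andP; split; lra.
    by apply: filterS.
  have : \forall p \near (y, s), k%:~R < p.2.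
    exact: (@cvg_snd _ _ (nbhs y) (nbhs s) _ _ (lt_nbhsr sk)).
  by apply: filterS => p h1 h2; have := lt_trans h1 h2; rewrite ltxx.
change (\forall p \near (y, s), A (spiR f p.1 p.2)).
near=> p; have [pk|pk] := leP k%:~R p.2.
  rewrite (@spiR_clamp p.1 p.2 k); first by near: p; exact: n1.
  rewrite pk /=; apply: ltW; near: p; exact: c1.
rewrite (@spiR_clamp p.1 p.2 (k - 1)).
  by move: pk; near: p; exact: n2.
rewrite intrB subrK (ltW pk) andbT; apply: ltW; near: p; exact: c2.
Unshelve. all: by end_near. Qed.

(** Pulled back to M x [0, 1], the image of [O] is the union of the preimages of its translates
    under the integer action. *)
Lemma spiR_open (O : set (M * R)) : open O ->
  open ((fun p : M * R => spiR f p.1 p.2) @` O).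
Proof.
move=> oO; set U := _ @` _.
have -> : open U = open [set p : M * unit_itv R | U (spi f p.1 p.2)].
  rewrite {1}/open/=/quotient_open; congr open.
  by apply/funext => -[y s].
have -> : [set p : M * unit_itv R | U (spi f p.1 p.2)] =
  \bigcup_(k in [set: int]) ((fun p : M * unit_itv R =>
     (ziter f k p.1, \val p.2 - k%:~R)) @^-1` O).
  apply/seteqP; split=> -[y s] /=.
    move=> [[z u] /= Ozu]; rewrite -spiR_spi => /esym/spiR_eq[k [ez eu]].
    by exists k => //=; rewrite -ez -eu.
  move=> [k _ /= Ok]; exists (ziter f k y, \val s - k%:~R) => //=.
  by rewrite spiR_shift spiR_spi.
apply: bigcup_open => k _; apply: open_comp oO => p _.
apply: (cvg_pair (F := nbhs p) (f := fun p => ziter f k p.1)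
    (g := fun p => \val p.2 - k%:~R) (G := nbhs (ziter f k p.1)) (H := nbhs (\val p.2 - k%:~R))).
  apply: (@continuous_comp _ _ _ fst (ziter f k)); first exact: cvg_fst.
  exact: ziter_continuous.
apply: cvgB; last exact: cvg_cst.
apply: (@continuous_comp _ _ _ (snd : M * unit_itv R -> _) (set_val : unit_itv R -> R)).
  exact: cvg_snd.
exact: initial_continuous.
Qed.

Lemma suspension_compact : compact [set: M] -> compact [set: suspension f].
Proof.
move=> cM; have -> : [set: suspension f] =
  (fun p : M * R => spiR f p.1 p.2) @` ([set: M] `*` `[0, 1]).
  apply/seteqP; split=> // p _; have [y [s [s01 ->]]] := spiR_surj p.
  by exists (y, s) => //=; split => //=; rewrite in_itv.
apply: continuous_compact; first exact/continuous_subspaceT/spiR_continuous.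
by apply: compact_setX => //; exact: segment_compact.
Qed.

Lemma continuous_spiR (Z : topologicalType) (g : suspension f -> Z) :
  continuous (fun p : M * R => g (spiR f p.1 p.2)) -> continuous g.
Proof.
move=> cg; apply/continuousP => A oA.
have -> : g @^-1` A = (fun p : M * R => spiR f p.1 p.2) @`
   ((fun p : M * R => g (spiR f p.1 p.2)) @^-1` A).
  apply/seteqP; split=> [p /= Ap|_ [p /= Ap <-]//].
  by have [y [s [_ ep]]] := spiR_surj p; exists (y, s) => //=; rewrite -ep.
by apply: spiR_open; apply: open_comp oA => p _; exact: cg.
Qed.

(** The map induced on the quotient, evaluated at the chosen representative; meaningful for [F]
    invariant under the integer action. *)
Definition descend (X : Type) (F : M -> R -> X) (p : suspension f) : X :=
  F (repr p).1 (\val (repr p).2).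

Lemma descendE (X : Type) (F : M -> R -> X) :
  (forall y s, F (f y) s = F y (s + 1)) ->
  forall y s, descend F (spiR f y s) = F y s.
Proof.
move=> Ff y s.
have shn n z u : F (iter n f z) u = F z (u + n%:R).
  elim: n z u => [|n IH] z u; first by rewrite addr0.
  by rewrite iterSr IH Ff -addrA natr1.
have sh (k : int) z u : F (ziter f k z) (u - k%:~R) = F z u.
  case: k => n; first by rewrite shn -addrA pmulrn addNr addr0.
  rewrite /ziter; set w := iter _ _ _.
  have ez : iter n.+1 f w = z.
    by rewrite /w; elim: n.+1 => // m IHm; rewrite iterSr /= diffeo_invK.
  rewrite -[in RHS]ez shn; congr (F _ _).
  by rewrite NegzE mulrNz opprK pmulrn.
have : spiR f (repr (spiR f y s)).1 (\val (repr (spiR f y s)).2) = spiR f y s.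
  by rewrite spiR_spi /spi -surjective_pairing reprK.
by rewrite /descend => /esym/spiR_eq[k [-> ->]].
Qed.

Lemma suspension_smooth_derivable (g : suspension f -> R) y s :
  suspension_smooth g -> derivable (fun u : R => g (spiR f y u)) s 1.
Proof.
move=> sg.
have [c Ac cy] : exists2 c, atlas (s := M) c & chart_dom c y.
  by have : [set: M] y by []; rewrite -(atlas_cover M) => -[c Ac cy]; exists c.
have [_ _ [fc _] [ic _] _] := atlas_chart Ac.
pose a := s - 2^-1.
have /= := sg (@suspension_chart _ _ _ f c a).
have Asc : @suspension_atlas _ _ _ f (@suspension_chart _ _ _ f c a) by exists (c, a).
move=> /(_ Asc 1)[+ _].
have inU : (chart_cod c `*` `]a, a + 1[) (chart_map c y, s).
  split => /=; first exact: fc.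
  by rewrite in_itv /=; apply/andP; split; rewrite /a; lra.
move=> /(_ _ inU) dg.
apply/derivable1_diffP.
pose A := fun u : R => (chart_map c y, u) : (E * R^o)%type.
have dA : differentiable A s by apply: differentiable_pair.
have := differentiable_comp dA dg.
by congr (differentiable _ _); apply/funext => u; rewrite /A /= ic.
Qed.

End SuspensionTopology.

(** * Time changes of the suspension flow *)

Section TimeChange.
Context {R : realType} {E : normedModType R} {M : smoothManifold E} (f : diffeo M).
Variables (alpha : suspension f -> R) (L : R).
Hypothesis alpha_cont : continuous alpha.
Hypothesis alpha01 : forall p, 0 <= alpha p <= 1.
Hypothesis L0 : 0 <= L.
Hypothesis alphaL : forall y s s',
  `|alpha (spiR f y s) - alpha (spiR f y s')| <= L * `|s - s'|.

(** On the fibre of [y] the field is the scalar equation [s' = alpha (spiR f y s)]. Its flow [sigma]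
    is kept next to [phi] because all later estimates concern the height. *)
Lemma time_change : exists (sigma : R -> M -> R -> R) (phi : R -> suspension f -> suspension f),
  [/\ (forall y s, sigma 0 y s = s) /\
      (forall t t' y s, sigma (t + t') y s = sigma t y (sigma t' y s)),
      forall y s t, is_derive t (1 : R) (fun t => sigma t y s)
        (alpha (spiR f y (sigma t y s))),
      forall t y s, phi t (spiR f y s) = spiR f y (sigma t y s) &
      induced_flow (scale_field alpha (suspension_field f)) phi].
Proof.
pose a y s := alpha (spiR f y s).
have ac : continuous (fun p : M * R => a p.1 p.2).
  move=> p; apply: (@continuous_comp _ _ _ (fun p : M * R => spiR f p.1 p.2) alpha).
    exact: spiR_continuous.
  exact: alpha_cont.
have a1 y s : `|a y s| <= 1.
  by have /andP[h0 h1] := alpha01 (spiR f y s); rewrite ger0_norm.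
have [sg [sg0 sgD sgc dsg]] := lipschitz_flow L0 a1 alphaL ac.
have spif y s : spiR f (f y) (s - 1) = spiR f y s by exact: (spiR_shift f y s 1).
(* Both sides solve the equation of the fibre of [f y] with the same initial value, so uniqueness
   lets the flow descend. *)
have sgf t y s : sg t (f y) s = sg t y (s + 1) - 1.
  have := @ode_unique R (a (f y)) L (fun t => sg t (f y) s) (fun t => sg t y (s + 1) - 1).
  apply => //; first exact: alphaL.
    move=> {}t; rewrite /a spif.
    have := is_deriveB (dsg y (s + 1) t) (is_derive_cst (1 : R) t (1 : R)).
    by rewrite subr0.
  by rewrite !sg0 addrK.
pose phi t := descend (f := f) (fun y s => spiR f y (sg t y s)).
have phiE t y s : phi t (spiR f y s) = spiR f y (sg t y s).
  rewrite /phi (descendE (F := fun y s => spiR f y (sg t y s)))// => y' s'.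
  by rewrite sgf spif.
exists sg, phi; split => //; split.
  split.
  - move=> [t p]; have [y [s [_ ->]]] := spiR_surj p.
    move=> A /=; rewrite phiE => nA.
    have cG : continuous (fun q : R * (M * R) => spiR f q.2.1 (sg q.1 q.2.1 q.2.2)).
      move=> q; apply: (@continuous_comp _ _ _ (fun q : R * (M * R) => (q.2.1, sg q.1 q.2.1 q.2.2))
        (fun p : M * R => spiR f p.1 p.2)); last exact: spiR_continuous.
      apply: (cvg_pair (F := nbhs q) (f := fun q => q.2.1)
        (g := fun q => sg q.1 q.2.1 q.2.2) (G := nbhs q.2.1) (H := nbhs (sg q.1 q.2.1 q.2.2))).
        apply: (@continuous_comp _ _ _ (snd : R * (M * R) -> _) fst); exact: cvg_snd || exact: cvg_fst.
      exact: sgc.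
    (* Joint continuity descends because [spiR] is open: the image of a neighbourhood upstairs is
       one downstairs. *)
    have [[N1 N2] /= [n1 n2] sub] := cG (t, (y, s)) A nA.
    have [N3 [oN3 N3p] sub3] : exists2 N3 : set (M * R), open N3 /\ N3 (y, s) & N3 `<=` N2.
      by move: n2; rewrite nbhsE => -[N3 ? ?]; exists N3.
    exists (N1, (fun p : M * R => spiR f p.1 p.2) @` N3) => /=.
      split => //; apply: open_nbhs_nbhs; split; first exact: spiR_open.
      by exists (y, s).
    move=> [t' p'] /= [t'N [q qN <-]]; rewrite phiE.
    by apply: (sub (t', q)); split => //=; exact: sub3.
  - by move=> p; have [y [s [_ ->]]] := spiR_surj p; rewrite phiE sg0.
  - by move=> s t p; have [y [u [_ ->]]] := spiR_surj p; rewrite !phiE sgD.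
move=> g sg' p t; have [y [s [_ ->]]] := spiR_surj p.
pose gg u := g (spiR f y u).
have dgg u := @suspension_smooth_derivable R E M f g y u sg'.
have dg u : is_derive u (1 : R) gg (gg^`()%classic u).
  by apply: DeriveDef; [exact: dgg|rewrite derive1E].
have E1 : (fun u : R => g (phi u (spiR f y s))) = gg \o (fun t => sg t y s).
  by apply/funext => u; rewrite /= phiE.
rewrite E1 phiE.
have E2 : scale_field alpha (suspension_field f) g (spiR f y (sg t y s)) =
  gg^`()%classic (sg t y s) * a y (sg t y s).
  rewrite /scale_field mulrC; congr (_ * _); rewrite /suspension_field.
  have -> : (fun t0 : R => g (suspension_flow f t0 (spiR f y (sg t y s)))) =
     gg \o (fun r => r + sg t y s).
    by apply/funext => r; rewrite /= suspension_flow_spiR.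
  have d1 : is_derive (0 : R) (1 : R) (fun r : R => r + sg t y s) 1.
    have := is_deriveD (is_derive_id (0 : R) (1 : R)) (is_derive_cst (sg t y s) (0 : R) (1 : R)).
    by rewrite addr0.
  have d2 := dg (0 + sg t y s).
  have := @is_derive1_comp R gg (fun r : R => r + sg t y s) 0 _ _ d2 d1 => -[_ v].
  by rewrite derive1E v mulr1 add0r.
rewrite E2; exact: (@is_derive1_comp R gg (fun t => sg t y s) t _ _ (dg _) (dsg y s t)).
Qed.

End TimeChange.

(** * Smoothness in charts *)

Lemma Ck_coord (R : realType) (E : normedModType R) n k (U : set E)
  (F : E -> 'rV[R]_n) i : open U -> Ck k U F -> Ck k U (fun x => F x 0 i : R).
Proof.
move=> oU; elim: k F => [|k IH] F.
  move=> cF x Ux; apply: (@continuous_comp _ _ _ F (fun z : 'rV[R]_n => z 0 i)).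
    exact: cF.
  exact: coord_continuous.
move=> [dF DF]; split=> [x Ux|v].
  apply: (@differentiable_comp _ _ _ _ F (fun z : 'rV[R]_n => z 0 i : R)); first exact: dF.
  exact: differentiable_coord.
apply: (@Ck_ext _ _ _ k U (fun x => ('D_v F x) 0 i : R)) => //; last exact: IH (DF v).
move=> x Ux; rewrite derive_mx ?mxE//; exact/diff_derivable/dF.
Qed.

Lemma chart_preimage_open (R : realType) (E : normedModType R) (T T' : topologicalType)
  (c : chart E T) (h : T -> T') (O : set T') : is_chart c -> continuous h -> open O ->
  open (chart_cod c `&` (h \o chart_inv c) @^-1` O).
Proof.
move=> [_ oc _ _ [_ cc]] ch oO.
rewrite openE => x [xc Ox]; apply: filterI; first exact: open_nbhs_nbhs.
have := @continuous_comp _ _ _ (chart_inv c) h x (cc x xc) (@ch _).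
by move/(_ O); apply; exact: open_nbhs_nbhs.
Qed.

(** A chart [e] around the m-th iterate factors the next one through coordinates; it varies with the
    point, hence [Ck_local]. *)
Lemma iter_smooth (R : realType) (n : nat) (M : smoothManifold 'rV[R]_n) (g : M -> M) m :
  smooth_map g -> forall c d i k, atlas (s := M) c -> atlas (s := M) d ->
  Ck k (chart_cod c `&` (iter m g \o chart_inv c) @^-1` chart_dom d)
    (fun x => chart_map d (iter m g (chart_inv c x)) 0 i : R).
Proof.
move=> [cg sg].
have cit j : continuous (iter j g).
  elim: j => [|j IH] x; first exact: cvg_id.
  by apply: (@continuous_comp _ _ _ (iter j g) g); [exact: IH|exact: cg].
elim: m => [|m IH] c d i k Ac Ad.
  have oU : open (overlap c d).
    have [od _ _ _ _] := atlas_chart Ad.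
    by apply: (@chart_preimage_open _ _ _ _ c id) => //; [exact: atlas_chart|move=> z; exact: cvg_id].
  apply: (@Ck_coord _ _ _ _ _ (transition c d)) => //.
  exact: atlas_compatible.
apply: Ck_local => x [xc xd].
set w := iter m g (chart_inv c x).
have [e Ae we] : exists2 e, atlas (s := M) e & chart_dom e w.
  by have : [set: M] w by []; rewrite -(atlas_cover M) => -[e Ae we]; exists e.
have [oe _ [fe _] [ie _] _] := atlas_chart Ae.
have [od _ _ _ _] := atlas_chart Ad.
have oV : open (chart_cod c `&` (iter m g \o chart_inv c) @^-1`
    (chart_dom e `&` g @^-1` chart_dom d)).
  apply: chart_preimage_open => //; first exact: atlas_chart.
  apply: openI => //; apply: open_comp od => z _; exact: cg.
exists (chart_cod c `&` (iter m g \o chart_inv c) @^-1`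
    (chart_dom e `&` g @^-1` chart_dom d)); first by [].
apply: (@Ck_ext _ _ _ _ _
  (fun x => (fun z => (chart_map d \o g \o chart_inv e) z 0 i : R)
     (chart_map e (iter m g (chart_inv c x))))) => //.
  by move=> z [_ [ze _]] /=; rewrite ie.
apply: (@Ck_comp_row _ _ _ _ _
   (chart_cod e `&` (g \o chart_inv e) @^-1` chart_dom d)
   (fun z => (chart_map d \o g \o chart_inv e) z 0 i : R)) => //.
- by move=> z [_ [ze zd]]; split => /=; [exact: fe|rewrite ie].
- move=> j; apply: Ck_sub (IH c e j k Ac Ae) => z [zc [ze _]]; by split.
- apply: Ck_coord; last exact: sg.
  by apply: chart_preimage_open => //; exact: atlas_chart.
Qed.

Lemma ziter_smooth (R : realType) (n : nat) (M : smoothManifold 'rV[R]_n) (f : diffeo M)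
    (l : int) c d i k : atlas (s := M) c -> atlas (s := M) d ->
  Ck k (chart_cod c `&` (ziter f l \o chart_inv c) @^-1` chart_dom d)
    (fun x => chart_map d (ziter f l (chart_inv c x)) 0 i : R).
Proof.
case: l => m Ac Ad; apply: iter_smooth => //; [exact: diffeo_smooth|exact: diffeo_inv_smooth].
Qed.

Lemma suspension_smooth_continuous (R : realType) (E : normedModType R)
  (M : smoothManifold E) (f : diffeo M) (g : suspension f -> R) :
  suspension_smooth g -> continuous g.
Proof.
move=> sg; apply: continuous_spiR => -[y s].
have [c Ac cy] : exists2 c, atlas (s := M) c & chart_dom c y.
  by have : [set: M] y by []; rewrite -(atlas_cover M) => -[c Ac cy]; exists c.
have [oc _ [fc _] [ic _] [cc _]] := atlas_chart Ac.
pose a := s - 2^-1.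
have Asc : @suspension_atlas _ _ _ f (@suspension_chart _ _ _ f c a) by exists (c, a).
have /= H := sg _ Asc 0%N.
have inU : (chart_cod c `*` `]a, a + 1[) (chart_map c y, s).
  split => /=; first exact: fc.
  by rewrite in_itv /=; apply/andP; split; rewrite /a; lra.
have {}H := H _ inU.
pose h (p : M * R) := (chart_map c p.1, p.2) : (E * R^o)%type.
have ch : {for (y, s), continuous h}.
  have c1 : {for (y, s), continuous (fun p : M * R => chart_map c p.1)}.
    have cfst : {for (y, s), continuous (fst : M * R -> M)} by exact: cvg_fst.
    exact: (@continuous_comp _ _ _ (fst : M * R -> M) (chart_map c) (y, s) cfst (cc y cy)).
  have c2 : {for (y, s), continuous (snd : M * R -> R)} by exact: cvg_snd.
  exact: (cvg_pair c1 c2).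
have := @continuous_comp _ _ _ h _ (y, s) ch H.
change ({for (y, s), continuous (fun p : M * R => g (spiR f (chart_inv c (chart_map c p.1)) p.2))} ->
  {for (y, s), continuous (fun p : M * R => g (spiR f p.1 p.2))}) => H'.
change (g (spiR f p.1 p.2) @[p --> (y, s)] --> g (spiR f y s)).
have -> : g (spiR f y s) = g (spiR f (chart_inv c (chart_map c y)) s) by rewrite ic.
apply: cvg_trans H'; apply: near_eq_cvg.
have : \forall p \near (y, s), chart_dom c p.1.
  exact: (@cvg_fst _ _ (nbhs y) (nbhs s) _ _ (open_nbhs_nbhs (conj oc cy))).
by apply: filterS => p cp; rewrite ic.
Qed.

Lemma open_prod (T U : topologicalType) (A : set T) (B : set U) :
  open A -> open B -> open (A `*` B).
Proof.
move=> oA oB; rewrite openE => -[x y] [/= Ax By].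
by exists (A, B) => //=; split; exact: open_nbhs_nbhs.
Qed.

Lemma suspension_smooth_post (R : realType) (n : nat)
  (M : smoothManifold 'rV[R]_n) (f : diffeo M) (g : suspension f -> R) D :
  smooth_seq D -> suspension_smooth g -> suspension_smooth (fun p => D 0%N (g p)).
Proof.
move=> sD sg _ [[c a] [Ac _] <-] k.
have [_ oc _ _ _] := atlas_chart Ac.
apply: (@Ck_post _ _ k 0 _ D (g \o chart_inv (@suspension_chart _ _ _ f c a))) => //.
  by apply: open_prod => //; exact: interval_open.
by apply: sg; exists (c, a).
Qed.

(** * Fields vanishing at a single point *)

Section BumpField.
Context {R : realType} {n : nat} {M : smoothManifold 'rV[R]_n} (f : diffeo M).
Variables (c0 : chart 'rV[R]_n M) (x0 : 'rV[R]_n) (r : R).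
Hypothesis Ac0 : atlas (s := M) c0.
Hypothesis r0 : 0 < r.
Hypothesis box : forall x : 'rV[R]_n, (forall i, `|x 0 i - x0 0 i| <= r) -> chart_cod c0 x.

Definition rho2 (x : 'rV[R]_n) : R := \sum_i ((x 0 i - x0 0 i) / r) ^+ 2.

(** A squared distance to the centre. The factor 16 makes it reach 1 at distance 1/4 from height
    1/2, away from the levels that are glued. *)
Definition profile (w : M) (s : R) : R := rho2 (chart_map c0 w) + 16 * (s - 2^-1) ^+ 2.

Definition beta (w : M) (s : R) : R :=
  if `[< chart_dom c0 w >] then flat 0 (1 - profile w s) else 0.

(** Up to 1/8, [flat 0 1 - flat 0 (1 - profile)]: zero at the centre only, and constant where the
    profile exceeds 1. The factor 1/8 is the speed limit used to track orbits. *)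
Definition bump_lift (y : M) (s : R) : R :=
  8^-1 * (flat 0 1 - beta (ziter f (Num.floor s) y) (s - (Num.floor s)%:~R)).

Definition bump_field : suspension f -> R := descend bump_lift.

Lemma rho2_ge0 x : 0 <= rho2 x.
Proof. by apply: sumr_ge0 => i _; exact: sqr_ge0. Qed.

Lemma bump_fieldE y s : bump_field (spiR f y s) = bump_lift y s.
Proof.
apply: descendE => z u; rewrite /bump_lift.
by rewrite floorDrz ?intr_int// floor1 ziterS intrD opprD addrACA subrr addr0.
Qed.

Lemma profile_ge1 w s : 4^-1 <= `|s - 2^-1| -> 1 <= profile w s.
Proof.
move=> h; rewrite /profile ler_wpDl ?rho2_ge0//.
rewrite -(real_normK (num_real (s - _))).
have : 4^-1 ^+ 2 <= `|s - 2^-1| ^+ 2 by rewrite ler_pXn2r ?nnegrE ?invr_ge0.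
by rewrite !expr2; lra.
Qed.

Lemma beta_out w s : 4^-1 <= `|s - 2^-1| -> beta w s = 0.
Proof.
by move=> h; rewrite /beta; case: ifPn => // _; rewrite flat_le0// subr_le0 profile_ge1.
Qed.

Lemma bump_lift_cell (k : int) y s : k%:~R <= s <= k%:~R + 1 ->
  bump_lift y s = 8^-1 * (flat 0 1 - beta (ziter f k y) (s - k%:~R)).
Proof.
move=> /andP[s0]; rewrite le_eqVlt => /orP[/eqP s1|s1]; last first.
  have fk : Num.floor s = k by apply/eqP; rewrite floor_eq s0 intrD1.
  by rewrite /bump_lift fk.
have e1 : s = k%:~R + 1%:~R :> R by rewrite s1.
have fk : Num.floor s = k + 1 by rewrite e1 -intrD intrKfloor.
rewrite /bump_lift fk !beta_out//; first by rewrite s1 ger0_norm; lra.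
by rewrite e1 -intrD subrr sub0r normrN ger0_norm; lra.
Qed.

Let K := chart_inv c0 @` [set x : 'rV[R]_n | forall i, `[x0 0 i - r, x0 0 i + r]%classic (x 0 i)].

(** A compact image in a Hausdorff space. Its complement is therefore open, which makes the
    extension of [beta] by 0 smooth at the edge of the chart domain. *)
Lemma bump_support_closed : closed K.
Proof.
apply: compact_closed; first exact: mfd_hausdorff.
have [_ _ _ _ [_ ci]] := atlas_chart Ac0.
apply: continuous_compact; last first.
  by apply: (@rV_compact _ _ (fun i => `[x0 0 i - r, x0 0 i + r]%classic)) => i; exact: segment_compact.
apply: continuous_in_subspaceT => x; rewrite inE => /= Kx; apply: ci; apply: box => i.
have := Kx i; rewrite in_itv /= => /andP[? ?]; rewrite ler_norml; apply/andP; split; lra.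
Qed.

Lemma beta_notin w s : ~ K w -> beta w s = 0.
Proof.
move=> nK; rewrite /beta; case: asboolP => // dw.
have [_ _ _ [ic _] _] := atlas_chart Ac0.
rewrite flat_le0// subr_le0 leNgt; apply/negP => p1; apply: nK.
exists (chart_map c0 w); last exact: ic.
move=> i /=; rewrite in_itv /=.
set d := chart_map c0 w 0 i - x0 0 i.
have d1 : (d / r) ^+ 2 <= 1.
  apply: le_trans (ltW p1); apply: ler_wpDr; first by rewrite mulr_ge0// sqr_ge0.
  by rewrite /rho2 (bigD1 i)//= lerDl sumr_ge0// => j _; exact: sqr_ge0.
have : `|d / r| <= 1 by rewrite -(@ler_pXn2r _ 2)// ?nnegrE// expr1n real_normK ?num_real.
rewrite normrM normfV (gtr0_norm r0) ler_pdivrMr// mul1r ler_norml /d => /andP[? ?].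
by apply/andP; split; lra.
Qed.

Lemma bump_lift_near_int (k : int) y s : `|s - k%:~R| <= 4^-1 ->
  bump_lift y s = 8^-1 * flat 0 1.
Proof.
rewrite ler_norml => /andP[h1 h2]; have [sk|sk] := leP k%:~R s.
  rewrite (@bump_lift_cell k); last by apply/andP; split; lra.
  by rewrite beta_out ?subr0// ler0_norm; lra.
rewrite (@bump_lift_cell (k - 1)) intrB; last by apply/andP; split; lra.
by rewrite beta_out ?subr0// ger0_norm; lra.
Qed.

(** Three local situations: near an integer height and off the support the field is constant; over
    the support it is an explicit expression in the coordinates of [c0]. *)
Lemma bump_field_smooth : suspension_smooth bump_field.
Proof.
move=> _ [[c a] [/= Ac _] <-] m.
apply: Ck_local => -[x s] [/= xc sa].
have fsE z u : (bump_field \o chart_inv (@suspension_chart _ _ _ f c a)) (z, u) =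
  bump_lift (chart_inv c z) u by rewrite /= bump_fieldE.
have [oc _ [fc _] [ic _] _] := atlas_chart Ac.
have [od _ _ _ _] := atlas_chart Ac0.
set k := Num.floor s.
have ks : k%:~R <= s by exact: floor_le.
have ks1 : s < k%:~R + 1 by rewrite -intrD1 floorD1_gt.
have oI (u v : R) : open (`]u, v[%classic : set R^o) by exact: interval_open.
have {ks} [ks|ks] : s = k%:~R \/ k%:~R < s.
  by move: ks; rewrite le_eqVlt => /orP[/eqP <-|]; [left|right].
- exists ([set: 'rV[R]_n] `*` `](k%:~R - 4^-1), (k%:~R + 4^-1)[).
    by split => //=; rewrite in_itv /= ks; apply/andP; split; lra.
  apply: (Ck_ext _ _ (Ck_cst m _ (8^-1 * flat 0 1 : R^o))).
    by apply: open_prod => //; exact: openT.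
  move=> [z u] [_ /=]; rewrite in_itv /= => /andP[? ?].
  by rewrite bump_fieldE (@bump_lift_near_int k)// ler_norml; apply/andP; split; lra.
have [Kw|nKw] := pselect (K (ziter f k (chart_inv c x))); last first.
  exists ((chart_cod c `&` (ziter f k \o chart_inv c) @^-1` (~` K)) `*` `]k%:~R, (k%:~R + 1)[).
    by split => //=; rewrite in_itv /= ks.
  apply: (Ck_ext _ _ (Ck_cst m _ (8^-1 * flat 0 1 : R^o))).
    apply: open_prod => //; apply: chart_preimage_open; first exact: atlas_chart.
      exact: ziter_continuous.
    by rewrite openC; exact: bump_support_closed.
  move=> [z u] [[_ /= nK]]; rewrite in_itv /= => /andP[? ?].
  rewrite bump_fieldE (@bump_lift_cell k); last by apply/andP; split; lra.
  by rewrite beta_notin ?subr0.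
pose W := chart_cod c `&` (ziter f k \o chart_inv c) @^-1` chart_dom c0.
have oW : open W.
  by apply: chart_preimage_open => //; [exact: atlas_chart|exact: ziter_continuous].
have dKw : chart_dom c0 (ziter f k (chart_inv c x)).
  case: Kw => z Kz <-; have [_ _ [_ gi] _ _] := atlas_chart Ac0.
  apply: gi; apply: box => i; have := Kz i; rewrite /= in_itv /= => /andP[? ?].
  by rewrite ler_norml; apply/andP; split; lra.
exists (W `*` `]k%:~R, (k%:~R + 1)[); first by split => //=; rewrite in_itv /= ks.
pose V : set ('rV[R]_n * R^o)%type := W `*` `]k%:~R, (k%:~R + 1)[.
have oV : open V by exact: open_prod.
rewrite -/V.
apply: (@Ck_ext _ _ _ m _ (fun p : 'rV[R]_n * R^o =>
  8^-1 * (flat 0 1 - flat 0 (1 - (\sum_i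
    ((chart_map c0 (ziter f k (chart_inv c p.1)) 0 i - x0 0 i) * r^-1) *
    ((chart_map c0 (ziter f k (chart_inv c p.1)) 0 i - x0 0 i) * r^-1) +
    16 * ((p.2 - (k%:~R + 2^-1)) * (p.2 - (k%:~R + 2^-1)))))) : R)) => //.
  move=> [z u] [[_ /= dz]]; rewrite in_itv /= => /andP[? ?].
  rewrite bump_fieldE (@bump_lift_cell k); last by apply/andP; split; lra.
  rewrite /beta asboolT// /profile /rho2; congr (_ * (_ - flat 0 (1 - (_ + _)))).
  by rewrite expr2 opprD addrA.
have csnd : Ck m V (fun p : 'rV[R]_n * R^o => p.2 : R).
  by apply: (@Ck_linear R ('rV[R]_n * R^o)%type R^o m _ snd) => p; exact: cvg_snd.
have cF i : Ck m V
   (fun p : 'rV[R]_n * R^o => chart_map c0 (ziter f k (chart_inv c p.1)) 0 i : R).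
  apply: (@Ck_pre_linear R 'rV[R]_n ('rV[R]_n * R^o)%type R m V W
    (fun x => chart_map c0 (ziter f k (chart_inv c x)) 0 i : R) fst) => //.
  - by move=> p; exact: cvg_fst.
  - by move=> p [].
  - exact: ziter_smooth.
have cc (b : R) := @Ck_cst R ('rV[R]_n * R^o)%type R m V b.
apply: CkM => //; apply: CkB => //; apply: Ck_post => //; first exact: flat_smooth.
apply: CkB => //; apply: CkD => //; last first.
  by apply: CkM => //; apply: CkM => //; apply: CkB.
apply: Ck_sum => // i; apply: CkM => //; apply: CkM => //; exact: CkB.
Qed.

(** Along a fibre, [y] enters the profile as an additive constant only, so the bound on the slope is
    uniform in [y]. *)
Lemma bump_lift_derive : exists2 L : R, 0 <= L &
  forall y s, exists2 l : R, is_derive s (1 : R) (bump_lift y) l & `|l| <= L.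
Proof.
have [B HB] := @flat_bounded R 1.
have B0 : 0 <= B by exact: le_trans (HB 0).
exists (16 * B) => [|y s]; first by rewrite mulr_ge0.
set k := Num.floor s.
have ks : k%:~R <= s by exact: floor_le.
have ks1 : s < k%:~R + 1 by rewrite -intrD1 floorD1_gt.
have {ks} [ks|ks] : s = k%:~R \/ k%:~R < s.
  by move: ks; rewrite le_eqVlt => /orP[/eqP <-|]; [left|right].
  exists 0; last by rewrite normr0 mulr_ge0.
  apply: (is_derive_quadratic (C := 0) (d := 4^-1)) => [|h h1]; first by rewrite invr_gt0.
  rewrite !(@bump_lift_near_int k) ?subrr ?mulr0 ?subrr ?normr0 ?mul0r//.
    by rewrite ks subrr normr0 invr_ge0.
  by rewrite ks addrAC subrr add0r.
have near_cell : \forall u \near s, k%:~R <= u <= k%:~R + 1.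
  near=> u; apply/andP; split; apply: ltW; near: u; [exact: lt_nbhsr|exact: lt_nbhsl].
have cellE : \forall u \near s, 8^-1 * (flat 0 1 - beta (ziter f k y) (u - k%:~R)) = bump_lift y u.
  by apply: filterS near_cell => u hu; rewrite (@bump_lift_cell k).
set w := ziter f k y in cellE.
have [dw|ndw] := pselect (chart_dom c0 w); last first.
  exists 0; last by rewrite normr0 mulr_ge0.
  apply: near_eq_is_derive cellE _; rewrite /beta asboolF//.
  exact: is_derive_cst.
pose A := rho2 (chart_map c0 w).
pose p u : R := 1 - (A + 16 * (u - k%:~R - 2^-1) ^+ 2).
have dp : is_derive s (1 : R) p (- (32 * (s - k%:~R - 2^-1))).
  apply: (is_derive_quadratic (C := 16) (d := 1)) => // h _.
  have -> : p (s + h) - p s - h * - (32 * (s - k%:~R - 2^-1)) = - (16 * h ^+ 2).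
    by rewrite /p; field.
  by rewrite normrN ger0_norm// mulr_ge0// sqr_ge0.
have dfp := @is_derive1_comp R (flat 0) p s _ _ (flat_derive 0 (p s)) dp.
exists (8^-1 * - (flat 1 (p s) * (- (32 * (s - k%:~R - 2^-1))))).
  apply: near_eq_is_derive cellE _; rewrite /beta asboolT//.
  have := is_deriveZ (8^-1 : R) (is_deriveB (is_derive_cst (flat 0 1 : R) s (1 : R)) dfp).
  by rewrite sub0r.
rewrite mulrN normrN !normrM normrN normrM.
have h1 : `|s - k%:~R - 2^-1| <= 2^-1 by rewrite ler_norml; apply/andP; split; lra.
have := HB (p s) => h2.
have : `|flat 1 (p s)| * `|s - k%:~R - 2^-1| <= B * 2^-1 by rewrite ler_pM.
have -> : `|8^-1| = 8^-1 :> R by rewrite ger0_norm ?invr_ge0.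
have -> : `|32| = 32 :> R by rewrite ger0_norm.
by lra.
Unshelve. all: by end_near. Qed.

(** The lower bound limits the time lost near the centre, for positive entropy; the upper bound
    gives zones where the field is small, for zero entropy. *)
Lemma bump_field_props : exists L c C : R, [/\ 0 <= L, 0 < c, 0 < C,
  forall y s s', `|bump_field (spiR f y s) - bump_field (spiR f y s')| <= L * `|s - s'| &
  forall y s, 0 <= s <= 1 ->
    (chart_dom c0 y -> c * Num.min 1 (profile y s) <= bump_field (spiR f y s) <= C * profile y s) /\
    (~ chart_dom c0 y -> c <= bump_field (spiR f y s))].
Proof.
have [L L0 HL] := bump_lift_derive.
have [c c1 Hc] := @flat_gap_lower R.
have [C C1 HC] := @flat_gap_upper R.
exists L, (8^-1 * c), (8^-1 * C); split => //; [by rewrite mulr_gt0|by rewrite mulr_gt0| |].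
  move=> y s s'; rewrite !bump_fieldE.
  have [d Hd] := @choice _ _ (fun s l => is_derive s (1 : R) (bump_lift y) l /\ `|l| <= L)
    (fun s => let: ex_intro2 l h1 h2 := HL y s in ex_intro _ l (conj h1 h2)).
  by apply: (mvt_norm (df := d)) => u; [exact: (Hd u).1|exact: (Hd u).2].
move=> y s s01; rewrite bump_fieldE (@bump_lift_cell 0) ?add0r// subr0 /=.
have p0 : 0 <= profile y s by rewrite addr_ge0 ?rho2_ge0// mulr_ge0// sqr_ge0.
split => dy.
  rewrite /beta asboolT// -!mulrA; apply/andP; split; rewrite ler_wpM2l ?invr_ge0//.
    exact: Hc.
  exact: HC.
rewrite /beta asboolF// subr0 ler_wpM2l ?invr_ge0//.
by have := Hc 1 ler01; rewrite subrr [flat 0 0]flat_le0// subr0 minxx mulr1.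
Qed.

Lemma bump_field_bounds p : 0 <= bump_field p <= 8^-1.
Proof.
have [y [s [_ ->]]] := spiR_surj p; rewrite bump_fieldE /bump_lift.
set w := ziter _ _ _; set u := s - _.
have h : 0 <= beta w u <= flat 0 1.
  rewrite /beta; case: ifPn => _; last by rewrite lexx flat_ge0.
  rewrite flat_ge0 flat_nondecreasing// gerBl addr_ge0 ?rho2_ge0//.
  by rewrite mulr_ge0// sqr_ge0.
have := @flat_le1 R 1; move: h => /andP[h1 h2] h3.
by apply/andP; split; lra.
Qed.

End BumpField.

(** * Zero entropy *)

(* [compact_cover] needs a pointed space; any point will do. *)
Lemma compact_cover_compact (T : topologicalType) (A : set T) :
  compact A -> cover_compact A.
Proof.
move=> cA; have [[x _]|nT] := pselect (exists x : T, True).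
  pose pT : ptopologicalType := HB.pack (Topological.sort T) (isPointed.Build (Topological.sort T) x).
  by have := cA; rewrite -[compact _]/(@compact pT A) (@compact_cover pT).
move=> I D g _ _; exists finmap.fset0 => [i|y _]; first by rewrite finmap.in_fset0.
by case: nT; exists y.
Qed.

Section CoverEntropy.
Context {R : realType} {T : topologicalType}.
Local Open Scope ereal_scope.

Lemma limn_esup_le (u : nat -> \bar R) (b : \bar R) N :
  (forall n, (N <= n)%N -> u n <= b) -> limn_esup u <= b.
Proof.
move=> H; apply: (@le_trans _ _ (ereal_sup [set u n | n in [set n | (N <= n)%N]])).
  by apply: ereal_inf_lbound; exists [set n | (N <= n)%N] => //; exact: nbhs_infty_ge.
by apply/ereal_supP => _ [n Nn <-]; exact: H.
Qed.

Lemma limn_esup_ge (u : nat -> \bar R) (b : \bar R) :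
  (forall N, exists2 n, (N <= n)%N & b <= u n) -> b <= limn_esup u.
Proof.
move=> H; apply/ereal_infP => _ [A [N _ AN] <-].
have [n Nn bn] := H N; apply: (le_trans bn); apply: ereal_sup_ubound.
by exists n => //; exact: AN.
Qed.

Lemma limn_esup_gt (u : nat -> \bar R) (b : \bar R) : b < limn_esup u ->
  forall N, exists2 n, (N <= n)%N & b < u n.
Proof.
move=> bu N; apply: contrapT => H; move: bu; apply/negP; rewrite -leNgt.
apply: (@limn_esup_le _ _ N) => n Nn; rewrite leNgt; apply/negP => bn.
by apply: H; exists n.
Qed.

Lemma lne_le (x y : \bar R) : 0 <= x -> x <= y -> lne x <= lne y.
Proof.
move=> x0 xy; rewrite lee_lne// in_itv/= ?leey ?x0//.
by rewrite (le_trans x0).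
Qed.

Lemma finite_subcover (U : set (set T)) : compact [set: T] -> open_cover U ->
  exists2 s : seq (set T), [set` s] `<=` U & \bigcup_(A in [set` s]) A = [set: T].
Proof.
move=> /compact_cover_compact cT [oU Uc].
have UT : [set: T] `<=` cover U id by rewrite /cover Uc.
have [D DU Dc] := cT _ U id oU UT.
exists (finmap.enum_fset D) => [A /DU|]; first by rewrite inE.
by apply/seteqP; split => // x _; have [A DA Ax] := Dc x I; exists A.
Qed.

Lemma min_subcover_le (U : set (set T)) (s : seq (set T)) :
  [set` s] `<=` U -> \bigcup_(A in [set` s]) A = [set: T] ->
  min_subcover R U <= ((size s)%:R : R)%:E.
Proof. by move=> sU sc; apply: ereal_inf_lbound; exists s. Qed.

Lemma min_subcover_ge (U : set (set T)) (b : R) :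
  (forall s : seq (set T), [set` s] `<=` U -> \bigcup_(A in [set` s]) A = [set: T] ->
     (b <= (size s)%:R)%R) -> b%:E <= min_subcover R U.
Proof. by move=> H; apply/ereal_infP => _ [s [sU sc] <-]; rewrite lee_fin; exact: H. Qed.

Lemma cover_entropy_ge0 (F : T -> T) (x : T) U : 0 <= cover_entropy R F U.
Proof.
apply: limn_esup_ge => N; exists N => //.
rewrite mule_ge0 ?lee_fin ?invr_ge0// lne_ge0.
apply: (@min_subcover_ge _ 1%R) => -[|A s] _ sc; last by rewrite ler1n.
by have : [set: T] x by []; rewrite -sc => -[A].
Qed.

Lemma topological_entropy_ge0 (F : T -> T) (x : T) : 0 <= topological_entropy R F.
Proof.
apply: (@le_trans _ _ (cover_entropy R F [set setT])); first exact: cover_entropy_ge0.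
apply: ereal_sup_ubound; exists [set setT] => //; split; first by move=> A ->; exact: openT.
by rewrite bigcup_set1.
Qed.

End CoverEntropy.

(* Chernoff's bound, with the exponential weight [t]. *)
Lemma card_rare_words (R : realType) (m N : nat) (t K : R) : 0 <= t ->
  (#|[set w : {ffun 'I_N -> 'I_m.+1} | (\sum_i (w i != ord0))%:R <= K]%SET|%:R : R)
    <= expR (t * K) * expR (m%:R * expR (- t)) ^+ N.
Proof.
move=> t0; set S := [set w | _]%SET.
have H : \sum_(w in S) 1 <= \sum_(w in S) expR (t * K) * \prod_(i < N) expR (- t *+ (w i != ord0)).
  apply: ler_sum => w; rewrite inE => wK.
  rewrite -expR_sum -expRD -[X in X <= _]expR0 ler_expR.
  by rewrite sumrMnr -mulr_natr mulNr subr_ge0 ler_wpM2l.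
rewrite sumr_const in H; apply: (le_trans H).
rewrite -mulr_sumr ler_wpM2l ?expR_ge0//.
apply: (@le_trans _ _ (\sum_(w : {ffun 'I_N -> 'I_m.+1}) \prod_(i < N) expR (- t *+ (w i != ord0)))).
  rewrite [leRHS](bigID (mem S)) /= lerDl sumr_ge0// => w _.
  by apply: prodr_ge0 => i _; exact: expR_ge0.
rewrite -(bigA_distr_bigA (fun (i : 'I_N) (c : 'I_m.+1) => expR (- t *+ (c != ord0)))) /=.
rewrite prodr_const card_ord; apply: lerXn2r; rewrite ?nnegrE ?expR_ge0//.
  by apply: sumr_ge0 => *; exact: expR_ge0.
rewrite big_ord_recl /= mulr0n expR0.
under eq_bigr do rewrite mulr1n.
rewrite sumr_const card_ord -[X in 1 + X]mulr_natl; exact: expR_ge1Dx.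
Qed.

(* [w i = ord0] codes a visit to a member of the cover containing [p]; by
   hypothesis the other letters are rare in the itineraries. *)
Lemma zero_entropy (R : realType) (T : topologicalType) (F : T -> T) (p : T) :
  compact [set: T] ->
  (forall (A : set T) (e : R), open A -> A p -> 0 < e ->
    exists N, forall n x, (N <= n)%N ->
      (\sum_(i < n) (`[< ~ A (iter i F x) >] : nat))%:R <= e * n%:R) ->
  topological_entropy R F = 0%E.
Proof.
move=> cT H; apply/eqP; rewrite eq_le (topological_entropy_ge0 F p) andbT.
apply/ereal_supP => _ [U [oU Uc] <-].
apply/lee_addgt0Pr => d d0; rewrite add0e.
have [s sU sc] := finite_subcover cT (conj oU Uc).
have [A0 UA0 A0p] : exists2 A, U A & A p by have : [set: T] p by []; rewrite -Uc => -[A]; exists A.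
set m := size s.
pose u (c : 'I_m.+1) : set T := nth setT (A0 :: s) c.
have Uu c : U (u c).
  rewrite /u; case: c => -[|c] cm //=; apply: sU => /=; exact: mem_nth.
(* With this weight [m exp(-t) <= d / 2]; with frequency [d / 2 / t] of rare letters, the two
   factors of Chernoff's bound contribute [d / 2] per letter each. *)
pose t : R := 2 * m.+1%:R / d.
have t0 : 0 < t by rewrite divr_gt0// mulr_gt0.
have mt : m%:R * expR (- t) <= d / 2.
  rewrite expRN ler_pdivrMr ?expR_gt0//.
  apply: (@le_trans _ _ (d / 2 * t)); last first.
    by rewrite ler_wpM2l ?divr_ge0 ?ltW// (lt_le_trans _ (expR_ge1Dx _))// ltrDr.
  have -> : d / 2 * t = m.+1%:R by rewrite /t; field; rewrite gt_eqF.
  by rewrite ler_nat.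
have e0 : 0 < d / 2 / t by rewrite !divr_gt0.
have [N HN] := H A0 _ (oU _ UA0) A0p e0.
apply: (@limn_esup_le _ _ _ N) => n Nn.
have n0 : 0 < n.+1%:R :> R by rewrite ltr0n.
pose S := [set w : {ffun 'I_n.+1 -> 'I_m.+1} | (\sum_i (w i != ord0))%:R <= d / 2 / t * n.+1%:R]%SET.
pose cyl (w : {ffun 'I_n.+1 -> 'I_m.+1}) : set T :=
  \bigcap_(i in `I_n.+1) (iter i F @^-1` u (w (inord i))).
(* The cylinders of the words with few nonzero letters already cover the space. *)
have B : (min_subcover R (iterated_join F U n.+1) <= (#|S|%:R : R)%:E)%E.
  rewrite cardE -(size_map cyl); apply: min_subcover_le.
    move=> _ /= /mapP[w _ ->]; exists (fun i => u (w (inord i))) => // i _; exact: Uu.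
  apply/seteqP; split => // x _.
  have wx (i : 'I_n.+1) : exists c : 'I_m.+1,
      u c (iter i F x) /\ (c != ord0 -> ~ A0 (iter i F x)).
    have [Ax|nAx] := pselect (A0 (iter i F x)); first by exists ord0; split.
    have : [set: T] (iter i F x) by [].
    rewrite -sc => -[A /= As Ax].
    have ltA : ((index A s).+1 < m.+1)%N by rewrite ltnS index_mem.
    by exists (Ordinal ltA); split => //; rewrite /u /= nth_index.
  have [w wP] := choice wx.
  exists (cyl [ffun i => w i]); last first.
    move=> i /= ilt; rewrite ffunE.
    by have [+ _] := wP (inord i); rewrite inordK.
  apply/mapP; exists [ffun i => w i] => //.
  rewrite mem_enum inE; apply: le_trans (HN n.+1 x (leqW Nn)).
  rewrite ler_nat; apply: leq_sum => i _; rewrite ffunE.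
  by case: eqP => //= /eqP wi; rewrite asboolT//; exact: (wP i).2.
have S0 : (0 <= min_subcover R (iterated_join F U n.+1))%E.
  by apply: min_subcover_ge => *; rewrite ler0n.
apply: (@le_trans _ _ (n.+1%:R^-1%:E * lne ((#|S|%:R : R)%:E))%E).
  by rewrite lee_wpmul2l ?lee_fin ?invr_ge0//; exact: lne_le.
(* [lne] of 0 is minus infinity, so the empty case is separate. *)
have [cS|cS] := posnP #|S|.
  rewrite cS le0_lneNy//; rewrite gt0_muleNy ?lte_fin ?invr_gt0//. exact: leNye.
rewrite lne_EFin ?ltr0n// -EFinM lee_fin mulrC ler_pdivrMr//.
rewrite -ler_expR lnK ?posrE ?ltr0n//.
apply: (le_trans (card_rare_words _ _ _ (ltW t0))).
rewrite -expRM_natl -expRD ler_expR.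
have -> : t * (d / 2 / t * n.+1%:R) = d / 2 * n.+1%:R by field; rewrite gt_eqF.
rewrite (mulrC n.+1%:R) -mulrDl ler_wpM2r//.
by rewrite -lerBrDl (le_trans mt)//; lra.
Qed.

(** Dense orbits make the preimages of [V] a cover; a finite subcover bounds the waiting time
    uniformly. *)
Lemma minimal_return (T : topologicalType) (g : T -> T) (V : set T) :
  compact [set: T] -> continuous g -> minimal g -> open V -> V !=set0 ->
  exists J, forall y, exists2 j, (j <= J)%N & V (iter j g y).
Proof.
move=> cT cg mg oV V0.
have cit j : continuous (iter j g).
  elim: j => [|j IH] x; first exact: cvg_id.
  by apply: (@continuous_comp _ _ _ (iter j g) g); [exact: IH|exact: cg].
have [||D _ Dc] := compact_cover_compact cT (I := nat) (D := setT) (f := fun j => iter j g @^-1` V).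
- by move=> j _; apply: open_comp oV => x _; exact: cit.
- move=> y _; have [z [Vz [j _ ez]]] := mg y V V0 oV.
  by exists j => //=; rewrite ez.
exists (\max_(j <- finmap.enum_fset D) j)%N => y.
by have [j jD Vj] := Dc y I; exists j => //; exact: leq_bigmax_seq.
Qed.

(** * Heights along the fibres *)

Section FiberDynamics.
Context {R : realType} {E : normedModType R} {M : smoothManifold E} (f : diffeo M).
Variables (alpha : suspension f -> R) (L : R) (sigma : R -> M -> R -> R)
  (phi : R -> suspension f -> suspension f).
Hypothesis alpha_cont : continuous alpha.
Hypothesis alpha01 : forall p, 0 <= alpha p <= 1.
Hypothesis L0 : 0 <= L.
Hypothesis alphaL : forall y s s',
  `|alpha (spiR f y s) - alpha (spiR f y s')| <= L * `|s - s'|.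
Hypothesis sigma0 : forall y s, sigma 0 y s = s.
Hypothesis sigmaD : forall t t' y s, sigma (t + t') y s = sigma t y (sigma t' y s).
Hypothesis dsigma : forall y s t, is_derive t (1 : R) (fun t => sigma t y s)
        (alpha (spiR f y (sigma t y s))).
Hypothesis phiE : forall t y s, phi t (spiR f y s) = spiR f y (sigma t y s).

Lemma sigma_nondecreasing y s : {homo (fun t => sigma t y s) : t t' / t <= t'}.
Proof.
move=> t t' tt'; rewrite -subr_ge0 -(mul0r (t' - t)).
apply: (mvt_ge (f := fun t => sigma t y s)) tt' (fun u _ => dsigma y s u) _ => u _.
by have /andP[] := alpha01 (spiR f y (sigma u y s)).
Qed.

Lemma sigma_lip y s t t' : `|sigma t' y s - sigma t y s| <= `|t' - t|.
Proof.
have := mvt_norm (dsigma y s) (M := 1) _ t t'; rewrite mul1r; apply => u.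
by have /andP[h0 h1] := alpha01 (spiR f y (sigma u y s)); rewrite ger0_norm.
Qed.

Lemma phi_iter i y s : iter i (phi 1) (spiR f y s) = spiR f y (sigma i%:R y s).
Proof.
elim: i => [|i IH]; first by rewrite sigma0.
by rewrite /= IH phiE -sigmaD -natr1 addrC.
Qed.

(** By the Lipschitz bound, the speed stays above [c / 2] for a time at least the minimum of 1 and
    [c / (2 (L + 1))]. *)
Lemma sigma_advance (c : R) y s t : 0 < c ->
  c <= alpha (spiR f y (sigma t y s)) ->
  c / 2 * Num.min 1 (c / (2 * (L + 1))) <= sigma (t + 1) y s - sigma t y s.
Proof.
move=> c0 ct; set d := Num.min 1 _.
have L1 : 0 < L + 1 by rewrite ltr_wpDl.
have d0 : 0 <= d by rewrite le_min ler01 divr_ge0 ?mulr_ge0 ?ltW.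
have d1 : d <= 1 by rewrite ge_min lexx.
have dL : L * d <= c / 2.
  apply: (@le_trans _ _ ((L + 1) * (c / (2 * (L + 1))))).
    by rewrite ler_pM// ?lerDl// ge_min lexx orbT.
  by rewrite le_eqVlt; apply/orP; left; apply/eqP; field; rewrite gt_eqF.
apply: (@le_trans _ _ (sigma (t + d) y s - sigma t y s)); last first.
  by rewrite lerD2r; apply: sigma_nondecreasing; rewrite lerD2l.
have td : t <= t + d by rewrite lerDl.
have := @mvt_ge R (fun t => sigma t y s) _ t (t + d) (c / 2) td (fun u _ => dsigma y s u).
rewrite [t + d - t]addrAC subrr add0r; apply => u /andP[u1 u2].
have := alphaL y (sigma u y s) (sigma t y s).
have h : L * `|sigma u y s - sigma t y s| <= c / 2.
  apply: le_trans dL; rewrite ler_wpM2l//; apply: (le_trans (sigma_lip _ _ _ _)).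
  by rewrite ger0_norm ?subr_ge0// lerBlDl.
by move=> /le_trans/(_ h); rewrite ler_norml => /andP[? ?]; lra.
Qed.

(** Off a neighbourhood of [p] the field has a positive minimum, so each visit there raises the
    height by a fixed [k]; a height gain of at most [e k n] allows at most [e n] visits. *)
Lemma slow_zero_entropy (p : suspension f) : compact [set: suspension f] ->
  (forall q, q <> p -> 0 < alpha q) ->
  (forall e : R, 0 < e -> exists N : nat, forall n y s, (N <= n)%N ->
     sigma n%:R y s - s <= e * n%:R) ->
  flow_entropy (R := R) phi = 0%E.
Proof.
move=> cO ap speed; apply: (zero_entropy (p := p)) => // A e oA Ap e0.
have [c c0 Hc] : exists2 c : R, 0 < c & forall q, ~ A q -> c <= alpha q.
  have [[q0 nq0]|nA] := pselect (exists q, ~ A q); last first.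
    by exists 1 => // q nq; case: nA; exists q.
  have cA : compact (~` A).
    by apply: subclosed_compact cO _ => //; rewrite closedC.
  have [||q nq qmin] := @compact_EVT_min _ _ alpha (~` A) _ cA.
  - by exists q0.
  - exact: continuous_subspaceT.
  exists (alpha q); first by apply: ap => qp; move: nq; rewrite inE qp; apply.
  by move=> z nz; apply: qmin; rewrite inE.
pose k := c / 2 * Num.min 1 (c / (2 * (L + 1))).
have L1 : 0 < L + 1 by rewrite ltr_wpDl.
have k0 : 0 < k.
  by rewrite mulr_gt0 ?divr_gt0// lt_min ltr01 divr_gt0// mulr_gt0.
have [N HN] := speed (e * k) (mulr_gt0 e0 k0).
exists N => n x Nn; have [y [s [_ ->]]] := spiR_surj x.
rewrite -(ler_pM2r k0); have := HN n y s Nn.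
rewrite mulrAC; apply: le_trans.
elim: n {Nn} => [|n IH]; first by rewrite big_ord0 mul0r sigma0 subrr.
rewrite big_ord_recr /= natrD mulrDl.
have -> : sigma n.+1%:R y s - s = (sigma n%:R y s - s) + (sigma n.+1%:R y s - sigma n%:R y s) by ring.
apply: lerD => //; rewrite -natr1; case: asboolP => /= [nA|_].
  by rewrite mul1r; apply: sigma_advance => //; rewrite -phi_iter; exact: Hc.
by rewrite mul0r subr_ge0; apply: sigma_nondecreasing; rewrite lerDl.
Qed.

(** Climbing beyond [s + T] requires crossing an interval of length [2 l] at speed at most [eps]. *)
Lemma crossing_time (y : M) (s T l eps c t : R) : 0 < eps -> 0 < l ->
  s <= c - l -> c + l <= s + T ->
  (forall u, `|u - c| <= l -> alpha (spiR f y u) <= eps) ->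
  0 <= t -> t <= 2 * l / eps -> sigma t y s <= s + T.
Proof.
move=> eps0 l0 sc cT slow t0 tl; rewrite leNgt; apply/negP => sT.
have cs a b : {within `[a, b], continuous (fun t => sigma t y s)}.
  apply: continuous_subspaceT => u; exact: is_derive_continuous (dsigma y s u).
have st : s <= sigma t y s.
  by rewrite -{1}(sigma0 y s); exact: sigma_nondecreasing.
have mn v : s <= v <= sigma t y s ->
    Num.min (sigma 0 y s) (sigma t y s) <= v <= Num.max (sigma 0 y s) (sigma t y s).
  by rewrite sigma0 (min_idPl st) (max_idPr st).
have [|t1 t1I E1] := IVT t0 (cs 0 t) (mn (c - l) _).
  by apply/andP; split; lra.
have [|t2 t2I E2] := IVT t0 (cs 0 t) (mn (c + l) _).
  by apply/andP; split; lra.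
move: t1I t2I; rewrite !in_itv /= => /andP[t10 t1t] /andP[t20 t2t].
(* At time [t] the height is strictly above [c + l]; this supplies the strict inequality of the
   contradiction. *)
have t2t' : t2 < t.
  rewrite lt_neqAle t2t andbT; apply/eqP => e; move: E2; rewrite e; lra.
have t12 : t1 <= t2.
  rewrite leNgt; apply/negP => /ltW/(sigma_nondecreasing y s).
  by rewrite /= E1 E2; lra.
have := @mvt_le R (fun t => sigma t y s) _ t1 t2 eps t12 (fun u _ => dsigma y s u).
rewrite E1 E2 => H.
have {}H : c + l - (c - l) <= eps * (t2 - t1).
  apply: H => u /andP[u1 u2]; apply: slow.
  have := (sigma_nondecreasing y s u1); have := (sigma_nondecreasing y s u2).
  by rewrite /= E1 E2 ler_norml => *; apply/andP; split; lra.
have : eps * (t2 - t1) < eps * t by rewrite ltr_pM2l//; lra.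
have : eps * t <= 2 * l.
  by rewrite mulrC -ler_pdivlMr.
by lra.
Qed.

Lemma iterate_speed (tau T : R) : 0 < tau ->
  (forall y s, sigma tau y s <= s + T) ->
  forall j y s, sigma (j%:R * tau) y s <= s + j%:R * T.
Proof.
move=> tau0 H; elim=> [|j IH] y s; first by rewrite !mul0r sigma0 addr0.
rewrite -natr1 mulrDl mul1r addrC sigmaD; apply: (le_trans (H _ _)).
by have := IH y s; lra.
Qed.

(** Blocks of time [(m + 1) T m] gain at most [T m], hence mean speed [1 / (m + 1)]; rounding [n] up
    to whole blocks costs one extra [T m]. Each contribution gets [e / 2]. *)
Lemma slow_speed (T : nat -> R) : (forall m, 0 < T m) ->
  (forall m y s, sigma (m.+1%:R * T m) y s <= s + T m) ->
  forall e : R, 0 < e -> exists N : nat, forall n y s, (N <= n)%N ->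
     sigma n%:R y s - s <= e * n%:R.
Proof.
move=> T0 H e e0.
pose m := Num.truncn (2 / e).
have me : 2 / m.+1%:R <= e.
  rewrite ler_pdivrMr ?ltr0n// mulrC -ler_pdivrMr//.
  exact/ltW/truncnS_gt.
pose N := (Num.truncn (2 * T m / e)).+1.
exists N => n y s Nn.
have Tn : 2 * T m <= e * n%:R.
  rewrite [X in _ <= X]mulrC -ler_pdivrMr//; apply: (le_trans (ltW (truncnS_gt _))).
  by rewrite ler_nat.
have tau0 : 0 < m.+1%:R * T m by rewrite mulr_gt0// ltr0n.
set tau := m.+1%:R * T m in tau0.
have ntau0 : 0 <= n%:R / tau by rewrite divr_ge0// ltW.
pose j := (Num.truncn (n%:R / tau)).+1.
have nj : n%:R <= j%:R * tau by rewrite -ler_pdivrMr//; exact/ltW/truncnS_gt.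
have jn : j%:R <= n%:R / tau + 1.
  by rewrite /j -natr1 lerD2r truncn_le.
have h1 := iterate_speed tau0 (H m) j y s.
have h2 : sigma n%:R y s <= sigma (j%:R * tau) y s := sigma_nondecreasing y s nj.
have h3 : j%:R * T m <= n%:R / m.+1%:R + T m.
  apply: (@le_trans _ _ ((n%:R / tau + 1) * T m)); first by rewrite ler_wpM2r// ltW.
  rewrite le_eqVlt; apply/orP; left; apply/eqP.
  rewrite /tau; field; by rewrite !gt_eqF ?ltr0n.
have h4 : n%:R / m.+1%:R <= e / 2 * n%:R.
  rewrite mulrC ler_wpM2r//.
  by rewrite ler_pdivlMr// mulrC.
move: h1 h2 h3 h4 Tn; move: (sigma n%:R y s) (sigma (j%:R * tau) y s) (j%:R * T m) (n%:R / m.+1%:R) => a b a1 b1 *.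
by lra.
Qed.

End FiberDynamics.

(** * A field of zero average speed *)

Section Slow.
Context {R : realType} {n : nat} {M : smoothManifold 'rV[R]_n} (f : diffeo M).
Variables (c0 : chart 'rV[R]_n M) (x0 : 'rV[R]_n) (r : R).
Hypothesis Ac0 : atlas (s := M) c0.
Hypothesis r0 : 0 < r.
Hypothesis box : forall x : 'rV[R]_n, (forall i, `|x 0 i - x0 0 i| <= r) -> chart_cod c0 x.

Let q := @bump_field R n M f c0 x0 r.
Let p0 := spiR f (chart_inv c0 x0) 2^-1.

Lemma rho2_continuous : continuous (rho2 x0 r).
Proof.
move=> x; apply: continuous_sum => i.
apply: (@continuous_comp _ _ _ (fun x : 'rV[R]_n => x 0 i)
  (fun u : R => ((u - x0 0 i) / r) ^+ 2)); first exact: coord_continuous.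
apply: (@continuous_comp _ _ _ (fun u : R => (u - x0 0 i) / r) (fun u : R => u ^+ 2)).
  apply: cvgM; last exact: cvg_cst.
  by apply: cvgB; [exact: cvg_id|exact: cvg_cst].
exact: exprn_continuous.
Qed.

Lemma rho2_eq0 x : rho2 x0 r x = 0 -> x = x0.
Proof.
move=> /eqP; rewrite psumr_eq0; last by move=> i _; exact: sqr_ge0.
move=> /allP H; apply/rowP => i; have := H i (mem_index_enum i).
by rewrite /= sqrf_eq0 mulf_eq0 invr_eq0 (gt_eqF r0) orbF subr_eq0 => /eqP.
Qed.

Lemma rho2_center : rho2 x0 r x0 = 0.
Proof. by rewrite /rho2 big1// => i _; rewrite subrr mul0r expr0n. Qed.

Lemma center_in_chart : chart_cod c0 x0.
Proof. by apply: box => i; rewrite subrr normr0 ltW. Qed.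

Lemma bump_field_gt0 p : p <> p0 -> 0 < q p.
Proof.
have [L [c [C [_ c1 _ _ H]]]] := bump_field_props f c0 x0 r.
have [y [s [s01 ->]]] := spiR_surj p.
have [Hd Hn] := H y s s01.
have [dy|/Hn/(lt_le_trans c1)//] := pselect (chart_dom c0 y).
move=> neq; have /andP[+ _] := Hd dy; apply: lt_le_trans.
rewrite mulr_gt0// lt_min ltr01 /= lt_neqAle.
have sq0 : 0 <= 16 * (s - 2^-1) ^+ 2 by rewrite mulr_ge0// sqr_ge0.
have [rg sg] := (rho2_ge0 x0 r (chart_map c0 y), sq0).
rewrite addr_ge0// andbT; apply/eqP => /esym/eqP.
rewrite paddr_eq0// => /andP[/eqP/rho2_eq0 ey].
rewrite mulf_eq0 pnatr_eq0 /= sqrf_eq0 subr_eq0 => /eqP es.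
apply: neq; rewrite /p0 -ey es.
by have [_ _ _ [-> //] _] := atlas_chart Ac0.
Qed.

Lemma bump_field_center : q p0 = 0.
Proof.
have [L [c [C [_ _ _ _ H]]]] := bump_field_props f c0 x0 r.
have [_ _ [_ gi] [_ ci] _] := atlas_chart Ac0; have x0c := center_in_chart.
have h : (0 <= 2^-1 :> R) && (2^-1 <= 1 :> R) by apply/andP; split; lra.
have [+ _] := H (chart_inv c0 x0) _ h => /(_ (gi _ x0c)).
rewrite /profile ci// rho2_center subrr expr0n /= mulr0 addr0 mulr0 => /andP[_ q0].
by apply/eqP; rewrite eq_le q0 /=; have /andP[] := bump_field_bounds (f := f) c0 x0 r p0.
Qed.

(** Only [q] occurs here, so [eps] is available before the flat function [D] with
    [D (2^-m) <= eps m] is chosen. *)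
Lemma bump_slow_zones : compact [set: M] -> minimal f ->
  exists (eps T : nat -> R), [/\ forall m, 0 < eps m, forall m, 0 < T m &
    forall m y s, exists c l, [/\ 0 < l, s <= c - l, c + l <= s + T m,
      m.+1%:R * T m <= 2 * l / eps m &
      forall u, `|u - c| <= l -> q (spiR f y u) <= 2 ^- m]].
Proof.
move=> cM mf.
have [L [c [C [_ _ C0 _ H]]]] := bump_field_props f c0 x0 r.
have p2 m : 0 < 2 ^- m :> R by rewrite invr_gt0 exprn_gt0.
pose V m := chart_dom c0 `&` [set y | C * rho2 x0 r (chart_map c0 y) < 2 ^- m / 2].
have [od oc [_ gi] [_ ci] [cc _]] := atlas_chart Ac0.
have oV m : open (V m).
  rewrite openE => y [dy /= Cy]; apply: filterI; first exact: open_nbhs_nbhs.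
  have ch : {for y, continuous (fun y => C * rho2 x0 r (chart_map c0 y))}.
    apply: cvgM; first exact: cvg_cst.
    apply: (@continuous_comp _ _ _ (chart_map c0) (rho2 x0 r)); first exact: cc.
    exact: rho2_continuous.
  exact: (cvgr_lt _ ch _ Cy).
have V0 m : V m !=set0.
  have x0c := center_in_chart.
  exists (chart_inv c0 x0); split; first exact: gi.
  by rewrite /= ci// rho2_center mulr0 divr_gt0.
have [J HJ] := choice (fun m => minimal_return cM (diffeo_smooth f).1 mf (oV m) (V0 m)).
(* The height part of the profile, times [C], stays below [2^-m / 2]; [V m] ensures the same for the
   horizontal part. *)
pose l m : R := Num.min 2^-1 (2 ^- m / (32 * C)).
have l0 m : 0 < l m by rewrite lt_min invr_gt0 ltr0n /= divr_gt0// mulr_gt0.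
have lh m : l m <= 2^-1 by rewrite ge_min lexx.
(* One unit to reach an integer level above [s], at most [J m] iterations, and one unit for the cell
   containing the zone. *)
pose T m : R := (J m)%:R + 2.
have T0 m : 0 < T m by rewrite ltr_wpDl.
(* This value makes the crossing time [2 l / eps] equal to [(m + 1) T m]. *)
exists (fun m => 2 * l m / (m.+1%:R * T m)), T; split => //.
  by move=> m; rewrite divr_gt0 ?mulr_gt0 ?ltr0n.
move=> m y s; pose k0 := Num.floor s + 1.
have k0s : s <= k0%:~R by apply/ltW; exact: floorD1_gt.
have k0s1 : k0%:~R <= s + 1 by rewrite intrD1 lerD2r floor_le.
have [j jJ Vj] := HJ m (ziter f k0 y).
pose k : int := j%:Z + k0.
have kE : k%:~R = j%:R + k0%:~R :> R by rewrite intrD.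
have jJ' : j%:R <= (J m)%:R :> R by rewrite ler_nat.
have j0 : 0 <= j%:R :> R by rewrite ler0n.
exists (k%:~R + 2^-1), (l m); have := lh m; split => //.
- by rewrite kE; lra.
- by rewrite kE /T; lra.
- rewrite invfM invrK le_eqVlt; apply/orP; left; apply/eqP.
  by field; rewrite !gt_eqF ?l0 ?ltr0n.
move=> u ul; rewrite -(spiR_shift f y u k).
have uk : 0 <= u - k%:~R <= 1.
  by move: ul; rewrite ler_norml => /andP[? ?]; apply/andP; split; lra.
have [dV Cr] : V m (ziter f k y) by rewrite /k ziterD.
have [+ _] := H (ziter f k y) _ uk => /(_ dV)/andP[_ /le_trans]; apply.
rewrite /profile mulrDr.
have : C * (16 * (u - k%:~R - 2^-1) ^+ 2) <= 2 ^- m / 2.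
  rewrite -(real_normK (num_real (_ - 2^-1))) -addrA -opprD.
  set d := `|_|; have d0 : 0 <= d by exact: normr_ge0.
  have dl : d <= l m by [].
  have dd : d ^+ 2 <= l m * 2^-1 by rewrite expr2 ler_pM// (le_trans dl).
  have : l m <= 2 ^- m / (32 * C) by rewrite ge_min lexx orbT.
  rewrite ler_pdivlMr ?mulr_gt0// => h1.
  have : C * (16 * d ^+ 2) <= C * (16 * (l m * 2^-1)) by rewrite !ler_pM2l.
  by have := p2 m; lra.
by rewrite /= in Cr; lra.
Qed.

Lemma slow_field : compact [set: M] -> minimal f ->
  exists (alpha : suspension f -> R) (sigma : R -> M -> R -> R)
    (phi : R -> suspension f -> suspension f),
  [/\ [/\ suspension_smooth alpha, forall p, 0 <= alpha p <= 1,
        alpha p0 = 0 & forall p, p <> p0 -> 0 < alpha p],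
      exists2 L : R, 0 <= L & forall y s s',
        `|alpha (spiR f y s) - alpha (spiR f y s')| <= L * `|s - s'|,
      [/\ forall y s, sigma 0 y s = s,
          forall t t' y s, sigma (t + t') y s = sigma t y (sigma t' y s),
          forall y s t, is_derive t (1 : R) (fun t => sigma t y s)
            (alpha (spiR f y (sigma t y s))) &
          forall t y s, phi t (spiR f y s) = spiR f y (sigma t y s)],
      induced_flow (scale_field alpha (suspension_field f)) phi &
      flow_entropy (R := R) phi = 0%E].
Proof.
move=> cM mf.
have [eps [T [eps0 T0 zones]]] := bump_slow_zones cM mf.
have [D [sD D0 Dgt Dmono [D01 Deps]]] := superflat eps0.
have [L [c [C [L0 c1 C0 Lq H]]]] := bump_field_props f c0 x0 r.
have [B HB] := sD.2 1%N; have B0 : 0 <= B by exact: le_trans (HB 0).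
pose alpha p := D 0%N (q p).
have sq : suspension_smooth q by exact: bump_field_smooth.
have sa : suspension_smooth alpha by exact: suspension_smooth_post.
have ca := suspension_smooth_continuous sa.
have a01 p : 0 <= alpha p <= 1 by exact: D01.
have La y s s' : `|alpha (spiR f y s) - alpha (spiR f y s')| <= B * L * `|s - s'|.
  apply: (le_trans (mvt_norm (sD.1 0%N) HB _ _)).
  by rewrite -mulrA ler_wpM2l.
have BL0 : 0 <= B * L by rewrite mulr_ge0.
have q0 : q p0 = 0 by exact: bump_field_center.
have a0 : alpha p0 = 0 by rewrite /alpha q0.
have agt p : p <> p0 -> 0 < alpha p by move=> /bump_field_gt0; exact: Dgt.
have [sigma [phi [[s0 sdD] ds phiE ifl]]] := time_change ca a01 BL0 La.
exists alpha, sigma, phi; split => //; first by exists (B * L).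
apply: (slow_zero_entropy ca a01 BL0 La s0 sdD ds phiE (p := p0)) => //.
  exact: suspension_compact.
apply: (slow_speed a01 s0 sdD ds T0) => m y s.
have [d [l [l0 sd dT Tl slow]]] := zones m y s.
apply: (crossing_time a01 s0 ds (eps0 m) l0 sd dT) => //.
  move=> u /slow qu; apply: le_trans (Deps m); exact: Dmono.
by rewrite mulr_ge0// ltW.
Qed.

End Slow.

(** * Positive entropy *)

Section KernelSelection.
Context {R : realType}.
Local Open Scope ereal_scope.

Let mu := (@lebesgue_measure R \x @lebesgue_measure R)%E.
Let D : set (R * R) := `[0%R, 1%R]%classic `*` `[0%R, 1%R]%classic.

Definition dyadic_box (p : R * R) (j : nat) : set (R * R) :=
  `[(p.1 - 2 ^- j)%R, (p.1 + 2 ^- j)%R]%classic `*` `[(p.2 - 2 ^- j)%R, (p.2 + 2 ^- j)%R]%classic.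

(* Comparable to [1 / max (|p.1 - x.1|, |p.2 - x.2|)] near [p]. *)
Definition dyadic_kernel (p x : R * R) : \bar R :=
  \sum_(0 <= j <oo) ((2 : R) ^+ j)%:E * (\1_(dyadic_box p j) x)%:E.

Let mD : measurable D.
Proof. by apply: measurableX; exact: measurable_itv. Qed.

Lemma measurable_dyadic_box p j : measurable (dyadic_box p j).
Proof. by apply: measurableX; exact: measurable_itv. Qed.

Let term_ge0 p j x : 0 <= ((2 : R) ^+ j)%:E * (\1_(dyadic_box p j) x)%:E.
Proof. by rewrite mule_ge0// lee_fin ?exprn_ge0// indicE. Qed.

Let term_measurable p j :
  measurable_fun D ((fun x => ((2 : R) ^+ j)%:E * (\1_(dyadic_box p j) x)%:E) : R * R -> \bar R).
Proof.
apply: measurable_funeM; apply: measurableT_comp => //.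
by apply: measurable_indic; exact: measurable_dyadic_box.
Qed.

Lemma dyadic_kernel_ge0 p x : 0 <= dyadic_kernel p x.
Proof. by apply: nneseries_ge0 => j _ _; exact: term_ge0. Qed.

Lemma measurable_dyadic_kernel p : measurable_fun D (dyadic_kernel p).
Proof.
apply: (@ge0_emeasurable_sum _ _ _ D (fun j x => ((2 : R) ^+ j)%:E * (\1_(dyadic_box p j) x)%:E) xpredT).
  by move=> j x _ _; exact: term_ge0.
by move=> j _; exact: term_measurable.
Qed.

Lemma dyadic_kernel_lower p x j : dyadic_box p j x -> ((2 : R) ^+ j)%:E <= dyadic_kernel p x.
Proof.
move=> bx; rewrite /dyadic_kernel.
have := @nneseries_lim_ge R (fun j => ((2 : R) ^+ j)%:E * (\1_(dyadic_box p j) x)%:E)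
  xpredT 0 j.+1 (fun k _ _ => term_ge0 p k x).
apply: le_trans.
have e1 : \1_(dyadic_box p j) x = 1%R :> R by rewrite indicE mem_set.
rewrite big_nat_recr //= e1 mule1.
by rewrite leeDr// sume_ge0// => k _; exact: term_ge0.
Qed.

(** A box of side [2 * 2^-j] has area [4 * 4^-j], so the weight [2^j] leaves [4 * 2^-j], of sum 8.
    On a line the terms would not decay. *)
Lemma integral_dyadic_kernel p : \int[mu]_(x in D) dyadic_kernel p x <= 8%:E.
Proof.
rewrite integral_nneseries//; last by move=> j; exact: term_measurable.
have termE j : \int[mu]_(x in D) (((2 : R) ^+ j)%:E * (\1_(dyadic_box p j) x)%:E) <= ((4 : R) * 2 ^- j)%:E.
  have m1 : measurable_fun D ((fun x => (\1_(dyadic_box p j) x)%:E) : R * R -> \bar R).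
    by apply: measurableT_comp => //; apply: measurable_indic; exact: measurable_dyadic_box.
  have n1 x : D x -> 0 <= (\1_(dyadic_box p j) x)%:E :> \bar R by rewrite lee_fin indicE.
  have k0 : 0 <= ((2 : R) ^+ j)%:E by rewrite lee_fin exprn_ge0.
  rewrite ge0_integralZl//.
  rewrite integral_indic//; last exact: measurable_dyadic_box.
  have p2 : (0 < 2 ^- j :> R)%R by rewrite invr_gt0 exprn_gt0.
  have lt2 (c : R) : (c - 2 ^- j < c + 2 ^- j)%R = true by lra.
  apply: (@le_trans _ _ (((2 : R) ^+ j)%:E * mu (dyadic_box p j))).
    apply: lee_wpmul2l; first by rewrite lee_fin exprn_ge0.
    have mb := measurable_dyadic_box p j.
    by apply: le_measure; rewrite ?inE//; exact: measurableI.
  rewrite /mu /dyadic_box product_measure1E//.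
  rewrite /= !lebesgue_measure_itv /= !lte_fin !lt2 -!EFinB -!EFinM lee_fin le_eqVlt; apply/orP; left; apply/eqP.
  by field; rewrite expf_neq0.
apply: lime_le; first by apply: is_cvg_nneseries => j _ _; apply: integral_ge0 => x _; exact: term_ge0.
near=> m.
apply: (@le_trans _ _ (\sum_(0 <= j < m) ((4 : R) * 2 ^- j)%:E)).
  by apply: lee_sum => j _; exact: termE.
rewrite sumEFin lee_fin big_mkord.
have p0 k : (0 < 2 ^- k :> R)%R by rewrite invr_gt0 exprn_gt0.
have H : (\sum_(j < m) 2 ^- j.+1 <= 1 :> R)%R.
  by apply: (@sum_weights_le1 R (fun j => 2 ^- j.+1)%R) => k; rewrite lexx andbT ltW.
have -> : (\sum_(j < m) 4 * 2 ^- j = 8 * \sum_(j < m) 2 ^- j.+1 :> R)%R.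
  rewrite mulr_sumr; apply: eq_bigr => j _; rewrite exprS invfM; field.
  by rewrite expf_neq0.
by rewrite -[leRHS]mulr1 ler_wpM2l.
Unshelve. all: by end_near. Qed.

(* Fatou: the averaged kernels have integral at most 8, so their liminf is
   below 9 somewhere on the unit square. *)
Lemma kernel_selection (s : nat -> seq (R * R)) : (forall n, (0 < size (s n))%N) ->
  exists2 x : R * R, D x & forall N, exists2 n, (N <= n)%N &
    \sum_(p <- s n) dyadic_kernel p x <= (9 * (size (s n))%:R)%:E.
Proof.
move=> s0.
have sz n : (0 < (size (s n))%:R :> R)%R by rewrite ltr0n.
pose g n x := ((size (s n))%:R^-1)%:E * \sum_(p <- s n) dyadic_kernel p x.
have mS n : measurable_fun D ((fun x => \sum_(p <- s n) dyadic_kernel p x) : R * R -> \bar R).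
  by apply: emeasurable_sum => p; exact: measurable_dyadic_kernel.
have g0 n x : 0 <= g n x.
  rewrite mule_ge0 ?lee_fin ?invr_ge0// sume_ge0// => p _; exact: dyadic_kernel_ge0.
have mg n : measurable_fun D (g n) by exact: measurable_funeM.
have ig n : \int[mu]_(x in D) g n x <= 8%:E.
  have n1 p x : D x -> 0 <= dyadic_kernel p x by move=> _; exact: dyadic_kernel_ge0.
  have n2 x : D x -> 0 <= \sum_(p <- s n) dyadic_kernel p x.
    by move=> Dx; apply: sume_ge0 => p _; exact: n1.
  have k0 : 0 <= ((size (s n))%:R^-1 : R)%:E by rewrite lee_fin invr_ge0.
  have mK p := measurable_dyadic_kernel p.
  rewrite ge0_integralZl//; last exact: mS.
  rewrite [X in _ * X](_ : _ = \sum_(p <- s n) \int[mu]_(x in D) dyadic_kernel p x); last first.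
    exact: (ge0_integral_sum mu mD mK n1).
  apply: (@le_trans _ _ (((size (s n))%:R^-1)%:E * (8 * (size (s n))%:R)%:E)).
    apply: lee_wpmul2l; first by rewrite lee_fin invr_ge0.
    apply: (@le_trans _ _ (\sum_(p <- s n) 8%:E)).
      by apply: lee_sum => p _; exact: integral_dyadic_kernel.
    by rewrite sumEFin lee_fin big_const_seq count_predT iter_addr_0 mulr_natr.
  rewrite -EFinM lee_fin le_eqVlt; apply/orP; left; apply/eqP; field.
  by rewrite gt_eqF.
apply: contrapT => H.
have H' x : D x -> 9%:E <= limn_einf (g ^~ x).
  move=> Dx; rewrite /limn_einf leeNr.
  have [N HN] : exists N, forall n, (N <= n)%N -> 9%:E <= g n x.
    apply: contrapT => nN; apply: H; exists x => // N.
    apply: contrapT => nn; apply: nN; exists N => n Nn; rewrite leNgt; apply/negP => gn.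
    apply: nn; exists n => //; move: gn => /ltW; rewrite /g.
    rewrite (_ : (9 * (size (s n))%:R)%:E = (size (s n))%:R%:E * 9%:E :> \bar R); last first.
      by rewrite -EFinM mulrC.
    by rewrite lee_pdivrMl.
  by apply: (@limn_esup_le _ _ _ N) => n Nn; rewrite leeN2; exact: HN.
have F := fatou mu mD mg (fun n x _ => g0 n x).
have : \int[mu]_(x in D) limn_einf (g ^~ x) <= 8%:E.
  apply: (le_trans F); rewrite /limn_einf leeNl.
  by apply: limn_esup_ge => N; exists N => //; rewrite leeN2; exact: ig.
apply/negP; rewrite -ltNge.
apply: (@lt_le_trans _ _ (\int[mu]_(x in D) cst 9%:E x)).
  have mu1 : mu D = 1.
    rewrite /mu /D product_measure1E//.
    by rewrite /= lebesgue_measure_itv /= lte_fin ltr01 oppr0 adde0 !mule1.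
  rewrite integral_cst//; change (8%:E < 9%:E * mu D).
  by rewrite mu1 mule1 lte_fin ltr_nat.
apply: ge0_le_integral => //.
- by move=> x _; rewrite lee_fin.
- have -> : (fun x => limn_einf (g ^~ x)) = (fun x => - limn_esup (fun n => - g n x)) by [].
  apply: measurableT_comp; first exact: oppe_measurable.
  by apply: measurable_fun_limn_esup => n; apply: measurableT_comp => //; exact: mg.
Qed.

End KernelSelection.

(** * Separated sets relative to a cover *)

Lemma barycentric_refinement (T : topologicalType) (U : set (set T)) :
  hausdorff_space T -> compact [set: T] -> open_cover U ->
  exists2 V : set (set T), open_cover V &
    forall x, exists2 A, U A & forall B, V B -> B x -> B `<=` A.
Proof.
move=> hT cT [oU Uc].
have HU x : exists A, U A /\ A x.
  by have : [set: T] x by []; rewrite -Uc => -[A UA Ax]; exists A.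
have [A AP] := choice HU.
have HG x : exists G : set T, [/\ open G, G x & closure G `<=` A x].
  have [UA Ax] := AP x.
  have nA : nbhs x (A x) by apply: open_nbhs_nbhs; split => //; exact: oU.
  have nT : nbhs x [set: T] by exact: filterT.
  have [B nB BA] := compact_regular hT cT nT nA.
  move: nB; rewrite nbhsE => -[G [oG Gx] GB].
  by exists G; split => // z cz; apply: BA; exact: closure_subset GB _ cz.
have [G GP] := choice HG.
have [||D _ Dc] := compact_cover_compact cT (I := T) (D := setT) (f := G).
- by move=> x _; have [] := GP x.
- by move=> x _; exists x => //; have [] := GP x.
(* [W] lies in [A i] or misses the closure of [G i], for each of finitely many [i]. If [x] is in
   [G i], no [W] through [x] can miss it, so all of them lie in [A i]. *)
pose good z W := forall i, [set` D] i -> (closure (G i) z -> W `<=` A i) /\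
   (~ closure (G i) z -> W `&` closure (G i) = set0).
exists [set W : set T | open W /\ exists2 z, W z & good z W].
  split=> [W []//|]; apply/seteqP; split => // z _.
  pose P i := [set w | (closure (G i) z -> A i w) /\ (~ closure (G i) z -> ~ closure (G i) w)].
  have nP : nbhs z (\bigcap_(i in [set` D]) P i).
    apply: filter_bigI => i _; have [cz|ncz] := pselect (closure (G i) z).
      have : nbhs z (A i).
        apply: open_nbhs_nbhs; split; first by apply: oU; have [] := AP i.
        by have [_ _] := GP i; apply.
      by apply: filterS => w Aw; split.
    have : nbhs z (~` closure (G i)).
      apply: open_nbhs_nbhs; split => //; rewrite openC; exact: closed_closure.
    by apply: filterS => w Aw; split.
  move: nP; rewrite nbhsE => -[W [oW Wz] WP].
  exists W => //; split => //; exists z => // i iD; split => cz.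
    by move=> w /WP/(_ i iD)[+ _]; exact.
  by apply/seteqP; split => // w [/WP/(_ i iD)[_ +] cw]; move/(_ cz)/(_ cw).
move=> x; have [i iD Gx] := Dc x I.
exists (A i); first by have [] := AP i.
move=> W [oW [z Wz gW]] Wx; have [h1 h2] := gW i iD.
have [/h1//|/h2 e] := pselect (closure (G i) z).
have : (W `&` closure (G i)) x by split => //; exact: subset_closure.
by rewrite e.
Qed.

(** Closeness of orbit segments of length [n], the cover [V] playing the role of a distance
    scale. *)
Definition shadows (T : topologicalType) (V : set (set T)) (F : T -> T) (n : nat) (x y : T) :=
  forall i, (i < n)%N -> exists B, [/\ V B, B (iter i F x) & B (iter i F y)].

(** Greedy choice: if the points found so far shadowed every point, their cylinders would be a
    subcover with fewer than [k] members. *)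
Lemma separated_set (R : realType) (T : topologicalType) (F : T -> T)
    (U V : set (set T)) n k : open_cover V ->
  (forall x, exists2 A, U A & forall B, V B -> B x -> B `<=` A) ->
  ((k%:R : R)%:E <= min_subcover R (iterated_join F U n))%E ->
  exists s : seq T, [/\ uniq s, size s = k &
    forall x y, x \in s -> y \in s -> shadows V F n x y -> x = y].
Proof.
move=> [_ Vc] VU kle.
suff : forall j, (j <= k)%N -> exists s : seq T, [/\ uniq s, size s = j &
    forall x y, x \in s -> y \in s -> shadows V F n x y -> x = y] by exact.
elim=> [_|j IH jk]; first by exists [::].
have [s [us ss sP]] := IH (ltnW jk).
have [z zs] : exists z, forall x, x \in s -> ~ (shadows V F n x z).
  apply: contrapT => H.
  have Hz z : exists2 x, x \in s & shadows V F n x z.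
    apply: contrapT => nz; apply: H; exists z => x xs sh; apply: nz; by exists x.
  have [A AP] := choice (fun x => let: ex_intro2 A h1 h2 := VU x in ex_intro _ A (conj h1 h2)).
  pose C x := \bigcap_(i in `I_n) (iter i F @^-1` A (iter i F x)).
  have : (min_subcover R (iterated_join F U n) <= ((size (map C s))%:R : R)%:E)%E.
    apply: min_subcover_le.
      move=> _ /= /mapP[x _ ->]; exists (fun i => A (iter i F x)) => // i _; exact: (AP _).1.
    apply/seteqP; split => // z _; have [x xs sh] := Hz z.
    exists (C x); first by apply/mapP; exists x.
    move=> i ilt; have [B [VB Bx Bz]] := sh i ilt.
    exact: (AP _).2 Bx _ Bz.
  rewrite size_map ss => /(le_trans kle); rewrite lee_fin ler_nat.
  by rewrite leqNgt jk.
have refl x : shadows V F n x x.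
  by move=> i _; have : [set: T] (iter i F x) by []; rewrite -Vc => -[B VB Bx]; exists B.
have sym x y : shadows V F n x y -> shadows V F n y x.
  by move=> sh i /sh[B [VB Bx By]]; exists B.
exists (z :: s); split => /=; [|by rewrite ss|].
  by rewrite us andbT; apply/negP => /zs; apply; exact: refl.
move=> x y; rewrite !inE => /orP[/eqP->|xs] /orP[/eqP->|ys] // sh.
- by case: (zs _ ys); exact: sym.
- by case: (zs _ xs).
- exact: sP.
Qed.

(** * From separated orbits of [f] to separated orbits of the flow *)

Section Tracking.
Context {R : realType} {E : normedModType R} {M : smoothManifold E} (f : diffeo M).
Variables (sigma : R -> M -> R -> R) (phi : R -> suspension f -> suspension f).
Hypothesis sigma0 : forall y s, sigma 0 y s = s.
Hypothesis sigma_slow : forall y s t t', `|sigma t' y s - sigma t y s| <= 8^-1 * `|t' - t|.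
Hypothesis phi_iter : forall i y s, iter i (phi 1) (spiR f y s) = spiR f y (sigma i%:R y s).
Variable V : set (set M).
Hypothesis Vcover : open_cover V.

(* The sets of [adapted] are controlled over the three levels that a slab may
   meet, since -1 < Aa.2 < 1. *)
Definition adapted : set (set M) := [set A | open A /\
  forall l : int, (`|l| <= 1)%R -> exists2 B, V B & A `<=` ziter f l @^-1` B].

Definition slabs : set (set (suspension f)) :=
  [set (fun p : M * R => spiR f p.1 p.2) @` (Aa.1 `*` `]Aa.2, (Aa.2 + 8^-1)%R[%classic) |
    Aa in [set Aa : set M * R | adapted Aa.1 /\ -1 < Aa.2 < 1]].

Lemma adapted_cover y : exists2 A, adapted A & A y.
Proof.
have [oV Vc] := Vcover.
have HB (l : int) : exists B, V B /\ B (ziter f l y).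
  by have : [set: M] (ziter f l y) by []; rewrite -Vc => -[B VB By]; exists B.
have [B BP] := choice HB.
pose P (l : int) := ziter f l @^-1` B l.
have oP l : open (P l) by apply: open_comp (oV _ (BP l).1) => x _; exact: ziter_continuous.
exists (P (-1) `&` P 0 `&` P 1); last by split; [split|]; exact: (BP _).2.
split; first by apply: openI => //; exact: openI.
move=> l l1; exists (B l); first exact: (BP l).1.
have : [\/ l = -1, l = 0 | l = 1].
  move: l1; rewrite ler_norml => /andP[la lb].
  have : l = -1 \/ l = 0 \/ l = 1 by lia.
  by move=> [|[|]] ->; [constructor 1|constructor 2|constructor 3].
by case=> -> x [[? ?] ?].
Qed.

Lemma slabs_cover : open_cover slabs.
Proof.
split=> [_ [[A a] [[oA _] _] <-]|].
  apply: spiR_open; rewrite openE => -[x u] [/= Ax ua].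
  exists (A, `]a, (a + 8^-1)%R[%classic) => //=; split; apply: open_nbhs_nbhs => //.
apply/seteqP; split => // p _; have [y [s [/andP[s0 s1] ->]]] := spiR_surj p.
have [A aA Ay] := adapted_cover y.
exists ((fun p : M * R => spiR f p.1 p.2) @` (A `*` `](s - 16^-1), (s - 16^-1 + 8^-1)[%classic)).
  by exists (A, s - 16^-1) => //; split => //=; apply/andP; split; lra.
by exists (y, s) => //=; split => //=; rewrite in_itv /=; apply/andP; split; lra.
Qed.

(* In time 1 the height changes by at most 1/8, so two orbits that visit the same
   slabs must pass from one cell of the suspension to the next together. *)
Lemma track x y m :
  (forall j, (j <= m)%N -> exists C, [/\ slabs C, C (spiR f x (sigma j%:R x 0)) &
     C (spiR f y (sigma j%:R y 0))]) ->
  forall j, (j <= m)%N -> `|sigma j%:R x 0 - sigma j%:R y 0| < 8^-1 /\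
    exists (k : int) (A : set M), [/\ adapted A, A (ziter f k x), A (ziter f k y),
      -1 < sigma j%:R x 0 - k%:~R & sigma j%:R x 0 - k%:~R < 1 + 8^-1].
Proof.
move=> H; elim=> [|j IH] jm.
  have [C [[[A a] [aA /= /andP[a1 a2]] <-]]] := H 0%N jm.
  rewrite !sigma0 => -[[z u] /= [Az uI] /esym/spiR_eq[k [zE uE]]].
  move=> [[z' u'] /= [Az' uI'] /esym/spiR_eq[k' [zE' uE']]].
  move: uI uI'; rewrite !in_itv /= => /andP[? ?] /andP[? ?].
  have kk : k = k'.
    apply/eqP; rewrite -subr_eq0 -normr_le0 -ltzD1 add0r -(ltr_int R) intr_norm intrB.
    by rewrite ltr_norml; apply/andP; split; lra.
  split; first by rewrite subrr normr0 invr_gt0.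
  exists k, A; split => //; [by rewrite -zE|by rewrite kk -zE'| |]; lra.
have [d8 _] := IH (ltnW jm).
have [C [[[A a] [aA /= /andP[a1 a2]] <-]]] := H j.+1 jm.
move=> [[z u] /= [Az uI] /esym/spiR_eq[k [zE uE]]].
move=> [[z' u'] /= [Az' uI'] /esym/spiR_eq[k' [zE' uE']]].
move: uI uI'; rewrite !in_itv /= => /andP[? ?] /andP[? ?].
have sx := sigma_slow x 0 j%:R j.+1%:R; have sy := sigma_slow y 0 j%:R j.+1%:R.
have e1 : `|j.+1%:R - j%:R| = 1 :> R by rewrite -natr1 addrAC subrr add0r normr1.
rewrite e1 mulr1 in sx sy.
move: d8 sx sy; set X := sigma j.+1%:R x 0 in uE *; set Y := sigma j.+1%:R y 0 in uE' *.
rewrite ltr_norml !ler_norml => /andP[? ?] /andP[? ?] /andP[? ?].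
have kk : k = k'.
  apply/eqP; rewrite -subr_eq0 -normr_le0 -ltzD1 add0r -(ltr_int R) intr_norm intrB.
  by rewrite ltr_norml; apply/andP; split; lra.
split.
  by rewrite ltr_norml; apply/andP; rewrite -kk in uE'; split; lra.
by exists k, A; split => //; [by rewrite -zE|by rewrite kk -zE'| |]; lra.
Qed.

(** At the first integer time when the height of [x] reaches [i], it is at most [i + 1/8], so the
    level [k] of the common slab satisfies [|i - k| <= 1]. An adapted set then controls the passage
    from [f^k] to [f^i]. *)
Lemma track_shadows x y m n :
  (forall j, (j <= m)%N -> exists C, [/\ slabs C, C (spiR f x (sigma j%:R x 0)) &
     C (spiR f y (sigma j%:R y 0))]) ->
  n%:R <= sigma m%:R x 0 -> shadows V f n x y.
Proof.
move=> H nm i ilt.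
have im : i%:R <= sigma m%:R x 0 by apply: le_trans nm; rewrite ler_nat ltnW.
have exj : exists j, i%:R <= sigma j%:R x 0 by exists m.
have ex_min := @ex_minnP (fun j => i%:R <= sigma j%:R x 0) exj.
case: ex_min => j ij jmin.
have jm : (j <= m)%N by exact: jmin.
have ji : sigma j%:R x 0 <= i%:R + 8^-1.
  case: j ij jmin {jm} => [|j] ij jmin.
    by rewrite sigma0 addr_ge0 ?invr_ge0.
  have : ~~ (i%:R <= sigma j%:R x 0) by apply/negP => /jmin; rewrite ltnn.
  rewrite -ltNge => h.
  have := sigma_slow x 0 j%:R j.+1%:R.
  have -> : `|j.+1%:R - j%:R| = 1 :> R by rewrite -natr1 addrAC subrr add0r normr1.
  by rewrite ler_norml => /andP[? ?]; lra.
have [_ [k [A [[_ aA] Ax Ay k1 k2]]]] := track H jm.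
have lk : (`|i%:Z - k| <= 1)%R.
  rewrite -ltzD1 -(ltr_int R) intr_norm intrB ltr_norml.
  by apply/andP; split; rewrite /=; lra.
have [B VB AB] := aA _ lk.
exists B; split => //.
  by have := AB _ Ax; rewrite /= -ziterD subrK.
by have := AB _ Ay; rewrite /= -ziterD subrK.
Qed.

(** Points at height 0 over a separated set need distinct cylinders of slabs. Passing from [n] to
    flow time [m <= C n] divides the exponential rate by a constant only. *)
Lemma entropy_lower (h C K : R) : 0 < h -> 0 < C -> 0 < K ->
  (forall N, exists n s m, [/\ (N <= n)%N, uniq s,
     forall x y, x \in s -> y \in s -> shadows V f n x y -> x = y,
     expR (h * n%:R) <= K * (size s)%:R & m%:R <= C * n%:R /\
     forall x, x \in s -> n%:R <= sigma m%:R x 0]) ->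
  (0 < flow_entropy (R := R) phi)%E.
Proof.
move=> h0 C0 K0 H; apply: (@lt_le_trans _ _ (h / 2 / (C + 1))%:E).
  by rewrite lte_fin !divr_gt0// addr_gt0.
apply: (@le_trans _ _ (cover_entropy R (phi 1) slabs)); last first.
  by apply: ereal_sup_ubound; exists slabs => //; exact: slabs_cover.
apply: limn_esup_ge => N.
(* Beyond [N1] the constant [K] costs at most half of the exponent [h n]. *)
pose N1 := (N + (Num.truncn (2 * `|ln K| / h)).+1)%N.
have [n [s [m [Nn us sP hs [mC ms]]]]] := H N1.
have n1 : 1 <= n%:R :> R by rewrite ler1n; apply: leq_trans Nn; rewrite /N1 addnS.
have n0 : 0 < n%:R :> R by apply: lt_le_trans n1.
have nK : 2 * `|ln K| <= h * n%:R.
  rewrite [leRHS]mulrC -ler_pdivrMr//; apply: (le_trans (ltW (truncnS_gt _))).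
  by rewrite ler_nat; apply: leq_trans Nn; rewrite leq_addl.
have s0 : 0 < (size s)%:R :> R.
  have := lt_le_trans (expR_gt0 _) hs; by rewrite pmulr_rgt0.
(* The speed limit makes [m] at least [n], so the times used in the upper limit are unbounded. *)
have mn : (n <= m)%N.
  have [x xs] : exists x, x \in s by case: (s) s0 => [|x s']; rewrite ?ltxx// => _; exists x; rewrite mem_head.
  have := sigma_slow x 0 0 m%:R; rewrite sigma0 !subr0 ger0_norm; last first.
    by apply: le_trans (ms _ xs).
  rewrite ger0_norm// => sm; rewrite -(ler_nat R).
  have := ms _ xs; have : 0 <= m%:R :> R by []. lra.
exists m; first by apply: leq_trans mn; apply: leq_trans Nn; exact: leq_addr.
have m0 : 0 < m.+1%:R :> R by rewrite ltr0n.
have low : ((size s)%:R%:E <= min_subcover R (iterated_join (phi 1) slabs m.+1))%E.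
  apply: min_subcover_ge => t tW tc; rewrite ler_nat.
  have Ht x : exists B, B \in t /\ B (spiR f x 0).
    by have : [set: suspension f] (spiR f x 0) by []; rewrite -tc => -[B Bt Bx]; exists B.
  have [b bP] := choice Ht.
  have bi : {in s &, injective b}.
    move=> x y xs ys bxy; apply: (sP _ _ xs ys); apply: (@track_shadows x y m n) (ms _ xs).
    move=> j jm; have [bt bx] := bP x; have [_ by_] := bP y; rewrite -bxy in by_.
    have [A AW bE] := tW _ bt.
    rewrite bE in bx by_; exists (A j); split; first exact: AW.
      by have := bx j jm; rewrite /= phi_iter.
    by have := by_ j jm; rewrite /= phi_iter.
  rewrite -(size_map b); apply: uniq_leq_size; first by rewrite map_inj_in_uniq.
  by move=> _ /mapP[x _ ->]; exact: (bP x).1.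
apply: (@le_trans _ _ (m.+1%:R^-1%:E * lne ((size s)%:R : R)%:E)%E); last first.
  by rewrite lee_wpmul2l ?lee_fin ?invr_ge0//; apply: lne_le => //; rewrite lee_fin ltW.
rewrite lne_EFin// -EFinM lee_fin [X in _ <= X]mulrC ler_pdivlMr//.
have : h * n%:R <= ln K + ln (size s)%:R.
  by rewrite -lnM ?posrE// -ler_expR lnK// posrE mulr_gt0.
have := ler_norm (ln K).
have : h / 2 / (C + 1) * m.+1%:R <= h / 2 * n%:R.
  rewrite -mulrA; apply: ler_wpM2l; first by rewrite divr_ge0// ltW.
  rewrite mulrC ler_pdivrMr ?addr_gt0// -natr1; lra.
by lra.
Qed.

End Tracking.

(** * Time lost near the zero of the field *)

Section Crossing.
Context {R : realType}.

(** [W] has derivative [1 + 1/P], where [P] is the profile, and [(1 + 1/P) min(1, P) >= 1]; so [W]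
    grows at rate at least [c]. Over a cell it gains at most 1 plus [pi / (4 rho)], and
    [pi <= 4]. *)
Lemma arctan_clock (rho c k : R) (a v : R -> R) (t : R) : 0 < rho -> 0 < c -> 0 <= t ->
  (forall u, is_derive u (1 : R) v (a (v u))) ->
  (forall u, 0 <= u <= t -> k <= v u <= k + 1 /\
     c * Num.min 1 (rho ^+ 2 + 16 * (v u - k - 2^-1) ^+ 2) <= a (v u)) ->
  c * t <= 1 + rho^-1.
Proof.
move=> rho0 c0 t0 dv H.
pose W x := x + (4 * rho)^-1 * atan ((4 / rho) * (x - k - 2^-1)).
pose dW x := 1 + (rho ^+ 2 + 16 * (x - k - 2^-1) ^+ 2)^-1.
have dWP x : is_derive x (1 : R) W (dW x).
  have d1 : is_derive x (1 : R) (fun x : R => (4 / rho) * (x - k - 2^-1)) (4 / rho).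
    apply: (is_derive_quadratic (C := 0) (d := 1)) => // h _.
    rewrite mul0r (_ : _ - _ - _ = 0) ?normr0//; ring.
  have d2 := @is_derive1_comp R atan _ x _ _ (is_derive1_atan _) d1.
  have d3 := is_deriveD (is_derive_id x (1 : R)) (is_deriveZ ((4 * rho)^-1) d2).
  apply: (is_derive_eq d3); rewrite /dW; congr (1 + _).
  rewrite /GRing.scale /=.
  have p0 : 0 < rho ^+ 2 + 16 * (x - k - 2^-1) ^+ 2.
    by rewrite ltr_pwDl ?exprn_gt0// mulr_ge0// sqr_ge0.
  set w := x - k - 2^-1 in p0 *; set P := rho ^+ 2 + 16 * w ^+ 2 in p0 *.
  have -> : 1 + (4 / rho * w) ^+ 2 = P / rho ^+ 2 by rewrite /P; field; rewrite gt_eqF.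
  by field; rewrite !gt_eqF.
have g0 : c * (t - 0) <= W (v t) - W (v 0).
  apply: (@mvt_ge R (W \o v) (fun u => dW (v u) * a (v u))) => //.
  move=> x xt; have [_ h] := H x xt; apply: le_trans (ler_wpM2l _ h); last first.
    by rewrite /dW addr_ge0// invr_ge0 addr_ge0 ?sqr_ge0// mulr_ge0// sqr_ge0.
  rewrite /dW; set P := _ + 16 * _.
  have P0 : 0 < P by rewrite ltr_pwDl ?exprn_gt0// mulr_ge0// sqr_ge0.
  rewrite mulrCA -[X in X <= _]mulr1 ler_wpM2l ?(ltW c0)//.
  have [P1|P1] := leP 1 P; first by rewrite mulr1 lerDl invr_ge0 ltW.
  by rewrite mulrDl mul1r mulVf ?gt_eqF// lerDr ltW.
rewrite subr0 in g0; apply: (le_trans g0).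
have [|h0 _] := H 0; first by rewrite lexx t0.
have [|ht _] := H t; first by rewrite lexx t0.
move: h0 ht => /andP[? ?] /andP[? ?].
rewrite /W.
set A := atan _; set B := atan _.
have AB : A - B <= 4.
  have A1 := atan_ltpi2 ((4 / rho) * (v t - k - 2^-1)).
  have B1 := atan_gtNpi2 ((4 / rho) * (v 0 - k - 2^-1)).
  have := @pihalf_lt2 R; rewrite -/A -/B in A1 B1; lra.
have : (4 * rho)^-1 * (A - B) <= rho^-1.
  apply: (@le_trans _ _ ((4 * rho)^-1 * 4)).
    by rewrite ler_wpM2l// invr_ge0 mulr_ge0// ltW.
  by rewrite le_eqVlt; apply/orP; left; apply/eqP; field; rewrite gt_eqF.
by rewrite mulrBr; lra.
Qed.

Context {n : nat} {M : smoothManifold 'rV[R]_n} (f : diffeo M).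
Variables (c0 : chart 'rV[R]_n M) (x0 : 'rV[R]_n) (r c : R).
Variables (alpha : suspension f -> R) (sigma : R -> M -> R -> R).
Hypothesis alpha01 : forall p, 0 <= alpha p <= 1.
Hypothesis c_gt0 : 0 < c.
Hypothesis alpha_lower : forall y s, 0 <= s <= 1 ->
    (chart_dom c0 y -> c * Num.min 1 (profile c0 x0 r y s) <= alpha (spiR f y s)) /\
    (~ chart_dom c0 y -> c <= alpha (spiR f y s)).
Hypothesis sigma0 : forall y s, sigma 0 y s = s.
Hypothesis sigmaD : forall t t' y s, sigma (t + t') y s = sigma t y (sigma t' y s).
Hypothesis dsigma : forall y s t, is_derive t (1 : R) (fun t => sigma t y s)
        (alpha (spiR f y (sigma t y s))).

Lemma cross_cell (y : M) (k : nat) (rho t : R) : 0 < rho ->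
  (chart_dom c0 (iter k f y) -> rho ^+ 2 <= rho2 x0 r (chart_map c0 (iter k f y))) ->
  (2 + rho^-1) / c <= t -> k.+1%:R <= sigma t y k%:R.
Proof.
move=> rho0 hrho tc; rewrite leNgt; apply/negP => lt1.
have t0 : 0 <= t.
  by apply: le_trans tc; rewrite divr_ge0 ?addr_ge0 ?invr_ge0 ?ltW.
have := @arctan_clock rho c k%:R (fun s => alpha (spiR f y s)) (fun t => sigma t y k%:R) t
  rho0 c_gt0 t0 (dsigma y k%:R).
(* One more than the clock allows within the cell. *)
have ct : 2 + rho^-1 <= c * t by rewrite mulrC -ler_pdivrMr.
suff : forall u, 0 <= u <= t -> k%:R <= sigma u y k%:R <= k%:R + 1 /\
     c * Num.min 1 (rho ^+ 2 + 16 * (sigma u y k%:R - k%:R - 2^-1) ^+ 2) <= alpha (spiR f y (sigma u y k%:R)).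
  by move=> H /(_ H); lra.
move=> u /andP[u0 ut].
have mono := sigma_nondecreasing alpha01 dsigma y k%:R.
have b1 : k%:R <= sigma u y k%:R by have := mono _ _ u0; rewrite /= sigma0.
have b2 : sigma u y k%:R <= k%:R + 1.
  by rewrite natr1; apply: le_trans (ltW lt1); exact: mono.
split; first by rewrite b1.
set v := sigma u y k%:R in b1 b2 *.
rewrite -(spiR_shift f y v k) -pmulrn.
have v01 : 0 <= v - k%:R <= 1 by apply/andP; split; lra.
have [hd hn] := alpha_lower (iter k f y) v01.
have [dy|/hn] := pselect (chart_dom c0 (iter k f y)).
  apply: le_trans (hd dy); rewrite ler_wpM2l ?(ltW c_gt0)// /profile.
  rewrite le_min ge_min lexx /= ge_min lerD2r hrho ?orbT//.
by apply: le_trans; rewrite -[leRHS]mulr1 ler_wpM2l ?(ltW c_gt0)// ge_min lexx.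
Qed.

(** Crossing times add up: the intermediate value theorem gives a time when the bottom of the last
    cell is reached exactly, and [cross_cell] starts there. *)
Lemma cross_cells (y : M) (rho : nat -> R) k : (forall i, (i < k)%N -> 0 < rho i /\
    (chart_dom c0 (iter i f y) -> rho i ^+ 2 <= rho2 x0 r (chart_map c0 (iter i f y)))) ->
  forall t, \sum_(i < k) (2 + (rho i)^-1) / c <= t -> k%:R <= sigma t y 0.
Proof.
have mono := sigma_nondecreasing alpha01 dsigma y 0.
elim: k => [|k IH] H t; first by rewrite big_ord0 => t0; have := mono _ _ t0; rewrite /= sigma0.
rewrite big_ord_recr /=; set S := \sum_(i < k) _ => St.
have S0 : 0 <= S.
  apply: sumr_ge0 => i _; have [r0 _] := H i (ltnW (ltn_ord i : (i < k)%N)).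
  by rewrite divr_ge0 ?addr_ge0 ?invr_ge0 ?ltW.
have kS : k%:R <= sigma S y 0 by apply: IH => // i ik; apply: H; exact: ltnW.
have cv : {within `[0, S], continuous (fun t => sigma t y 0)}.
  by apply: continuous_subspaceT => z; exact: is_derive_continuous (dsigma y 0 z).
have mm : Num.min (sigma 0 y 0) (sigma S y 0) <= k%:R <= Num.max (sigma 0 y 0) (sigma S y 0).
  have h : sigma 0 y 0 <= sigma S y 0 by exact: mono.
  by rewrite (min_idPl h) (max_idPr h) sigma0 ler0n.
have [T TI ET] := IVT S0 cv mm.
move: TI; rewrite in_itv /= => /andP[T0 TS].
have [rk0 hk] := H k (ltnSn k).
have := cross_cell rk0 hk (lexx _); rewrite -{1}ET -sigmaD.
move/le_trans; apply; apply: mono; lra.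
Qed.

End Crossing.

(** On an empty space the empty subcover gives [lne 0], minus infinity. *)
Lemma positive_entropy_point (R : realType) (T : topologicalType) (F : T -> T) :
  (0 < topological_entropy R F)%E -> exists x : T, True.
Proof.
move=> H; apply: contrapT => nT; move: H; apply/negP; rewrite -leNgt.
apply/ereal_supP => _ [U _ <-]; apply: (@limn_esup_le _ _ _ 0%N) => n _.
have : (min_subcover R (iterated_join F U n.+1) <= ((size (@nil (set T)))%:R : R)%:E)%E.
  apply: min_subcover_le => //; apply/seteqP; split => // x _.
  by case: nT; exists x.
move=> /le0_lneNy ->; rewrite gt0_muleNy ?leNye// lte_fin invr_gt0 ltr0n //.
Qed.

Lemma positive_entropy_growth (R : realType) (T : topologicalType) (F : T -> T) :
  (0 < topological_entropy R F)%E -> exists (U : set (set T)) (h : R),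
  [/\ open_cover U, 0 < h & forall N, exists n, [/\ (N <= n)%N, (0 < n)%N &
    ((expR (h * n%:R))%:E <= min_subcover R (iterated_join F U n))%E]].
Proof.
move=> H.
have [U oU HU] : exists2 U, open_cover U & (0 < cover_entropy R F U)%E.
  apply: contrapT => nU; move: H; apply/negP; rewrite -leNgt.
  apply/ereal_supP => _ [U oU <-]; rewrite leNgt; apply/negP => h; apply: nU; by exists U.
have [h h0 hU] : exists2 h : R, 0 < h & (h%:E < cover_entropy R F U)%E.
  move: HU; case: (cover_entropy R F U) => [e| |] //.
    rewrite lte_fin => e0; exists (e / 2); first by rewrite divr_gt0.
    by rewrite lte_fin; lra.
  by move=> _; exists 1 => //; rewrite ltry.
exists U, h; split => // N.
have [m Nm] := limn_esup_gt hU N.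
have m0 : 0 < m.+1%:R :> R by rewrite ltr0n.
have X0 : (0 <= min_subcover R (iterated_join F U m.+1))%E.
  by apply: min_subcover_ge => *; rewrite ler0n.
move=> hm; exists m.+1; split => //; first exact: leqW.
move: X0 hm; case: (min_subcover R _) => [x| |] //; last by move=> _ _; exact: leey.
rewrite lee_fin => x0.
move: x0; rewrite le_eqVlt => /orP[/eqP <-|x0].
  by rewrite le0_lneNy// gt0_muleNy// lte_fin invr_gt0.
rewrite lne_EFin// -EFinM !lte_fin => hm.
rewrite lee_fin -ler_ln ?posrE ?expR_gt0// expRK ltW//.
by rewrite -ltr_pdivlMr// mulrC.
Qed.

(** Radius [2 r] leaves room for moving the centre by [r] and for a bump of radius [r] around it. *)
Lemma chart_box (R : realType) (n : nat) (M : smoothManifold 'rV[R]_n) (w : M) :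
  exists (c0 : chart 'rV[R]_n M) (z0 : 'rV[R]_n) (r : R), [/\ atlas c0, 0 < r &
    forall x : 'rV[R]_n, (forall i, `|x 0 i - z0 0 i| <= 2 * r) -> chart_cod c0 x].
Proof.
have [c Ac cw] : exists2 c, atlas (s := M) c & chart_dom c w.
  by have : [set: M] w by []; rewrite -(atlas_cover M) => -[c Ac cw]; exists c.
have [_ oc [fc _] _ _] := atlas_chart Ac.
have := open_nbhs_nbhs (conj oc (fc _ cw)); rewrite -nbhs_ballE => -[e /= e0 eB].
exists c, (chart_map c w), (e / 4); split => //; first by rewrite divr_gt0.
move=> x xe; apply: eB; rewrite -ball_normE /ball_ /=.
apply: (@le_lt_trans _ _ (e / 2)); last by lra.
rewrite [leLHS]mx_normrE; apply/bigmax_leP; split; first by rewrite divr_ge0// ltW.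
move=> [i j] _ /=; rewrite !mxE (ord1 i) distrC; apply: (le_trans (xe j)); lra.
Qed.

(** Markov's inequality for the uniform measure on [s]. *)
Lemma half_below_average (R : realType) (T : eqType) (s : seq T) (g : T -> R) (b : R) :
  0 < b -> (forall x, 0 <= g x) -> \sum_(x <- s) g x <= b * (size s)%:R ->
  (size s)%:R <= 2 * (size [seq x <- s | g x <= 2 * b])%:R :> R.
Proof.
move=> b0 g0 H.
have E : (size s)%:R = (size [seq x <- s | g x <= 2 * b])%:R +
   (size [seq x <- s | ~~ (g x <= 2 * b)])%:R :> R.
  by rewrite -natrD; congr (_%:R); rewrite !size_filter count_predC.
have : 2 * b * (size [seq x <- s | ~~ (g x <= 2 * b)])%:R <= \sum_(x <- s) g x.
  rewrite (bigID (fun x => g x <= 2 * b)) /=; apply: ler_wpDl; first exact: sumr_ge0.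
  apply: (@le_trans _ _ (\sum_(x <- s | ~~ (g x <= 2 * b)) 2 * b)).
    by rewrite big_const_seq iter_addr_0 size_filter mulr_natr.
  by apply: ler_sum => x; rewrite -ltNge => /ltW.
move=> /le_trans/(_ H); rewrite -mulrA mulrCA ler_pM2l// E; lra.
Qed.

(** * Selection of the centre *)

Section Selection.
Context {R : realType} {n : nat} {M : smoothManifold 'rV[R]_n} (f : diffeo M).
Variables (c0 : chart 'rV[R]_n M) (z0 : 'rV[R]_n) (r : R) (i0 i1 : 'I_n).
Hypothesis r0 : 0 < r.
Hypothesis i01 : i0 != i1.

Let u (y : M) : R * R :=
  ((chart_map c0 y 0 i0 - z0 0 i0) / r, (chart_map c0 y 0 i1 - z0 0 i1) / r).

(* The centre of the bump is moved in a two-dimensional slice of the chart: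
   this is where [n >= 2] is needed, as [1 / |x|] is integrable in the plane. *)
Definition slice_point (x : R * R) : 'rV[R]_n :=
  \row_i (z0 0 i + r * (if i == i0 then x.1 else if i == i1 then x.2 else 0)).

Lemma slice_point_box (x : R * R) : 0 <= x.1 <= 1 -> 0 <= x.2 <= 1 ->
  forall y : 'rV[R]_n, (forall i, `|y 0 i - slice_point x 0 i| <= r) ->
  forall i, `|y 0 i - z0 0 i| <= 2 * r.
Proof.
move=> /andP[a0 a1] /andP[b0 b1] y H i.
have {H} := H i; rewrite mxE; set d := if _ then _ else _.
have d01 : 0 <= d <= 1.
  rewrite /d; case: ifP => _; first by rewrite a0.
  by case: ifP => _; [rewrite b0|rewrite lexx ler01].
have rd : 0 <= r * d <= r.
  move: d01 => /andP[h1 h2]; rewrite mulr_ge0 ?(ltW r0)//=.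
  by rewrite -[leRHS]mulr1 ler_wpM2l// ltW.
move: rd => /andP[? ?]; rewrite !ler_norml => /andP[? ?].
by apply/andP; split; lra.
Qed.

Lemma slice_rho2 (x : R * R) (y : M) (rho : R) : 0 <= rho ->
  rho <= `|(u y).1 - x.1| \/ rho <= `|(u y).2 - x.2| ->
  rho ^+ 2 <= rho2 (slice_point x) r (chart_map c0 y).
Proof.
move=> rho0 H.
have rn : r != 0 by rewrite gt_eqF.
have sq (i : 'I_n) (d : R) : (chart_map c0 y 0 i - slice_point x 0 i) / r = d ->
    rho <= `|d| -> rho ^+ 2 <= rho2 (slice_point x) r (chart_map c0 y).
  move=> <- h; rewrite /rho2 (bigD1 i)//=; apply: ler_wpDr.
    by apply: sumr_ge0 => j _; exact: sqr_ge0.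
  by rewrite -[leRHS]real_normK ?num_real// ler_pXn2r ?nnegrE.
case: H => h; [apply: (sq i0 _ _ h)|apply: (sq i1 _ _ h)]; rewrite mxE /u /=.
  by rewrite eqxx; field.
by rewrite eq_sym (negbTE i01) eqxx; field.
Qed.

(** [kappa] is the kernel at the selected point. An orbit point too close to the centre would put
    the centre in a small dyadic box, hence force a larger kernel value. *)
Lemma slice_selection (N : nat -> nat) (s : nat -> seq M) :
  (forall k, (0 < N k)%N) -> (forall k, (0 < size (s k))%N) ->
  exists (x : R * R) (kappa : M -> R),
  [/\ 0 <= x.1 <= 1, 0 <= x.2 <= 1, forall y, 0 <= kappa y &
    forall K, exists k, [/\ (K <= k)%N,
      \sum_(y <- s k) \sum_(i < N k) kappa (iter i f y) <= 9 * (N k)%:R * (size (s k))%:R &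
      forall y i, y \in s k -> (i < N k)%N ->
        ((2 * kappa (iter i f y) + 1)^-1) ^+ 2 <=
           rho2 (slice_point x) r (chart_map c0 (iter i f y))]].
Proof.
move=> N0 s0.
pose P k := [seq u (iter i f y) | y <- s k, i <- iota 0 (N k)].
have sP k : size (P k) = (size (s k) * N k)%N by rewrite size_allpairs size_iota.
have [|x [x1 x2] H] := @kernel_selection R P.
  by move=> k; rewrite sP muln_gt0 s0 N0.
(* [fine] sends infinity to 0; at the orbit points used, the finite bound on the sum makes the
   kernel finite. *)
exists x, (fun y => fine (dyadic_kernel (u y) x)).
move: x1 x2; rewrite /= !in_itv /= => x1 x2; split => //.
  by move=> y; apply: fine_ge0; exact: dyadic_kernel_ge0.
move=> K; have [k Kk Hk] := H K; exists k; split => //.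
  have fin p : p \in P k -> dyadic_kernel p x \is a fin_num.
    move=> pP; rewrite ge0_fin_numE; last exact: dyadic_kernel_ge0.
    apply: le_lt_trans (ltry (9 * (size (P k))%:R)); apply: le_trans Hk.
    rewrite (big_rem p)//= leeDl// sume_ge0// => q _; exact: dyadic_kernel_ge0.
  have := Hk; rewrite big_seq (eq_bigr (fun p => (fine (dyadic_kernel p x))%:E)); last first.
    by move=> p pP; rewrite fineK// fin.
  rewrite -big_seq sumEFin lee_fin sP natrM [(size (s k))%:R * _]mulrC mulrA.
  apply: le_trans; rewrite /P big_allpairs_dep /=.
  have iE : iota 0 (N k) = index_iota 0 (N k) by rewrite /index_iota subn0.
  by apply: ler_sum => y _; rewrite iE big_mkord.
move=> y i ys iN; set p := u (iter i f y).
set kp := fine _.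
have pP : p \in P k by apply/allpairsP; exists (y, i); rewrite mem_iota.
have kpfin : dyadic_kernel p x = kp%:E.
  rewrite /kp fineK// ge0_fin_numE; last exact: dyadic_kernel_ge0.
  apply: le_lt_trans (ltry (9 * (size (P k))%:R)); apply: le_trans Hk.
  rewrite (big_rem p)//= leeDl// sume_ge0// => q _; exact: dyadic_kernel_ge0.
have kp0 : 0 <= kp by apply: fine_ge0; exact: dyadic_kernel_ge0.
have q0 : 0 < 2 * kp + 1 by rewrite ltr_wpDl// mulr_ge0.
apply: slice_rho2; first by rewrite invr_ge0 ltW.
rewrite -/p; set rho := (_)^-1.
have [h1|h1] := leP rho `|p.1 - x.1|; first by left.
have [h2|h2] := leP rho `|p.2 - x.2|; first by right.
exfalso.
(* The least [j] with [kp < 2^j]: either [j = 0], or [2^(j-1) <= kp]. *)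
have [j kj jk] : exists2 j : nat, kp < 2 ^+ j & 2 ^+ j <= 2 * kp + 1.
  have ex : exists j : nat, kp < 2 ^+ j.
    exists (Num.truncn kp).+1; apply: (lt_trans (truncnS_gt _)).
    by move: (Num.truncn kp).+1 => m; rewrite -natrX ltr_nat ltn_expl.
  case: (ex_minnP ex) => j kj jmin; exists j => //.
  case: j kj jmin => [|j] kj jmin; first by rewrite expr0 lerDr mulr_ge0.
  have : ~~ (kp < 2 ^+ j) by apply/negP => /jmin; rewrite ltnn.
  by rewrite -leNgt exprS => h; lra.
have rj : rho <= 2 ^- j.
  by rewrite /rho lef_pV2 ?posrE ?exprn_gt0.
have : ((2 ^+ j)%:E <= dyadic_kernel p x)%E.
  clearbody rho kp p; apply: dyadic_kernel_lower.
  move: h1 h2; rewrite !ltr_norml => /andP[? ?] /andP[? ?].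
  by split; rewrite /= in_itv /=; apply/andP; split; lra.
by rewrite kpfin lee_fin leNgt kj.
Qed.

End Selection.

(** * Equivalence of the flows *)

Section Reparametrization.
Context {R : realType}.
Implicit Types (b v w : R -> R).

Definition lipschitz_field b := exists L : R, forall s s', `|b s - b s'| <= L * `|s - s'|.

Definition solves b v := forall t, is_derive t (1 : R) v (b (v t)).

Lemma solves_shift b v c : solves b v -> solves b (fun t => v (t + c)).
Proof.
move=> sv t.
have d1 : is_derive t (1 : R) (fun t : R => t + c) 1.
  have := is_deriveD (is_derive_id t (1 : R)) (is_derive_cst c t (1 : R)).
  by rewrite addr0.
have := @is_derive1_comp R v (fun t => t + c) t _ _ (sv (t + c)) d1.
by rewrite mulr1.
Qed.

Lemma solves_reflect b v : solves b v -> solves (fun s => b (- s)) (fun t => - v (- t)).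
Proof.
move=> sv t.
have d1 : is_derive t (1 : R) (fun t : R => - t) (- 1) by exact: is_deriveNid.
have d2 := @is_derive1_comp R v (fun t => - t) t _ _ (sv (- t)) d1.
have := is_deriveN d2.
by rewrite opprK mulrN1 opprK.
Qed.

(** A solution that meets a zero of [b] is constant by uniqueness. *)
Lemma solves_positive b v : lipschitz_field b -> (forall s, 0 <= b s) -> solves b v ->
  0 < b (v 0) -> forall t, 0 < b (v t).
Proof.
move=> [L bL] b0 sv bv0 t; rewrite lt_neqAle b0 andbT; apply/eqP => bt.
have cst : (fun u => v (u + t)) =1 (fun=> v t).
  apply: (ode_unique bL); last by rewrite add0r.
    exact: solves_shift.
  by move=> u; rewrite -bt; exact: is_derive_cst.
have := cst (- t); rewrite addNr => e; move: bv0; rewrite e -bt ltxx //.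
Qed.

Lemma solves_increasing b v : solves b v -> (forall t, 0 < b (v t)) ->
  {homo v : t t' / t < t'}.
Proof.
move=> sv bv t t' tt'; have [c _ e] := mvt (ltW tt') (fun x _ => sv x).
by rewrite -subr_gt0 e mulr_gt0// subr_gt0.
Qed.

Lemma solves_ivt b v (t1 t2 u : R) : solves b v -> t1 <= t2 -> v t1 <= u <= v t2 ->
  exists2 t, t1 <= t <= t2 & v t = u.
Proof.
move=> sv t12 /andP[u1 u2].
have cv : {within `[t1, t2], continuous v}.
  by apply: continuous_subspaceT => z; exact: is_derive_continuous (sv z).
have v12 : v t1 <= v t2 by exact: le_trans u2.
have [|t tI e] := @IVT R v t1 t2 u t12 cv.
  by rewrite (min_idPl v12) (max_idPr v12) u1.
by exists t => //; move: tI; rewrite in_itv.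
Qed.

(** Between [v 0] and [v t] the field [b] is positive, hence so is [b']; its minimum there bounds
    the time [v'] needs. *)
Lemma solves_reach b b' v v' : lipschitz_field b' ->
  (forall s, 0 <= b' s) -> (forall s, 0 < b s -> 0 < b' s) ->
  solves b v -> solves b' v' -> v 0 = v' 0 -> (forall t, 0 < b (v t)) ->
  forall t, 0 <= t -> exists t', v' t' = v t.
Proof.
move=> [L bL] b0 bb sv sv' e bv t t0.
have vt : v 0 <= v t by move: t0; rewrite le_eqVlt => /orP[/eqP <-//|/(solves_increasing sv bv)/ltW].
have cb : {within `[v 0, v t], continuous b'}.
  apply: continuous_subspaceT => z; apply/cvgrPdist_le => d d0.
  have L0 : 0 < `|L| + 1 by rewrite ltr_wpDl.
  near=> z'; apply: (le_trans (bL _ _)).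
  apply: (@le_trans _ _ ((`|L| + 1) * `|z - z'|)).
    by rewrite ler_wpM2r// (le_trans (ler_norm L))// lerDl.
  rewrite mulrC -ler_pdivlMr//; near: z'.
  have /cvgrPdist_le : id z @[z --> z] --> z by exact: cvg_id.
  by apply; rewrite divr_gt0.
have [c cI cmin] := EVT_min vt cb.
have c0 : 0 < b' c.
  apply: bb; move: cI; rewrite in_itv /= => cI.
  by have [r _ <-] := solves_ivt sv t0 cI; exact: bv.
pose T := (v t - v 0) / b' c.
have T0 : 0 <= T by rewrite divr_ge0 ?subr_ge0 ?(ltW c0).
have mono r r' : r <= r' -> v' r <= v' r'.
  move=> rr; rewrite -subr_ge0 -(mul0r (r' - r)).
  by apply: mvt_ge rr (fun x _ => sv' x) (fun x _ => b0 _).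
have vT : v t <= v' T.
  rewrite leNgt; apply/negP => lt.
  have := mvt_ge (c := b' c) T0 (fun x _ => sv' x).
  have bT : b' c * T = v t - v 0 by rewrite /T mulrC divfK ?gt_eqF.
  rewrite subr0 bT -e => H.
  have : v t - v 0 <= v' T - v 0.
    apply: H => x /andP[x0 xT]; apply: cmin; rewrite in_itv /= e mono//=.
    exact: le_trans (mono _ _ xT) (ltW lt).
  by lra.
have [|t' _ ev] := @solves_ivt b' v' 0 T (v t) sv' T0; first by rewrite -e vt.
by exists t'.
Unshelve. all: by end_near. Qed.

Lemma solves_reach_all b b' v v' : lipschitz_field b' ->
  (forall s, 0 <= b' s) -> (forall s, 0 < b s -> 0 < b' s) ->
  solves b v -> solves b' v' -> v 0 = v' 0 -> (forall t, 0 < b (v t)) ->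
  forall t, exists t', v' t' = v t.
Proof.
move=> Lb b0 bb sv sv' e bv t; have [t0|t0] := leP 0 t; first exact: (solves_reach Lb b0 bb sv sv').
have [L bL] := Lb.
have Lb' : lipschitz_field (fun s => b' (- s)).
  by exists L => s s'; apply: (le_trans (bL _ _)); rewrite -opprD normrN.
have := @solves_reach (fun s => b (- s)) (fun s => b' (- s)) _ _ Lb'
  (fun s => b0 _) (fun s => bb _) (solves_reflect sv) (solves_reflect sv').
rewrite oppr0 e => /(_ erefl) H.
have bvr u : 0 < b (- - v (- u)) by rewrite opprK.
have mt : 0 <= - t by rewrite oppr_ge0 ltW.
have [t' e'] := H bvr _ mt.
by exists (- t'); apply: oppr_inj; rewrite e' opprK.
Qed.

Lemma increasing_surjective_continuous (tau : R -> R) :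
  {homo tau : s t / s < t} -> (forall u, exists t, tau t = u) -> continuous tau.
Proof.
move=> tinc tsurj t0; apply/cvgrPdist_le => e e0.
have mono := leW_mono (le_mono tinc).
have [t1 e1] := tsurj (tau t0 - e); have [t2 e2] := tsurj (tau t0 + e).
have t10 : t1 < t0 by rewrite -mono e1 ltrBlDr ltrDl.
have t02 : t0 < t2 by rewrite -mono e2 ltrDl.
near=> t.
have h1 : tau t1 < tau t by apply: tinc; near: t; exact: lt_nbhsr.
have h2 : tau t < tau t2 by apply: tinc; near: t; exact: lt_nbhsl.
rewrite e1 in h1; rewrite e2 in h2.
by rewrite ler_norml; apply/andP; split; lra.
Unshelve. all: by end_near. Qed.

(** Where the fields are positive, both solutions increase over the same interval and [tau] is the
    inverse of [v'] after [v]. From a common zero both are constant and [id] serves. *)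
Lemma solves_reparam b b' v v' : lipschitz_field b -> lipschitz_field b' ->
  (forall s, 0 <= b s) -> (forall s, 0 <= b' s) -> (forall s, 0 < b s <-> 0 < b' s) ->
  solves b v -> solves b' v' -> v 0 = v' 0 ->
  exists tau : R -> R, [/\ continuous tau, {homo tau : s t / s < t},
    forall u, exists t, tau t = u & forall t, v t = v' (tau t)].
Proof.
move=> Lb Lb' b0 b'0 bb sv sv' e.
have [bv0|/negP nb] := boolP (0 < b (v 0)).
  have bv := solves_positive Lb b0 sv bv0.
  have bv0' : 0 < b' (v' 0) by rewrite -e -bb.
  have bv' := solves_positive Lb' b'0 sv' bv0'.
  have [tau tauP] := choice (solves_reach_all Lb' b'0 (fun s => (bb s).1) sv sv' e bv).
  have inc := solves_increasing sv bv; have inc' := solves_increasing sv' bv'.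
  have mono' := leW_mono (le_mono inc').
  have tinc : {homo tau : s t / s < t}.
    by move=> s t st; rewrite -mono' !tauP; exact: inc.
  have tsurj u : exists t, tau t = u.
    have [t et] := solves_reach_all Lb b0 (fun s => (bb s).2) sv' sv (esym e) bv' u.
    by exists t; apply: (inc_inj (le_mono inc')); rewrite tauP.
  by exists tau; split => //; exact: increasing_surjective_continuous.
have z : b (v 0) = 0 by apply/eqP; rewrite eq_le b0 andbT leNgt; apply/negP.
have z' : b' (v' 0) = 0.
  by apply/eqP; rewrite eq_le b'0 andbT leNgt -e; apply/negP => /bb.
have stat c w : lipschitz_field c -> solves c w -> c (w 0) = 0 -> w =1 fun=> w 0.
  move=> [L cL] sw cw; apply: (ode_unique cL) => //.
  by move=> u; rewrite cw; exact: is_derive_cst.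
exists id; split => //; first by move=> t; exact: cvg_id.
  by move=> u; exists u.
by move=> t; rewrite (stat _ _ Lb sv z) (stat _ _ Lb' sv' z').
Qed.

End Reparametrization.

Section Equivalence.
Context {R : realType} {E : normedModType R} {M : smoothManifold E} (f : diffeo M).
Variables (alpha alpha' : suspension f -> R) (L L' : R).
Variables (sigma sigma' : R -> M -> R -> R) (phi phi' : R -> suspension f -> suspension f).
Hypothesis alpha_ge0 : forall p, 0 <= alpha p.
Hypothesis alpha'_ge0 : forall p, 0 <= alpha' p.
Hypothesis same_zeros : forall p, 0 < alpha p <-> 0 < alpha' p.
Hypothesis alphaL : forall y s s',
  `|alpha (spiR f y s) - alpha (spiR f y s')| <= L * `|s - s'|.
Hypothesis alpha'L : forall y s s',
  `|alpha' (spiR f y s) - alpha' (spiR f y s')| <= L' * `|s - s'|.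
Hypothesis sigma0 : forall y s, sigma 0 y s = s.
Hypothesis sigma'0 : forall y s, sigma' 0 y s = s.
Hypothesis dsigma : forall y s t, is_derive t (1 : R) (fun t => sigma t y s)
        (alpha (spiR f y (sigma t y s))).
Hypothesis dsigma' : forall y s t, is_derive t (1 : R) (fun t => sigma' t y s)
        (alpha' (spiR f y (sigma' t y s))).
Hypothesis phiE : forall t y s, phi t (spiR f y s) = spiR f y (sigma t y s).
Hypothesis phi'E : forall t y s, phi' t (spiR f y s) = spiR f y (sigma' t y s).

Lemma same_zeros_equivalent : equivalent_flows phi phi'.
Proof.
exists id, id; split => //; [by move=> p; exact: cvg_id|by move=> p; exact: cvg_id|].
move=> p; have [y [s [_ ->]]] := spiR_surj p.
have [tau [ctau tinc tsurj tE]] : exists tau : R -> R, [/\ continuous tau,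
    {homo tau : s t / s < t}, forall u, exists t, tau t = u &
    forall t, sigma t y s = sigma' (tau t) y s].
  have Lb : lipschitz_field (fun u => alpha (spiR f y u)) by exists L.
  have Lb' : lipschitz_field (fun u => alpha' (spiR f y u)) by exists L'.
  have e : sigma 0 y s = sigma' 0 y s by rewrite sigma0 sigma'0.
  exact: (solves_reparam Lb Lb' (fun u => alpha_ge0 _) (fun u => alpha'_ge0 _)
    (fun u => same_zeros _) (dsigma y s) (dsigma' y s) e).
split; last first.
  by exists tau; split => // t; rewrite phiE phi'E tE.
rewrite image_id /orbit; apply/seteqP; split=> [_ [t _ <-]|_ [u _ <-]].
  by exists (tau t) => //; rewrite phiE phi'E tE.
by have [t <-] := tsurj u; exists t => //; rewrite phiE phi'E tE.
Qed.

End Equivalence.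

Theorem theorem1p1 (R : realType) (n : nat) (n_ge2 : (2 <= n)%N)
    (M : smoothManifold 'rV[R]_n) (g : riemannianMetric M)
    (M_compact : compact [set: M])
    (f : diffeo M) (f_minimal : minimal f)
    (f_entropy : (0 < topological_entropy R f)%E) :
  exists alpha alpha' : suspension f -> R,
    [/\ suspension_smooth alpha /\ (forall p, 0 <= alpha p <= 1),
        suspension_smooth alpha' /\ (forall p, 0 <= alpha' p <= 1) &
        exists phi phi' : R -> suspension f -> suspension f,
          [/\ induced_flow (scale_field alpha (suspension_field f)) phi,
              induced_flow (scale_field alpha' (suspension_field f)) phi',
              equivalent_flows phi phi',
              flow_entropy phi = 0%E &
              (0 < flow_entropy phi')%E]].
Proof.
have [w _] := positive_entropy_point f_entropy.
have [U [h [oU h0 grow]]] := positive_entropy_growth f_entropy.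
have [V oV star] := barycentric_refinement (@mfd_hausdorff _ _ M) M_compact oU.
have [c0 [z0 [r [Ac0 r0 big]]]] := chart_box w.
pose i0 : 'I_n := Ordinal (ltnW n_ge2); pose i1 : 'I_n := Ordinal n_ge2.
have i01 : i0 != i1 by [].
have seqs N : exists ns : nat * seq M, [/\ (N <= ns.1)%N, (0 < ns.1)%N, uniq ns.2,
    expR (h * ns.1%:R) <= 2 * (size ns.2)%:R &
    forall x y, x \in ns.2 -> y \in ns.2 -> shadows V f ns.1 x y -> x = y].
  have [m [Nm m0 mU]] := grow N.
  (* As [k >= 1], rounding down costs at most a factor 2. *)
  pose k := Num.truncn (expR (h * m%:R)).
  have kle : k%:R <= expR (h * m%:R) by rewrite truncn_le expR_ge0.
  have k1 : (1 <= k)%N.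
    by rewrite truncn_ge_nat ?expR_ge0// -expR0 ler_expR mulr_ge0// ltW.
  have kU : ((k%:R : R)%:E <= min_subcover R (iterated_join f U m))%E.
    by apply: le_trans mU; rewrite lee_fin.
  have [s [us ss sP]] := separated_set oV star kU.
  exists (m, s); split => //=; rewrite ss; apply: (le_trans (ltW (truncnS_gt _))).
  have : (1 : R) <= k%:R by rewrite ler1n.
  by rewrite -/k -natr1; lra.
have [ns nsP] := choice seqs.
have N0 k : (0 < (ns k).1)%N by have [] := nsP k.
have S0 k : (0 < size (ns k).2)%N.
  have [_ _ _ H _] := nsP k; rewrite -(ltr_nat R).
  by have := lt_le_trans (expR_gt0 _) H; rewrite pmulr_rgt0.
have [x [kappa [x1 x2 kap0 sel]]] := slice_selection f c0 z0 r0 i01 N0 S0.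
pose x0 := slice_point z0 r i0 i1 x.
have box (y : 'rV[R]_n) : (forall i, `|y 0 i - x0 0 i| <= r) -> chart_cod c0 y.
  by move=> yr; apply: big; exact: (slice_point_box r0 x1 x2 yr).
have [alpha [sigma [phi [[sa a01 a0 agt] [La La0 aL] [s0 sD ds phiE] ind ent]]]] :=
  slow_field Ac0 r0 box M_compact f_minimal.
pose q := @bump_field R n M f c0 x0 r.
have qc : q (spiR f (chart_inv c0 x0) 2^-1) = 0 := bump_field_center f Ac0 r0 box.
have sq : suspension_smooth q by exact: bump_field_smooth.
have [L [c [C [L0 c1 C1 qL qb]]]] := bump_field_props f c0 x0 r.
have q8 p : 0 <= q p <= 8^-1 by exact: bump_field_bounds.
have q01 p : 0 <= q p <= 1 by have /andP[h1 h2] := q8 p; apply/andP; split; lra.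
have [sigma' [phi' [[s0' sD'] ds' phiE' ind']]] :=
  time_change (suspension_smooth_continuous sq) q01 L0 qL.
exists alpha, q; split => //; exists phi, phi'; split => //.
  apply: (same_zeros_equivalent (L := La) (L' := L) (sigma := sigma) (sigma' := sigma')) => //.
  - by move=> p; have /andP[] := a01 p.
  - by move=> p; have /andP[] := q01 p.
  - move=> p; split=> hp.
      apply: (bump_field_gt0 Ac0 r0) => e; move: hp; rewrite e a0 ltxx //.
    by apply: agt => e; move: hp; rewrite e qc ltxx.
have slow8 y s t t' : `|sigma' t' y s - sigma' t y s| <= 8^-1 * `|t' - t|.
  apply: (mvt_norm (ds' y s)) => u; have /andP[h1 h2] := q8 (spiR f y (sigma' u y s)).
  by rewrite ger0_norm.
have iterE := phi_iter s0' sD' phiE'.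
have C0 : 0 < 39 / c + 1 by rewrite addr_gt0// divr_gt0.
have qlow y s : 0 <= s <= 1 ->
    (chart_dom c0 y -> c * Num.min 1 (profile c0 x0 r y s) <= q (spiR f y s)) /\
    (~ chart_dom c0 y -> c <= q (spiR f y s)).
  by move=> s01; have [h1 h2] := qb y s s01; split => // /h1/andP[].
(* [K = 4]: one factor 2 from the rounding in [seqs], one from keeping only half of the points. *)
apply: (entropy_lower s0' slow8 iterE oV h0 C0 (K := 4)) => // N.
have [k [Nk sumk rhok]] := sel N.
have [kn nk0 us hs sP] := nsP k.
set m := (ns k).1 in kn nk0 hs sP sumk rhok *; set s := (ns k).2 in us hs sP sumk rhok *.
have m0 : 0 < m%:R :> R by rewrite ltr0n.
pose G (y : M) : R := \sum_(i < m) kappa (iter i f y).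
have G0 y : 0 <= G y by apply: sumr_ge0.
have b0 : 0 < 9 * m%:R :> R by rewrite mulr_gt0.
have half := half_below_average b0 G0 sumk.
set s' := [seq y <- s | G y <= 2 * (9 * m%:R)] in half.
(* The i-th cell costs [(3 + 2 kappa) / c], and [G y <= 18 m] for the points kept: in total at most
   [(3 + 36) m / c]. *)
pose t := (Num.truncn (39 * m%:R / c)).+1.
exists m, s', t; split => //.
- exact: leq_trans kn.
- exact: filter_uniq.
- by move=> y y'; rewrite !mem_filter => /andP[_ ys] /andP[_ ys']; exact: sP.
- by apply: (le_trans hs); rewrite -[4](_ : 2 * 2 = _ :> R); [rewrite -mulrA ler_pM2l|ring].
split.
  rewrite /t -natr1 [leRHS]mulrDl mul1r; apply: lerD; last by rewrite ler1n.
  rewrite mulrAC truncn_le.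
  by rewrite mulr_ge0// divr_ge0// ltW.
move=> y; rewrite mem_filter => /andP[Gy ys].
apply: (cross_cells q01 c1 qlow s0' sD' ds'
  (rho := fun i => (2 * kappa (iter i f y) + 1)^-1)) => [i im|].
  split; last by move=> _; exact: rhok.
  by rewrite invr_gt0 ltr_wpDl// mulr_ge0.
apply: (@le_trans _ _ (39 * m%:R / c)); last exact/ltW/truncnS_gt.
have -> : \sum_(i < m) (2 + (2 * kappa (iter i f y) + 1)^-1^-1) / c =
  (3 * m%:R + 2 * G y) / c.
  rewrite -mulr_suml; congr (_ / c); rewrite /G mulr_sumr.
  rewrite (eq_bigr (fun i : 'I_m => 3 + 2 * kappa (iter i f y))); last first.
    by move=> i _; rewrite invrK; ring.
  by rewrite big_split /= sumr_const card_ord mulr_natr.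
by rewrite ler_pM2r ?invr_gt0//; lra.
Qed.
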